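(* Let $\varphi$ be a Jacob's ladder, $\varphi_1(t)=\frac12\varphi(t)$ and $\tilde Z^2(t)=\frac{d\varphi_1(t)}{dt}$. Let $\nu>-1$, let $J_\nu$ be the Bessel function of order $\nu$, and let $\mu_1^{(\nu)}<\mu_2^{(\nu)}<\dots$ be its positive zeros. There is $T_0=T_0[\varphi_1]>0$ such that for every $T\ge T_0$, writing $\mathring{T}=\varphi_1^{-1}(T)$ and $\mathring{(T+1)}=\varphi_1^{-1}(T+1)$ (so that $\varphi_1$ maps $[\mathring{T},\mathring{(T+1)}]$ onto $[T,T+1]$), the system of functions $$J_\nu\big[\mu_n^{(\nu)}(\varphi_1(t)-T)\big],\quad t\in[\mathring{T},\mathring{(T+1)}],\quad n=1,2,\dots$$ is orthogonal on $[\mathring{T},\mathring{(T+1)}]$ with the weight $(\varphi_1(t)-T)\tilde Z^2(t)$. More precisely, $\varphi_1(t)-T\in[0,1]$ for $t\in[\mathring{T},\mathring{(T+1)}]$, and for all positive integers $m,n$ $$\int_{\mathring{T}}^{\mathring{(T+1)}}J_\nu\big[\mu_m^{(\nu)}(\varphi_1(t)-T)\big]\,J_\nu\big[\mu_n^{(\nu)}(\varphi_1(t)-T)\big]\,(\varphi_1(t)-T)\,\tilde Z^2(t)\,dt=0,\qquad m\neq n,$$ $$\int_{\mathring{T}}^{\mathring{(T+1)}}\big\{J_\nu\big[\mu_n^{(\nu)}(\varphi_1(t)-T)\big]\big\}^2(\varphi_1(t)-T)\,\tilde Z^2(t)\,dt=\frac12\big[J_{\nu+1}(\mu_n^{(\nu)})\big]^2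 .$$ Moreover, the distance $\rho$ between the segments satisfies $$\rho\big\{[0,1];[\mathring{T},\mathring{(T+1)}]\big\}\sim T,\qquad T\to\infty .$$
   Context: Hardy's function is $Z(t)=e^{i\vartheta(t)}\zeta\left(\frac12+it\right)$ with $\vartheta(t)=-\frac t2\ln\pi+\operatorname{Im}\ln\Gamma\left(\frac14+i\frac t2\right)$; it is real for real $t$ and $Z^2(t)=\left|\zeta\left(\frac12+it\right)\right|^2$. Jacob's ladder: fix a $C^\infty$ function $\mu(y)$, defined for all sufficiently large $y$, increasing to $+\infty$, with $\mu(y)\ge 7y\ln y$. A Jacob's ladder is the function $\varphi(T)$, defined for all sufficiently large $T$, which is the solution $x(T)=\varphi(T)$ (with large positive values) of the nonlinear integral equation $$\int_0^{\mu[x(T)]}Z^2(t)\,e^{-\frac{2}{x(T)}t}\,dt=\int_0^TZ^2(t)\,dt .$$ It is a strictly increasing, differentiable function tending to $+\infty$. One sets $\varphi_1(t)=\frac12\varphi(t)$; $\varphi_1^{-1}$ denotes its inverse function. Bessel function: $J_\nu(x)=\sum_{r=0}^\infty\frac{(-1)^r}{r!\,\Gamma(\nu+r+1)}\left(\frac x2\right)^{\nu+2r}$ for $x>0$, $\nu>-1$. The distance of two segments $A,B\subset\mathbb R$ is $\rho\{A;B\}=\inf\{|a-b|:a\in A,\ b\in B\}$. The notation $f(T)\sim g(T)$ means $f(T)/g(T)\to1$. *)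

(* Defs.v *)
From Stdlib Require Export Reals Factorial ClassicalEpsilon.
From Coquelicot Require Export Coquelicot.

Open Scope R_scope.

Definition Cexp (z : C) : C := (exp (Re z) * cos (Im z), exp (Re z) * sin (Im z)).

(* Principal logarithm; the formula for the argument is valid for Re z > 0 only. *)
Definition Clog (z : C) : C := (ln (Cmod z), atan (Im z / Re z)).

Definition Clim_seq (u : nat -> C) : C :=
  (real (Lim_seq (fun n => Re (u n))), real (Lim_seq (fun n => Im (u n)))).

(* n^s, meaningful for n >= 1 *)
Definition Cnpow (n : nat) (s : C) : C := Cexp (s * RtoC (ln (INR n)))%C.

(* Riemann zeta function on the half-plane Re s > 0, s <> 1:
     zeta s = lim_N ( sum_(1 <= n <= N) n^(-s) - N^(1-s) / (1-s) ).
   For Re s > 1 the second term tends to 0 and this is the Dirichlet series;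
   the limit is locally uniform on Re s > 0, s <> 1, hence it is the analytic
   continuation of that series. *)
Definition zeta (s : C) : C :=
  Clim_seq (fun N =>
    sum_n_m (fun n => Cnpow n (- s)) 1 N - Cnpow N (1 - s) / (1 - s))%C.

(* Gauss's product: Gamma x = lim_n  n! n^x / (x (x+1) ... (x+n)). *)
Definition Gamma (x : R) : R :=
  real (Lim_seq (fun n =>
    INR (fact n) * Rpower (INR n) x / prod_f_R0 (fun k => x + INR k) n)).

(* The logarithm of the same product on Re s > 0, taken factor by factor with
   principal logarithms: this is the branch of ln Gamma that is analytic on
   Re s > 0 and real for s > 0. *)
Definition lnGamma (s : C) : C :=
  Clim_seq (fun n =>
    RtoC (ln (INR (fact n))) + s * RtoC (ln (INR n))
    - sum_n (fun k => Clog (s + RtoC (INR k))) n)%C.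

Definition theta (t : R) : R :=
  - (t / 2) * ln PI + Im (lnGamma (1 / 4, t / 2)%R).

Definition hardyZ (t : R) : C := (Cexp (0, theta t)%R * zeta (1 / 2, t)%R)%C.

(* hardyZ t lies on the real axis of C, so that its square is the square of its
   modulus, i.e. |zeta (1/2 + it)|^2. *)
Definition hardyZ2 (t : R) : R := Cmod (hardyZ t) ^ 2.

(* mu is a smooth function on the ray ]y0, +oo[, increasing to +oo, with
   mu y >= 7 y ln y; its values outside the ray are irrelevant. *)
Record ladder_bound (mu : R -> R) (y0 : R) : Prop := {
  lb_domain : 0 < y0;
  lb_smooth : forall (n : nat) (y : R), y0 < y -> ex_derive_n mu n y;
  lb_increasing : forall x y : R, y0 < x -> x <= y -> mu x <= mu y;
  lb_lim : is_lim mu p_infty p_infty;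
  lb_lower : forall y : R, y0 < y -> 7 * y * ln y <= mu y
}.

(* A Jacob's ladder phi with domain [T1, +oo[, for the function mu on ]y0, +oo[;
   the values of phi below T1 are irrelevant. *)
Record jacobs_ladder (mu : R -> R) (y0 : R) (phi : R -> R) (T1 : R) : Prop := {
  jl_domain : 0 < T1;
  jl_range : forall T : R, T1 <= T -> y0 < phi T;
  jl_eq : forall T : R, T1 <= T ->
    RInt (fun t => hardyZ2 t * exp (- (2 / phi T) * t)) 0 (mu (phi T))
    = RInt hardyZ2 0 T
}.

(* The inverse of f restricted to [a, +oo[; meaningful when f is injective there
   and y is one of its values. *)
Definition inverse_from (f : R -> R) (a y : R) : R :=
  epsilon (inhabits 0) (fun t => a <= t /\ f t = y).

Definition segment (a b : R) : R -> Prop := fun x => a <= x <= b.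

Definition set_dist (A B : R -> Prop) : R :=
  real (Glb_Rbar (fun d => exists a b : R, A a /\ B b /\ d = Rabs (a - b))).

Definition asymp_equiv (f g : R -> R) : Prop :=
  is_lim (fun T => f T / g T) p_infty 1.

(* J_nu x, for x > 0 and nu > -1 *)
Definition besselJ (nu x : R) : R :=
  Series (fun r : nat =>
    (-1) ^ r / (INR (fact r) * Gamma (nu + INR r + 1))
    * Rpower (x / 2) (nu + 2 * INR r)).

(* j 1 < j 2 < ... are all the positive zeros of J_nu; j 0 is irrelevant. *)
Record bessel_zeros (nu : R) (j : nat -> R) : Prop := {
  bz_zero : forall n : nat, (1 <= n)%nat -> 0 < j n /\ besselJ nu (j n) = 0;
  bz_increasing : forall m n : nat, (1 <= m < n)%nat -> j m < j n;
  bz_all : forall x : R, 0 < x -> besselJ nu x = 0 ->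
    exists n : nat, (1 <= n)%nat /\ x = j n
}.

(* The integral of f over [a, b], as an improper integral at a:
   for -1 < nu < -1/2 the products of Bessel functions integrated over
   [phi_1^{-1}(T), phi_1^{-1}(T+1)] are unbounded near the left end-point (and
   for nu < 0 the Bessel functions are undefined there).  When f is Riemann
   integrable on [a, b] this is its ordinary integral. *)
Definition is_integral (f : R -> R) (a b v : R) : Prop :=
  is_RInt_gen f (at_right a) (at_point b) v.

(* Main.v *)
Require Import Defs.
From Stdlib Require Import Lra Lia Psatz.

(** The Bessel part is the classical orthogonality on [0,1] with weight [u], transported by the substitution [u = phi_1(t) - T], whose Jacobian is the weight [Ztilde2]. Writing [J_nu x = (x/2)^nu E(x^2/4)] with [E] entire, the integrands have explicit primitives that tend to [0] at [0+] for every [nu > -1].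

The ladder is regular because [F x = int_0^(mu x) Z^2 e^(-2t/x) dt] has a positive continuous derivative and [M T = int_0^T Z^2] is strictly increasing: [(1-s) zeta s] on the critical line has [k]-th derivatives [O(k! 4^k)], so it is real analytic and [Z^2] vanishes on no interval.

The asymptotics rest on Hardy and Littlewood's [M T ~ T ln T]. For [N] of order [|t|], [zeta s = sum_(n <= N) n^(-s) + O(sqrt N / |s|)] follows by partial summation from [n^(-s) = rho_n (P_(n+1) - P_n)] with [P_n = n^(1-s)/(1-s)] and slowly varying [rho_n]. Against the weight [T - t] the off-diagonal terms of the mean square of the sum are [O(N^2) = O(T^2)], since they are [(1 - cos (T L)) / L^2] with [L = ln (n/m)]; monotonicity of [M] removes the weight. Then [F (2X) ~ X ln X] by integration by parts, and [F (phi T) = M T] gives [phi_1 T ~ T]. *)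

(** * Complex powers of real numbers *)

(** Every limit in the definitions is [real (Lim_seq _)], which takes a default value when the
    sequence diverges, so each convergence is proved with an explicit rate before the limit is used.
    The ratio of [P_(n+1) - P_n] to [n^(-s)] is used and not their difference: the differences have
    size [|s| n^(-3/2)], and their sum from [N] of order [|t|] on is of order [sqrt |t|], far too
    large for the mean square. The ratio is close to a constant as soon as [n] exceeds a multiple of
    [|s|]. The weight [T - t] stands in for a Hilbert-type inequality. Without it the off-diagonal
    terms are [sin (T L) / L], of either sign and of first order in [1 / L]; estimated in absolute
    value they total about [T ln T], as much as the main term. For [phi] only its equation and its
    range are given. Continuity, monotonicity and differentiability come from writing [phi] as the
    inverse of [F] composed with [M], which requires both to be strictly increasing; this is what
    the analyticity of [(1-s) zeta s] is for. *)

Definition cpow (x : R) (z : C) : C := Cexp (z * RtoC (ln x))%C.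

Lemma Cexp_plus (a b : C) : Cexp (a + b) = (Cexp a * Cexp b)%C.
Proof.
  destruct a as [a1 a2], b as [b1 b2]. unfold Cexp, Cplus, Cmult; simpl.
  rewrite exp_plus, cos_plus, sin_plus. f_equal; ring.
Qed.

Lemma Cmod_Cexp (z : C) : Cmod (Cexp z) = exp (Re z).
Proof.
  unfold Cmod, Cexp; simpl.
  replace (_ + _) with (exp (Re z) ^ 2 * (Rsqr (sin (Im z)) + Rsqr (cos (Im z))))
    by (unfold Rsqr; ring).
  rewrite sin2_cos2, Rmult_1_r, sqrt_pow2; [reflexivity | left; apply exp_pos].
Qed.

Lemma cpow_1 (z : C) : cpow 1 z = 1%C.
Proof.
  unfold cpow, Cexp. rewrite ln_1. destruct z as [a b]; simpl.
  replace (a * 0 - b * 0) with 0 by ring.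
  replace (a * 0 + b * 0) with 0 by ring.
  rewrite exp_0, cos_0, sin_0. unfold RtoC. f_equal; ring.
Qed.

Lemma cpow_mult (x y : R) (z : C) :
  0 < x -> 0 < y -> cpow (x * y) z = (cpow x z * cpow y z)%C.
Proof.
  intros Hx Hy. unfold cpow. rewrite <- Cexp_plus, ln_mult by assumption.
  f_equal. rewrite RtoC_plus. ring.
Qed.

Lemma cpow_plus (x : R) (z w : C) : cpow x (z + w) = (cpow x z * cpow x w)%C.
Proof. unfold cpow. rewrite <- Cexp_plus. f_equal. ring. Qed.

Lemma cpow_id (x : R) : 0 < x -> cpow x 1 = RtoC x.
Proof.
  intros Hx. unfold cpow, Cexp; simpl.
  replace (1 * ln x - 0 * 0) with (ln x) by ring.
  replace (1 * 0 + 0 * ln x) with 0 by ring.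
  rewrite exp_ln, cos_0, sin_0 by assumption. unfold RtoC. f_equal; ring.
Qed.

Lemma cpow_succ (x : R) (z : C) : 0 < x -> cpow x (1 + z) = (RtoC x * cpow x z)%C.
Proof. intros Hx. now rewrite cpow_plus, cpow_id. Qed.

Lemma cpow_re (x : R) (z : C) : Re (cpow x z) = exp (Re z * ln x) * cos (Im z * ln x).
Proof.
  unfold cpow, Cexp. destruct z as [a b]; simpl.
  f_equal; f_equal; ring.
Qed.

Lemma cpow_im (x : R) (z : C) : Im (cpow x z) = exp (Re z * ln x) * sin (Im z * ln x).
Proof.
  unfold cpow, Cexp. destruct z as [a b]; simpl.
  f_equal; f_equal; ring.
Qed.

Lemma Cmod_cpow (x : R) (z : C) : Cmod (cpow x z) = exp (Re z * ln x).
Proof.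
  unfold cpow. rewrite Cmod_Cexp. f_equal. destruct z; simpl; ring.
Qed.

Lemma im_le_Cmod (z : C) : Rabs (Im z) <= Cmod z.
Proof.
  eapply Rle_trans; [| apply Rmax_Cmod]. apply Rmax_r.
Qed.

Lemma is_derive_cpow_re (x : R) (z : C) : 0 < x ->
  is_derive (fun y => Re (cpow y z)) x (Re (z * cpow x z)%C / x).
Proof.
  intros Hx. apply is_derive_ext with (fun y => exp (Re z * ln y) * cos (Im z * ln y)).
  { intros y; symmetry; apply cpow_re. }
  auto_derive; [tauto |].
  pose proof (cpow_re x z) as H1. pose proof (cpow_im x z) as H2.
  destruct (cpow x z) as [u v], z as [a b]; simpl in *.
  subst u v. field. lra.
Qed.

Lemma is_derive_cpow_im (x : R) (z : C) : 0 < x ->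
  is_derive (fun y => Im (cpow y z)) x (Im (z * cpow x z)%C / x).
Proof.
  intros Hx. apply is_derive_ext with (fun y => exp (Re z * ln y) * sin (Im z * ln y)).
  { intros y; symmetry; apply cpow_im. }
  auto_derive; [tauto |].
  pose proof (cpow_re x z) as H1. pose proof (cpow_im x z) as H2.
  destruct (cpow x z) as [u v], z as [a b]; simpl in *.
  subst u v. field. lra.
Qed.

Lemma lipschitz_of_derive (f df : R -> R) (a b K : R) :
  (forall x, Rmin a b <= x <= Rmax a b -> is_derive f x (df x) /\ Rabs (df x) <= K) ->
  Rabs (f b - f a) <= K * Rabs (b - a).
Proof.
  intros H.
  destruct (MVT_gen f a b df) as [c [Hc ->]].
  - intros x Hx. apply H. lra.
  - intros x Hx. apply continuity_pt_filterlim.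
    apply (ex_derive_continuous f). exists (df x). now apply H.
  - rewrite Rabs_mult. apply Rmult_le_compat_r; [apply Rabs_pos | now apply H].
Qed.

Lemma exp_monotone (x y : R) : x <= y -> exp x <= exp y.
Proof. intros [H | ->]; [left; now apply exp_increasing | lra]. Qed.

Lemma ln_nonneg (x : R) : 1 <= x -> 0 <= ln x.
Proof.
  intros H. rewrite <- ln_1. destruct H as [H | <-]; [left; apply ln_increasing |]; lra.
Qed.

Lemma ln_diff_ge (x y : R) : 0 < x -> x <= y -> (y - x) / y <= ln y - ln x.
Proof.
  intros Hx Hy. pose proof (exp_ineq1_le (ln x - ln y)) as H.
  replace (exp (ln x - ln y)) with (x / y) in H.
  - replace ((y - x) / y) with (1 - x / y) by (field; lra). lra.
  - unfold Rminus. rewrite exp_plus, exp_Ropp, !exp_ln by lra. reflexivity.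
Qed.

Lemma Cmod_deriv_cpow_le (z : C) (x : R) : Re z <= 0 -> 1 <= x ->
  Cmod (z * cpow x z)%C / x <= Cmod z.
Proof.
  intros Hz Hx. rewrite Cmod_mult, Cmod_cpow.
  assert (H : exp (Re z * ln x) <= 1).
  { rewrite <- exp_0. apply exp_monotone. pose proof (ln_nonneg x Hx). nra. }
  apply Rle_div_l; [lra |].
  pose proof (Cmod_ge_0 z). pose proof (exp_pos (Re z * ln x)).
  apply Rle_trans with (Cmod z * 1); [apply Rmult_le_compat_l | apply Rmult_le_compat_l]; lra.
Qed.

Lemma cpow_re_lipschitz (z : C) (x y : R) : Re z <= 0 -> 1 <= x -> 1 <= y ->
  Rabs (Re (cpow y z) - Re (cpow x z)) <= Cmod z * Rabs (y - x).
Proof.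
  intros Hz Hx Hy.
  apply (lipschitz_of_derive (fun y => Re (cpow y z)) (fun y => Re (z * cpow y z)%C / y)).
  intros u Hu. assert (1 <= u) by (unfold Rmin in Hu; destruct (Rle_dec x y); lra).
  split; [apply is_derive_cpow_re; lra |].
  eapply Rle_trans; [| apply Cmod_deriv_cpow_le; eassumption].
  unfold Rdiv. rewrite Rabs_mult, (Rabs_pos_eq (/ u)) by (left; apply Rinv_0_lt_compat; lra).
  apply Rmult_le_compat_r; [left; apply Rinv_0_lt_compat; lra | apply re_le_Cmod].
Qed.

Lemma cpow_im_lipschitz (z : C) (x y : R) : Re z <= 0 -> 1 <= x -> 1 <= y ->
  Rabs (Im (cpow y z) - Im (cpow x z)) <= Cmod z * Rabs (y - x).
Proof.
  intros Hz Hx Hy.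
  apply (lipschitz_of_derive (fun y => Im (cpow y z)) (fun y => Im (z * cpow y z)%C / y)).
  intros u Hu. assert (1 <= u) by (unfold Rmin in Hu; destruct (Rle_dec x y); lra).
  split; [apply is_derive_cpow_im; lra |].
  eapply Rle_trans; [| apply Cmod_deriv_cpow_le; eassumption].
  unfold Rdiv. rewrite Rabs_mult, (Rabs_pos_eq (/ u)) by (left; apply Rinv_0_lt_compat; lra).
  apply Rmult_le_compat_r; [left; apply Rinv_0_lt_compat; lra | apply im_le_Cmod].
Qed.

(* [int_0^1 (1 + u y)^z du], so that [n^(z+1) + (z+1) n^z avg z (1/n) = (n+1)^(z+1)] *)
Definition avg (z : C) (y : R) : C :=
  (RInt (fun u => Re (cpow (1 + u * y) z)) 0 1,
   RInt (fun u => Im (cpow (1 + u * y) z)) 0 1).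

Lemma ex_RInt_cpow_re (z : C) (y : R) : 0 <= y ->
  ex_RInt (fun u => Re (cpow (1 + u * y) z)) 0 1.
Proof.
  intros Hy. apply (ex_RInt_continuous (V := R_CompleteNormedModule)).
  intros u. rewrite Rmin_left, Rmax_right by lra. intros Hu.
  apply (continuous_comp (fun u => 1 + u * y) (fun v => Re (cpow v z))).
  - apply (ex_derive_continuous (fun u => 1 + u * y)). auto_derive; trivial.
  - apply (ex_derive_continuous (fun v => Re (cpow v z))).
    eexists. apply is_derive_cpow_re. nra.
Qed.

Lemma ex_RInt_cpow_im (z : C) (y : R) : 0 <= y ->
  ex_RInt (fun u => Im (cpow (1 + u * y) z)) 0 1.
Proof.
  intros Hy. apply (ex_RInt_continuous (V := R_CompleteNormedModule)).
  intros u. rewrite Rmin_left, Rmax_right by lra. intros Hu.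
  apply (continuous_comp (fun u => 1 + u * y) (fun v => Im (cpow v z))).
  - apply (ex_derive_continuous (fun u => 1 + u * y)). auto_derive; trivial.
  - apply (ex_derive_continuous (fun v => Im (cpow v z))).
    eexists. apply is_derive_cpow_im. nra.
Qed.

Lemma avg_0 (z : C) : avg z 0 = 1%C.
Proof.
  unfold avg, RtoC. f_equal.
  - rewrite (RInt_ext _ (fun _ => 1)).
    + rewrite RInt_const. unfold scal; simpl; unfold mult; simpl; ring.
    + intros u _. rewrite Rmult_0_r, Rplus_0_r, cpow_1. reflexivity.
  - rewrite (RInt_ext _ (fun _ => 0)).
    + rewrite RInt_const. unfold scal; simpl; unfold mult; simpl; ring.
    + intros u _. rewrite Rmult_0_r, Rplus_0_r, cpow_1. reflexivity.
Qed.

Lemma Cmod_le_of_parts (z : C) (M : R) :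
  Rabs (Re z) <= M -> Rabs (Im z) <= M -> Cmod z <= 2 * M.
Proof.
  intros H1 H2. destruct z as [a b]; simpl in *.
  pose proof (Rabs_pos a).
  unfold Cmod; simpl. rewrite <- (sqrt_pow2 (2 * M)) by lra.
  apply sqrt_le_1_alt.
  apply Rabs_le_between in H1, H2.
  assert (a * a <= M * M) by nra. assert (b * b <= M * M) by nra.
  nra.
Qed.

Lemma avg_lipschitz (z : C) (x y : R) : Re z <= 0 -> 0 <= x -> 0 <= y ->
  Cmod (avg z y - avg z x)%C <= 2 * (Cmod z * Rabs (y - x)).
Proof.
  intros Hz Hx Hy.
  apply Cmod_le_of_parts.
  - change (Re (avg z y - avg z x)%C) with
      (RInt (fun u => Re (cpow (1 + u * y) z)) 0 1 - RInt (fun u => Re (cpow (1 + u * x) z)) 0 1).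
    rewrite <- (RInt_minus (V := R_CompleteNormedModule)) by (apply ex_RInt_cpow_re; assumption).
    rewrite <- (Rmult_1_l (Cmod z * _)). replace 1 with (1 - 0) at 2 by ring.
    apply abs_RInt_le_const; [lra | |].
    + apply (ex_RInt_minus (V := R_NormedModule)); apply ex_RInt_cpow_re; assumption.
    + intros u Hu. eapply Rle_trans; [apply (cpow_re_lipschitz z (1 + u * x) (1 + u * y)); nra |].
      apply Rmult_le_compat_l; [apply Cmod_ge_0 |].
      replace (1 + u * y - (1 + u * x)) with (u * (y - x)) by ring.
      rewrite Rabs_mult, (Rabs_pos_eq u) by lra. pose proof (Rabs_pos (y - x)). nra.
  - change (Im (avg z y - avg z x)%C) with
      (RInt (fun u => Im (cpow (1 + u * y) z)) 0 1 - RInt (fun u => Im (cpow (1 + u * x) z)) 0 1).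
    rewrite <- (RInt_minus (V := R_CompleteNormedModule)) by (apply ex_RInt_cpow_im; assumption).
    rewrite <- (Rmult_1_l (Cmod z * _)). replace 1 with (1 - 0) at 2 by ring.
    apply abs_RInt_le_const; [lra | |].
    + apply (ex_RInt_minus (V := R_NormedModule)); apply ex_RInt_cpow_im; assumption.
    + intros u Hu. eapply Rle_trans; [apply (cpow_im_lipschitz z (1 + u * x) (1 + u * y)); nra |].
      apply Rmult_le_compat_l; [apply Cmod_ge_0 |].
      replace (1 + u * y - (1 + u * x)) with (u * (y - x)) by ring.
      rewrite Rabs_mult, (Rabs_pos_eq u) by lra. pose proof (Rabs_pos (y - x)). nra.
Qed.

Lemma RInt_lin2 (f g : R -> R) (p q a b : R) : ex_RInt f a b -> ex_RInt g a b ->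
  is_RInt (fun u => p * f u + q * g u) a b (p * RInt f a b + q * RInt g a b).
Proof.
  intros Hf Hg.
  apply (is_RInt_plus (V := R_NormedModule) (fun u => p * f u) (fun u => q * g u)).
  - apply (is_RInt_scal (V := R_NormedModule) f).
    exact (RInt_correct (V := R_CompleteNormedModule) f a b Hf).
  - apply (is_RInt_scal (V := R_NormedModule) g).
    exact (RInt_correct (V := R_CompleteNormedModule) g a b Hg).
Qed.

Lemma continuous_lin2 (f g : R -> R) (p q x : R) : continuous f x -> continuous g x ->
  continuous (fun u => p * f u + q * g u) x.
Proof.
  intros Hf Hg.
  apply (continuous_plus (V := R_NormedModule) (fun u => p * f u) (fun u => q * g u)).
  - exact (continuous_scal_r (V := R_NormedModule) p f x Hf).
  - exact (continuous_scal_r (V := R_NormedModule) q g x Hg).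
Qed.

Lemma avg_eq (z : C) (y : R) : 0 <= y ->
  (RtoC y * ((1 + z) * avg z y) = cpow (1 + y) (1 + z) - 1)%C.
Proof.
  intros Hy. destruct z as [a b]. set (z := (a, b) : C).
  assert (HD : forall u, 0 <= u ->
    is_derive (fun u => Re (cpow (1 + u * y) (1 + z))) u
      (y * (1 + a) * Re (cpow (1 + u * y) z) + - (y * b) * Im (cpow (1 + u * y) z))
    /\ is_derive (fun u => Im (cpow (1 + u * y) (1 + z))) u
      (y * b * Re (cpow (1 + u * y) z) + (y * (1 + a)) * Im (cpow (1 + u * y) z))).
  { intros u Hu. assert (Hp : 0 < 1 + u * y) by nra.
    split.
    - evar_last.
      + apply (is_derive_comp (fun v => Re (cpow v (1 + z))) (fun u => 1 + u * y)).
        * now apply is_derive_cpow_re.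
        * auto_derive; trivial.
      + rewrite cpow_succ by assumption. unfold scal; simpl; unfold mult; simpl.
        destruct (cpow (1 + u * y) z) as [c d]; simpl. field. lra.
    - evar_last.
      + apply (is_derive_comp (fun v => Im (cpow v (1 + z))) (fun u => 1 + u * y)).
        * now apply is_derive_cpow_im.
        * auto_derive; trivial.
      + rewrite cpow_succ by assumption. unfold scal; simpl; unfold mult; simpl.
        destruct (cpow (1 + u * y) z) as [c d]; simpl. field. lra. }
  pose proof (ex_RInt_cpow_re z y Hy) as Er. pose proof (ex_RInt_cpow_im z y Hy) as Ei.
  assert (Hc : forall u, 0 <= u -> continuous (fun u => Re (cpow (1 + u * y) z)) u /\
     continuous (fun u => Im (cpow (1 + u * y) z)) u).
  { intros u Hu. split.
    - apply (continuous_comp (fun u => 1 + u * y) (fun v => Re (cpow v z))).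
      + apply (ex_derive_continuous (fun u => 1 + u * y)). auto_derive; trivial.
      + apply (ex_derive_continuous (fun v => Re (cpow v z))).
        eexists. apply is_derive_cpow_re. nra.
    - apply (continuous_comp (fun u => 1 + u * y) (fun v => Im (cpow v z))).
      + apply (ex_derive_continuous (fun u => 1 + u * y)). auto_derive; trivial.
      + apply (ex_derive_continuous (fun v => Im (cpow v z))).
        eexists. apply is_derive_cpow_im. nra. }
  assert (H1 : y * (1 + a) * RInt (fun u => Re (cpow (1 + u * y) z)) 0 1 +
     - (y * b) * RInt (fun u => Im (cpow (1 + u * y) z)) 0 1 =
     Re (cpow (1 + 1 * y) (1 + z)) - Re (cpow (1 + 0 * y) (1 + z))).
  { rewrite <- (is_RInt_unique _ _ _ _ (RInt_lin2 _ _ (y * (1 + a)) (- (y * b)) 0 1 Er Ei)).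
    apply is_RInt_unique.
    apply (is_RInt_derive (V := R_CompleteNormedModule) (fun u => Re (cpow (1 + u * y) (1 + z)))
      (fun u => (y * (1 + a)) * Re (cpow (1 + u * y) z) + (- (y * b)) * Im (cpow (1 + u * y) z))).
    - intros u. rewrite Rmin_left, Rmax_right by lra. intros Hu. exact (proj1 (HD u (proj1 Hu))).
    - intros u. rewrite Rmin_left, Rmax_right by lra. intros Hu.
      apply (continuous_lin2 (fun u => Re (cpow (1 + u * y) z))
        (fun u => Im (cpow (1 + u * y) z)) (y * (1 + a)) (- (y * b)) u);
        [exact (proj1 (Hc u (proj1 Hu))) | exact (proj2 (Hc u (proj1 Hu)))]. }
  assert (H2 : y * b * RInt (fun u => Re (cpow (1 + u * y) z)) 0 1 +
     (y * (1 + a)) * RInt (fun u => Im (cpow (1 + u * y) z)) 0 1 =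
     Im (cpow (1 + 1 * y) (1 + z)) - Im (cpow (1 + 0 * y) (1 + z))).
  { rewrite <- (is_RInt_unique _ _ _ _ (RInt_lin2 _ _ (y * b) (y * (1 + a)) 0 1 Er Ei)).
    apply is_RInt_unique.
    apply (is_RInt_derive (V := R_CompleteNormedModule) (fun u => Im (cpow (1 + u * y) (1 + z)))
      (fun u => (y * b) * Re (cpow (1 + u * y) z) + (y * (1 + a)) * Im (cpow (1 + u * y) z))).
    - intros u. rewrite Rmin_left, Rmax_right by lra. intros Hu. exact (proj2 (HD u (proj1 Hu))).
    - intros u. rewrite Rmin_left, Rmax_right by lra. intros Hu.
      apply (continuous_lin2 (fun u => Re (cpow (1 + u * y) z))
        (fun u => Im (cpow (1 + u * y) z)) (y * b) (y * (1 + a)) u);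
        [exact (proj1 (Hc u (proj1 Hu))) | exact (proj2 (Hc u (proj1 Hu)))]. }
  rewrite Rmult_1_l, Rmult_0_l, Rplus_0_r, cpow_1 in H1, H2.
  unfold avg. destruct (cpow (1 + y) (1 + z)) as [p q]. subst z. simpl in H1, H2.
  unfold Cmult, Cplus, Cminus, Copp, RtoC; simpl.
  apply injective_projections; simpl; lra.
Qed.

(** * Approximation of zeta on the critical line *)

Definition half (t : R) : C := (1 / 2, t)%R.
Definition dsum (t : R) (N : nat) : C := sum_n_m (fun n => Cnpow n (- half t)) 1 N.
Definition prim (t : R) (n : nat) : C := (Cnpow n (1 - half t) / (1 - half t))%C.
Definition rho (t : R) (n : nat) : C := (/ avg (- half t) (/ INR n))%C.
(** Partial summation: from [n^(-s) = rho_n (P_(n+1) - P_n)], consecutive values differ only by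
    [(rho_n - rho_(n+1)) P_(n+1)]. The boundary term at [n] goes with the sum of the terms below
    [n], whence [pred n]. *)
Definition theta_seq (t : R) (n : nat) : C := (dsum t (pred n) - rho t n * prim t n)%C.

Lemma Cmod_half_sqr (t : R) : Cmod (half t) ^ 2 = 1 / 4 + t ^ 2.
Proof. rewrite Cmod2_alt. simpl. field. Qed.

Lemma Cmod_half_ge (t : R) : 1 / 2 <= Cmod (half t).
Proof. eapply Rle_trans; [| apply re_le_Cmod]. simpl. rewrite Rabs_pos_eq; lra. Qed.

Lemma Cmod_half_conj (t : R) : Cmod (1 - half t)%C = Cmod (half t).
Proof. unfold Cmod, half; simpl. f_equal. field. Qed.

Lemma one_minus_half_neq_0 (t : R) : (1 - half t)%C <> 0.
Proof.
  apply Cmod_gt_0. rewrite Cmod_half_conj. pose proof (Cmod_half_ge t). lra.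
Qed.

Lemma exp_half_ln (x : R) : 0 < x -> exp (1 / 2 * ln x) = sqrt x.
Proof.
  intros Hx. replace (1 / 2 * ln x) with (/ 2 * ln x) by field.
  fold (Rpower x (/ 2)). now apply Rpower_sqrt.
Qed.

Lemma Cmod_Cnpow_half (t : R) (n : nat) : (1 <= n)%nat ->
  Cmod (Cnpow n (- half t)) = / sqrt (INR n).
Proof.
  intros Hn. apply (lt_0_INR n) in Hn.
  change (Cnpow n (- half t)) with (cpow (INR n) (- half t)).
  rewrite Cmod_cpow. simpl.
  replace (- (1 / 2) * ln (INR n)) with (- (1 / 2 * ln (INR n))) by ring.
  rewrite exp_Ropp, exp_half_ln by assumption. reflexivity.
Qed.

Lemma Cmod_prim (t : R) (n : nat) : (1 <= n)%nat ->
  Cmod (prim t n) = sqrt (INR n) / Cmod (half t).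
Proof.
  intros Hn. apply (lt_0_INR n) in Hn. unfold prim.
  rewrite Cmod_div by apply one_minus_half_neq_0. rewrite Cmod_half_conj. f_equal.
  change (Cnpow n (1 - half t)) with (cpow (INR n) (1 - half t)).
  rewrite Cmod_cpow. simpl. rewrite <- exp_half_ln by assumption. f_equal. field.
Qed.

(** This is [avg_eq] at [y = 1/n], after [(n+1)^(1-s) = n^(1-s) (1 + 1/n)^(1-s)]. *)
Lemma prim_step (t : R) (n : nat) : (1 <= n)%nat ->
  (Cnpow n (- half t) * avg (- half t) (/ INR n))%C = (prim t (S n) - prim t n)%C.
Proof.
  intros Hn. apply (lt_0_INR n) in Hn. set (x := INR n) in *.
  pose proof (one_minus_half_neq_0 t) as Hs.
  assert (Hx : 0 < / x) by now apply Rinv_0_lt_compat.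
  assert (Hxc : RtoC x <> 0) by (intros E; injection E; lra).
  pose proof (avg_eq (- half t) (/ x) (Rlt_le _ _ Hx)) as H.
  unfold prim.
  change (Cnpow n (- half t)) with (cpow x (- half t)).
  change (Cnpow n (1 - half t)) with (cpow x (1 + - half t)).
  change (Cnpow (S n) (1 - half t)) with (cpow (INR (S n)) (1 + - half t)).
  rewrite S_INR. fold x. replace (x + 1) with (x * (1 + / x)) by (field; lra).
  rewrite cpow_mult by lra.
  assert (H2 : cpow (1 + / x) (1 + - half t) =
    (1 + RtoC (/ x) * ((1 + - half t) * avg (- half t) (/ x)))%C) by (rewrite H; ring).
  rewrite H2, cpow_succ by assumption. rewrite RtoC_inv by lra. field.
  split; [exact Hs | exact Hxc].
Qed.

(** The threshold [4 |s| <= n] makes the Lipschitz bound [2 |s| / n] at most [1/2], so [avg] stays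
    in the disc of radius [1/2] about [1] and its inverse [rho] is at most [2]. *)
Lemma avg_bound (t : R) (n : nat) : (1 <= n)%nat -> 4 * Cmod (half t) <= INR n ->
  Cmod (avg (- half t) (/ INR n) - 1)%C <= 2 * Cmod (half t) / INR n /\
  1 / 2 <= Cmod (avg (- half t) (/ INR n)).
Proof.
  intros Hn H. apply (lt_0_INR n) in Hn. set (x := INR n) in *.
  assert (Hx : 0 < / x) by now apply Rinv_0_lt_compat.
  assert (H1 : Cmod (avg (- half t) (/ x) - 1)%C <= 2 * Cmod (half t) / x).
  { rewrite <- (avg_0 (- half t)).
    eapply Rle_trans; [apply avg_lipschitz; simpl; lra |].
    rewrite Cmod_opp, Rminus_0_r, Rabs_pos_eq by lra. right. field. lra. }
  split; [exact H1 |].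
  assert (H2 : 2 * Cmod (half t) / x <= 1 / 2) by (apply Rle_div_l; lra).
  pose proof (Cmod_triangle (avg (- half t) (/ x)) (- (avg (- half t) (/ x) - 1))%C) as H3.
  rewrite Cmod_opp in H3.
  replace (avg (- half t) (/ x) + - (avg (- half t) (/ x) - 1))%C with (RtoC 1) in H3 by ring.
  rewrite Cmod_1 in H3. lra.
Qed.

Lemma rho_bound (t : R) (n : nat) : (1 <= n)%nat -> 4 * Cmod (half t) <= INR n ->
  Cmod (rho t n) <= 2 /\ Cmod (rho t n - 1)%C <= 4 * Cmod (half t) / INR n.
Proof.
  intros Hn H. destruct (avg_bound t n Hn H) as [H1 H2].
  assert (Ha : avg (- half t) (/ INR n) <> 0) by (apply Cmod_gt_0; lra).
  assert (H3 : Cmod (rho t n) <= 2).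
  { unfold rho. rewrite Cmod_inv by exact Ha.
    replace 2 with (/ (1 / 2)) by field. apply Rinv_le_contravar; lra. }
  split; [exact H3 |].
  replace (rho t n - 1)%C with (- (rho t n * (avg (- half t) (/ INR n) - 1)))%C
    by (unfold rho; field; exact Ha).
  rewrite Cmod_opp, Cmod_mult.
  replace (4 * Cmod (half t) / INR n) with (2 * (2 * Cmod (half t) / INR n))
    by (field; apply not_0_INR; lia).
  apply Rmult_le_compat; try apply Cmod_ge_0; assumption.
Qed.

Lemma rho_diff (t : R) (n : nat) : (1 <= n)%nat -> 4 * Cmod (half t) <= INR n ->
  Cmod (rho t n - rho t (S n))%C <= 8 * Cmod (half t) / (INR n * INR (S n)).
Proof.
  intros Hn H. assert (Hn' : 0 < INR n) by now apply (lt_0_INR n).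
  assert (H' : 4 * Cmod (half t) <= INR (S n)) by (rewrite S_INR; lra).
  destruct (avg_bound t n Hn H) as [_ A1].
  destruct (avg_bound t (S n) ltac:(lia) H') as [_ A2].
  destruct (rho_bound t n Hn H) as [B1 _].
  destruct (rho_bound t (S n) ltac:(lia) H') as [B2 _].
  assert (Ha : avg (- half t) (/ INR n) <> 0) by (apply Cmod_gt_0; lra).
  assert (Hb : avg (- half t) (/ INR (S n)) <> 0) by (apply Cmod_gt_0; lra).
  replace (rho t n - rho t (S n))%C with
    (rho t n * rho t (S n) * (avg (- half t) (/ INR (S n)) - avg (- half t) (/ INR n)))%C
    by (unfold rho; field; split; assumption).
  rewrite !Cmod_mult.
  assert (Hp : 0 < / INR (S n)) by (apply Rinv_0_lt_compat, lt_0_INR; lia).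
  assert (Hle : / INR (S n) <= / INR n) by (apply Rinv_le_contravar; [| rewrite S_INR]; lra).
  assert (H1 : Cmod (avg (- half t) (/ INR (S n)) - avg (- half t) (/ INR n))%C <=
    2 * (Cmod (half t) * (/ INR n - / INR (S n)))).
  { eapply Rle_trans; [apply avg_lipschitz; simpl Re; lra |].
    rewrite Cmod_opp, Rabs_left1 by lra. right; ring. }
  replace (8 * Cmod (half t) / (INR n * INR (S n))) with
    (2 * 2 * (2 * (Cmod (half t) * (/ INR n - / INR (S n)))))
    by (rewrite S_INR; field; lra).
  apply Rmult_le_compat; try apply Cmod_ge_0; [| | exact H1].
  - apply Rmult_le_pos; apply Cmod_ge_0.
  - apply Rmult_le_compat; try apply Cmod_ge_0; assumption.
Qed.

(** Turns terms of size [x^(-3/2)] into differences that telescope; it serves both the tail of zeta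
    and the off-diagonal terms of the mean square. The [3] is [1 + 2], from
    [sqrt (x + 1) <= 2 sqrt x]. *)
Lemma inv_sqrt_telescope (x : R) : 1 <= x ->
  / (x * sqrt (x + 1)) <= 3 * (/ sqrt x - / sqrt (x + 1)).
Proof.
  intros Hx. set (a := sqrt x). set (b := sqrt (x + 1)).
  assert (Ha : a * a = x) by (apply sqrt_sqrt; lra).
  assert (Hb : b * b = x + 1) by (apply sqrt_sqrt; lra).
  assert (Pa : 0 < a) by (apply sqrt_lt_R0; lra).
  assert (Pb : 0 < b) by (apply sqrt_lt_R0; lra).
  assert (Hab : b <= 2 * a) by nra.
  rewrite <- Ha.
  replace (/ a - / b) with (/ (a * b * (a + b))).
  2:{ assert (E : (b - a) * (a + b) = 1) by (ring_simplify; nra).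
      transitivity (((b - a) * (a + b)) / (a * b * (a + b))).
      - rewrite E. field. repeat split; nra.
      - field. repeat split; nra. }
  replace (3 * / (a * b * (a + b))) with (/ (a * b * (a + b) / 3))
    by (field; repeat split; nra).
  apply Rinv_le_contravar.
  - apply Rdiv_lt_0_compat; [| lra]. repeat apply Rmult_lt_0_compat; lra.
  - apply Rle_div_l; [lra |].
    replace (a * a * b * 3) with ((a * b) * (3 * a)) by ring.
    apply Rmult_le_compat_l; nra.
Qed.

(** The factor [|s|] in [rho_n - rho_(n+1)] cancels against the [1 / |s|] in [P_(n+1)], leaving
    [8 / (n sqrt (n+1))] uniformly in [t]. *)
Lemma theta_seq_step (t : R) (n : nat) : (1 <= n)%nat -> 4 * Cmod (half t) <= INR n ->
  Cmod (theta_seq t (S n) - theta_seq t n)%C <= 24 * (/ sqrt (INR n) - / sqrt (INR (S n))).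
Proof.
  intros Hn H. assert (Hn' : 1 <= INR n) by (apply (le_INR 1) in Hn; exact Hn).
  destruct (avg_bound t n Hn H) as [_ A1].
  assert (Ha : avg (- half t) (/ INR n) <> 0) by (apply Cmod_gt_0; lra).
  assert (E : (theta_seq t (S n) - theta_seq t n)%C = ((rho t n - rho t (S n)) * prim t (S n))%C).
  { unfold theta_seq. destruct n as [|k]; [lia |]. simpl pred.
    assert (D : dsum t (S k) = (dsum t k + Cnpow (S k) (- half t))%C).
    { unfold dsum. rewrite sum_n_Sm by lia. reflexivity. }
    rewrite D.
    assert (P : Cnpow (S k) (- half t) = (rho t (S k) * (prim t (S (S k)) - prim t (S k)))%C).
    { rewrite <- prim_step by lia. unfold rho. field. exact Ha. }
    rewrite P. ring. }
  rewrite E, Cmod_mult, Cmod_prim by lia.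
  pose proof (inv_sqrt_telescope (INR n) Hn') as T. rewrite S_INR in *.
  pose proof (rho_diff t n Hn H) as D. rewrite S_INR in D.
  pose proof (Cmod_half_ge t).
  assert (Pb : 0 < sqrt (INR n + 1)) by (apply sqrt_lt_R0; lra).
  apply Rle_trans with (8 * Cmod (half t) / (INR n * (INR n + 1)) * (sqrt (INR n + 1) / Cmod (half t))).
  - apply Rmult_le_compat_r; [| exact D]. apply Rdiv_le_0_compat; lra.
  - replace (8 * Cmod (half t) / (INR n * (INR n + 1)) * (sqrt (INR n + 1) / Cmod (half t)))
      with (8 * / (INR n * sqrt (INR n + 1))); [lra |].
    rewrite <- (sqrt_sqrt (INR n + 1)) at 2 by lra. field. repeat split; lra.
Qed.

Lemma theta_seq_cauchy (t : R) (n m : nat) :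
  (1 <= n)%nat -> 4 * Cmod (half t) <= INR n -> (n <= m)%nat ->
  Cmod (theta_seq t m - theta_seq t n)%C <= 24 * (/ sqrt (INR n) - / sqrt (INR m)).
Proof.
  intros Hn H. induction 1 as [| m Hm IH].
  - replace (theta_seq t n - theta_seq t n)%C with (RtoC 0) by ring.
    rewrite Cmod_0. lra.
  - replace (theta_seq t (S m) - theta_seq t n)%C with
      ((theta_seq t (S m) - theta_seq t m) + (theta_seq t m - theta_seq t n))%C by ring.
    eapply Rle_trans; [apply Cmod_triangle |].
    assert (H' : 4 * Cmod (half t) <= INR m) by (apply le_INR in Hm; lra).
    pose proof (theta_seq_step t m ltac:(lia) H'). lra.
Qed.

(** Here [v] is the sequence whose limit is defined, [u] the companion with a Cauchy rate. Real and
    imaginary parts are treated separately, as in [Clim_seq], and this costs the factor [2]. *)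
Lemma Clim_seq_approx (u v : nat -> C) (N : nat) (e : nat -> R) :
  is_lim_seq e 0 -> is_lim_seq (fun n => Cmod (v n - u n)%C) 0 ->
  (forall n m : nat, (N <= n <= m)%nat -> Cmod (u m - u n)%C <= e n) ->
  forall n : nat, (N <= n)%nat -> Cmod (Clim_seq v - u n)%C <= 2 * e n.
Proof.
  intros He Hv Hu n Hn.
  assert (Key : forall P : C -> R, (forall a b, P (a - b)%C = P a - P b) ->
    (forall a, Rabs (P a) <= Cmod a) -> Rabs (real (Lim_seq (fun n => P (v n))) - P (u n)) <= e n).
  { intros P Pm Pb.
    assert (E : ex_finite_lim_seq (fun n => P (u n))).
    { apply ex_lim_seq_cauchy_corr. intros eps.
      apply is_lim_seq_spec in He. destruct (He (pos_div_2 eps)) as [M HM].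
      assert (W : forall k, (max N M <= k)%nat -> Rabs (P (u k) - P (u (max N M))) < eps / 2).
      { intros k Hk. rewrite <- Pm. eapply Rle_lt_trans; [apply Pb |].
        eapply Rle_lt_trans; [apply Hu; lia |].
        specialize (HM (max N M) ltac:(lia)). rewrite Rminus_0_r in HM.
        apply Rabs_lt_between in HM. simpl in HM. lra. }
      exists (max N M). intros p q Hp Hq. pose proof (W p Hp) as W1. pose proof (W q Hq) as W2.
      apply Rabs_lt_between in W1, W2. apply Rabs_lt_between. lra. }
    destruct E as [l Hl].
    assert (Hvl : is_lim_seq (fun n => P (v n)) l).
    { apply is_lim_seq_ext with (fun n => P (u n) + (P (v n) - P (u n))); [intros; ring |].
      replace (Finite l) with (Finite (l + 0)) by (f_equal; ring).
      apply is_lim_seq_plus'; [exact Hl |].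
      apply is_lim_seq_abs_0.
      apply is_lim_seq_le_le with (fun _ => 0) (fun n => Cmod (v n - u n)%C).
      - intros k. split; [apply Rabs_pos |]. rewrite <- Pm. apply Pb.
      - apply is_lim_seq_const.
      - exact Hv. }
    rewrite (is_lim_seq_unique _ _ Hvl). simpl.
    apply (is_lim_seq_le_loc (fun k => Rabs (P (u k) - P (u n))) (fun _ => e n)
      (Finite (Rabs (l - P (u n)))) (Finite (e n))).
    - exists n. intros k Hk. rewrite <- Pm. eapply Rle_trans; [apply Pb |]. apply Hu. lia.
    - apply (is_lim_seq_abs (fun k => P (u k) - P (u n)) (l - P (u n))).
      apply is_lim_seq_minus'; [exact Hl | apply is_lim_seq_const].
    - apply is_lim_seq_const. }
  apply Cmod_le_of_parts.
  - apply (Key (fun z => Re z)); [reflexivity | apply re_le_Cmod].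
  - apply (Key (fun z => Im z)); [reflexivity | apply im_le_Cmod].
Qed.

Lemma is_lim_seq_inv_sqrt : is_lim_seq (fun n => / sqrt (INR n)) 0.
Proof.
  replace (Finite 0) with (Rbar_inv p_infty) by reflexivity.
  apply is_lim_seq_inv; [| discriminate].
  apply (filterlim_comp _ _ _ INR sqrt eventually (Rbar_locally' p_infty) (Rbar_locally' p_infty)).
  - apply is_lim_seq_INR.
  - apply filterlim_sqrt_p.
Qed.

(** The difference is exactly [n^(-s) + (rho_n - 1) P_n], which gives [1 + 4]. It makes [theta_seq]
    share the limit of the sequence that defines [zeta]. *)
Lemma theta_seq_close (t : R) (n : nat) : (1 <= n)%nat -> 4 * Cmod (half t) <= INR n ->
  Cmod (dsum t n - prim t n - theta_seq t n)%C <= 5 * / sqrt (INR n).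
Proof.
  intros Hn H. assert (Hn' : 0 < INR n) by now apply (lt_0_INR n).
  assert (E : (dsum t n - prim t n - theta_seq t n)%C =
    (Cnpow n (- half t) + (rho t n - 1) * prim t n)%C).
  { unfold theta_seq. destruct n as [|k]; [lia |]. simpl pred.
    assert (D : dsum t (S k) = (dsum t k + Cnpow (S k) (- half t))%C).
    { unfold dsum. rewrite sum_n_Sm by lia. reflexivity. }
    rewrite D. ring. }
  rewrite E. eapply Rle_trans; [apply Cmod_triangle |].
  rewrite Cmod_Cnpow_half, Cmod_mult, Cmod_prim by lia.
  destruct (rho_bound t n Hn H) as [_ B]. pose proof (Cmod_half_ge t).
  assert (Pb : 0 < sqrt (INR n)) by (apply sqrt_lt_R0; lra).
  assert (Cmod (rho t n - 1)%C * (sqrt (INR n) / Cmod (half t)) <= 4 * / sqrt (INR n)); [| lra].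
  apply Rle_trans with (4 * Cmod (half t) / INR n * (sqrt (INR n) / Cmod (half t))).
  - apply Rmult_le_compat_r; [| exact B]. apply Rdiv_le_0_compat; lra.
  - right. rewrite <- (sqrt_sqrt (INR n)) at 1 by lra. field. lra.
Qed.

Lemma zeta_theta_seq (t : R) (n : nat) : (1 <= n)%nat -> 4 * Cmod (half t) <= INR n ->
  Cmod (zeta (half t) - theta_seq t n)%C <= 48 * / sqrt (INR n).
Proof.
  intros Hn H.
  replace (48 * / sqrt (INR n)) with (2 * (24 * / sqrt (INR n))) by ring.
  apply (Clim_seq_approx (theta_seq t) (fun N => dsum t N - prim t N)%C n (fun n => 24 * / sqrt (INR n))).
  - replace (Finite 0) with (Rbar_mult 24 0) by (simpl; f_equal; ring).
    apply (is_lim_seq_scal_l _ 24 0), is_lim_seq_inv_sqrt.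
  - apply (is_lim_seq_le_le_loc (fun _ => 0) _ (fun n => 5 * / sqrt (INR n))).
    + exists n. intros k Hk. split; [apply Cmod_ge_0 |]. apply theta_seq_close; [lia |].
      apply le_INR in Hk. lra.
    + apply is_lim_seq_const.
    + replace (Finite 0) with (Rbar_mult 5 0) by (simpl; f_equal; ring).
      apply (is_lim_seq_scal_l _ 5 0), is_lim_seq_inv_sqrt.
  - intros k m [Hk Hm]. assert (Hk' : INR n <= INR k) by now apply le_INR.
    eapply Rle_trans; [apply theta_seq_cauchy; [lia | lra | lia] |].
    assert (0 < / sqrt (INR m)); [| lra]. apply Rinv_0_lt_compat, sqrt_lt_R0, lt_0_INR. lia.
  - lia.
Qed.

Lemma zeta_uniform_approx (t : R) (n : nat) : (1 <= n)%nat -> 4 * Cmod (half t) <= INR n ->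
  Cmod (zeta (half t) - (dsum t n - prim t n))%C <= 53 * / sqrt (INR n).
Proof.
  intros Hn H.
  replace (zeta (half t) - (dsum t n - prim t n))%C with
    ((zeta (half t) - theta_seq t n) + - (dsum t n - prim t n - theta_seq t n))%C by ring.
  eapply Rle_trans; [apply Cmod_triangle |]. rewrite Cmod_opp.
  pose proof (zeta_theta_seq t n Hn H). pose proof (theta_seq_close t n Hn H). lra.
Qed.

(* Hardy and Littlewood's approximate formula, with the length of the sum proportional to [|t|]. *)
Lemma zeta_dsum_approx (t : R) (n : nat) : 4 * Cmod (half t) <= INR (S n) ->
  Cmod (zeta (half t) - dsum t n)%C <= 14 * sqrt (INR (S n)) / Cmod (half t).
Proof.
  intros H. pose proof (Cmod_half_ge t).
  assert (Hn' : 0 < INR (S n)) by (apply lt_0_INR; lia).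
  replace (zeta (half t) - dsum t n)%C with
    ((zeta (half t) - theta_seq t (S n)) + - (rho t (S n) * prim t (S n)))%C
    by (unfold theta_seq; simpl pred; ring).
  eapply Rle_trans; [apply Cmod_triangle |]. rewrite Cmod_opp, Cmod_mult, Cmod_prim by lia.
  destruct (rho_bound t (S n) ltac:(lia) H) as [B _].
  pose proof (zeta_theta_seq t (S n) ltac:(lia) H) as Z.
  set (x := INR (S n)) in *. set (c := Cmod (half t)) in *.
  assert (Pb : 0 < sqrt x) by (apply sqrt_lt_R0; lra).
  (* Since [4 c <= x], the tail is absorbed into [sqrt x / c]; the coefficient [12] and the bound
     [|rho| <= 2] make up [14]. *)
  assert (Q : 48 * / sqrt x <= 12 * (sqrt x / c)).
  { apply Rmult_le_reg_r with (sqrt x * c); [nra |].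
    replace (48 * / sqrt x * (sqrt x * c)) with (48 * c) by (field; lra).
    replace (12 * (sqrt x / c) * (sqrt x * c)) with (12 * (sqrt x * sqrt x)) by (field; lra).
    rewrite sqrt_sqrt by lra. lra. }
  assert (0 <= sqrt x / c) by (apply Rdiv_le_0_compat; lra).
  assert (Cmod (rho t (S n)) * (sqrt x / c) <= 2 * (sqrt x / c)) by (apply Rmult_le_compat_r; lra).
  replace (14 * sqrt x / c) with (14 * (sqrt x / c)) by (field; lra). lra.
Qed.

(** * Real analyticity on the critical line *)

(* For [k = 0] and [b = 0, PI/2] these are the parts of [x^(1-s)], [s = 1/2 + it]; in general the [k]-th derivatives in [t], with [b] shifted by [k PI/2]. *)
Definition osc (k : nat) (b x t : R) : R := sqrt x * ln x ^ k * cos (t * ln x + b).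

(** The derivative of [osc] in [x]. As [d/dx x^(1-s) = (1-s) x^(-s)], summing it over the integers
    yields [(1-s)] times the Dirichlet sum, with no division by [1 - s] that would spoil the
    derivatives in [t]. *)
Definition osc_dx (k : nat) (b x t : R) : R :=
  / sqrt x * ((1 / 2 * ln x ^ k + INR k * ln x ^ pred k) * cos (t * ln x + b)
              - t * ln x ^ k * sin (t * ln x + b)).

Lemma is_derive_osc_t (k : nat) (b x t : R) :
  is_derive (osc k b x) t (osc (S k) (b + PI / 2) x t).
Proof.
  unfold osc. auto_derive; [trivial |].
  replace (t * ln x + (b + PI / 2)) with (PI / 2 + (t * ln x + b)) by ring.
  rewrite (cos_sin (PI / 2 + _)).
  replace (PI / 2 + (PI / 2 + (t * ln x + b))) with ((t * ln x + b) + PI) by field.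
  rewrite neg_sin. simpl. ring.
Qed.

Lemma is_derive_osc_dx_t (k : nat) (b x t : R) :
  is_derive (osc_dx k b x) t (osc_dx (S k) (b + PI / 2) x t).
Proof.
  unfold osc_dx. auto_derive; [trivial |].
  replace (t * ln x + (b + PI / 2)) with (PI / 2 + (t * ln x + b)) by ring.
  rewrite <- (cos_sin (t * ln x + b)), (cos_sin (PI / 2 + _)).
  replace (PI / 2 + (PI / 2 + (t * ln x + b))) with ((t * ln x + b) + PI) by field.
  rewrite neg_sin, S_INR. simpl pred.
  destruct k; [simpl | simpl pred; rewrite <- tech_pow_Rmult]; simpl; ring.
Qed.

Lemma is_derive_osc_x (k : nat) (b x t : R) : 0 < x ->
  is_derive (fun y => osc k b y t) x (osc_dx k b x t).
Proof.
  intros Hx. assert (Hs : 0 < sqrt x) by now apply sqrt_lt_R0.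
  unfold osc, osc_dx. auto_derive; [tauto |].
  assert (E : / x = / sqrt x * / sqrt x).
  { rewrite <- Rinv_mult, sqrt_sqrt; lra. }
  rewrite E. generalize dependent (sqrt x). intros s Hs _. field. lra.
Qed.

Lemma pow_le_fact_exp (y : R) (k : nat) : 0 <= y -> y ^ k <= INR (fact k) * exp y.
Proof.
  intros Hy. pose proof (exp_ge_taylor y k Hy) as H.
  assert (Hk : 0 < INR (fact k)) by apply INR_fact_lt_0.
  apply Rmult_le_reg_l with (/ INR (fact k)); [now apply Rinv_0_lt_compat |].
  rewrite <- Rmult_assoc, Rinv_l, Rmult_1_l by lra.
  eapply Rle_trans; [| exact H].
  assert (T : forall n, 0 <= sum_f_R0 (fun k => y ^ k / INR (fact k)) n).
  { intros n. apply cond_pos_sum. intros m. apply Rdiv_le_0_compat; [now apply pow_le |].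
    apply INR_fact_lt_0. }
  destruct k as [| k].
  - right. apply Rmult_comm.
  - specialize (T k). rewrite tech5, (Rmult_comm (/ _)). unfold Rdiv in *. lra.
Qed.

(** Used at [y = ln x], where [exp (y / 4)] is [x^(1/4)]. The second derivative of [osc] in [x], of
    order [x^(-3/2)] up to logarithms, then remains below [x^(-5/4)], which is summable, at the
    price [k! 4^k]. The next three lemmas give the same bound for [y^k] and its first two
    derivatives. *)
Definition lnpow_bound (k : nat) (y : R) : R := INR (fact k) * 4 ^ k * exp (y / 4).

Lemma lnpow_bound_0 (y : R) (k : nat) : 0 <= y -> 0 <= y ^ k <= lnpow_bound k y.
Proof.
  intros Hy. split; [now apply pow_le |].
  pose proof (pow_le_fact_exp (y / 4) k ltac:(lra)) as H.
  unfold lnpow_bound. replace (y ^ k) with (4 ^ k * (y / 4) ^ k)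
    by (rewrite <- Rpow_mult_distr; f_equal; field).
  assert (0 < 4 ^ k) by (apply pow_lt; lra). nra.
Qed.

Lemma lnpow_bound_1 (y : R) (k : nat) : 0 <= y ->
  0 <= INR k * y ^ pred k <= lnpow_bound k y.
Proof.
  intros Hy. destruct k as [| k].
  - simpl. split; [lra |]. destruct (lnpow_bound_0 y 0 Hy). simpl in *. lra.
  - simpl pred. destruct (lnpow_bound_0 y k Hy) as [H1 H2].
    pose proof (pos_INR (S k)).
    split; [now apply Rmult_le_pos |].
    apply Rle_trans with (INR (S k) * lnpow_bound k y); [now apply Rmult_le_compat_l |].
    unfold lnpow_bound in *. rewrite fact_simpl, mult_INR, <- tech_pow_Rmult.
    assert (0 <= INR (S k) * (INR (fact k) * 4 ^ k * exp (y / 4))) by (apply Rmult_le_pos; lra).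
    lra.
Qed.

Lemma lnpow_bound_2 (y : R) (k : nat) : 0 <= y ->
  0 <= INR k * (INR (pred k) * y ^ pred (pred k)) <= lnpow_bound k y.
Proof.
  intros Hy. destruct k as [| k].
  - simpl. split; [lra |]. destruct (lnpow_bound_0 y 0 Hy). simpl in *. lra.
  - simpl pred. destruct (lnpow_bound_1 y k Hy) as [H1 H2].
    pose proof (pos_INR (S k)).
    split; [now apply Rmult_le_pos |].
    apply Rle_trans with (INR (S k) * lnpow_bound k y); [now apply Rmult_le_compat_l |].
    unfold lnpow_bound in *. rewrite fact_simpl, mult_INR, <- tech_pow_Rmult.
    assert (0 <= INR (S k) * (INR (fact k) * 4 ^ k * exp (y / 4))) by (apply Rmult_le_pos; lra).
    lra.
Qed.

(** [U], [V], [W] stand for [L^k], [k L^(k-1)], [k (k-1) L^(k-2)] with [L = ln x], and [c], [s] for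
    the cosine and sine; the expression is the bracket in the second derivative of [osc] in [x]. *)
Lemma osc_coeff_bound (U V W D t A c s : R) :
  0 <= U <= D -> 0 <= V <= D -> 0 <= W <= D -> Rabs t <= A -> 1 <= A ->
  Rabs c <= 1 -> Rabs s <= 1 ->
  Rabs (- / 2 * ((1 / 2 * U + V) * c - t * U * s)
        + ((1 / 2 * V + W) * c - (1 / 2 * U + V) * t * s - t * V * s - t ^ 2 * U * c))
  <= 7 * A ^ 2 * D.
Proof.
  intros HU HV HW Ht HA Hc Hs.
  set (a := - / 2 * (1 / 2 * U + V) + (1 / 2 * V + W)).
  replace (_ + _) with (a * c + - 2 * V * (t * s) + - (t ^ 2 * U * c)) by (unfold a; field).
  assert (Ha : Rabs a <= 2 * D) by (apply Rabs_le_between; unfold a; lra).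
  assert (H1 : Rabs (a * c) <= 2 * D * 1)
    by (rewrite Rabs_mult; apply Rmult_le_compat; auto using Rabs_pos).
  assert (Hts : Rabs (t * s) <= A * 1)
    by (rewrite Rabs_mult; apply Rmult_le_compat; auto using Rabs_pos).
  assert (H2 : Rabs (- 2 * V * (t * s)) <= 2 * D * (A * 1)).
  { rewrite Rabs_mult. apply Rmult_le_compat; auto using Rabs_pos.
    apply Rabs_le_between; lra. }
  assert (Ht2 : t ^ 2 <= A ^ 2) by (apply Rabs_le_between in Ht; nra).
  assert (H3 : Rabs (t ^ 2 * U * c) <= A ^ 2 * D * 1).
  { rewrite Rabs_mult. apply Rmult_le_compat; auto using Rabs_pos.
    pose proof (pow2_ge_0 t). rewrite Rabs_pos_eq by nra. apply Rmult_le_compat; lra. }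
  eapply Rle_trans; [apply Rabs_triang |]. rewrite Rabs_Ropp.
  pose proof (Rabs_triang (a * c) (- 2 * V * (t * s))) as H4.
  assert (0 <= D * (A ^ 2 - 1)) by (apply Rmult_le_pos; nra).
  assert (0 <= D * (A ^ 2 - A)) by (apply Rmult_le_pos; nra).
  lra.
Qed.

Lemma inv_pow_sqrt (x : R) : 0 < x -> / sqrt x * / x * exp (ln x / 4) = Rpower x (- (5 / 4)).
Proof.
  intros Hx. rewrite <- exp_half_ln by assumption.
  rewrite <- (exp_ln x) at 2 by assumption. rewrite <- !exp_Ropp, <- !exp_plus.
  unfold Rpower. f_equal. field.
Qed.

Lemma osc_dx_derive_bound (k : nat) (b A x t : R) : 1 <= x -> Rabs t <= A -> 1 <= A ->
  exists d, is_derive (fun y => osc_dx k b y t) x d /\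
    Rabs d <= 7 * A ^ 2 * (INR (fact k) * 4 ^ k) * Rpower x (- (5 / 4)).
Proof.
  intros Hx Ht HA. pose proof (ln_nonneg x Hx) as HL.
  assert (Hs : 0 < sqrt x) by (apply sqrt_lt_R0; lra).
  exists (/ sqrt x * / x *
   (- / 2 * ((1 / 2 * ln x ^ k + INR k * ln x ^ pred k) * cos (t * ln x + b)
        - t * ln x ^ k * sin (t * ln x + b))
    + ((1 / 2 * (INR k * ln x ^ pred k) + INR k * (INR (pred k) * ln x ^ pred (pred k)))
        * cos (t * ln x + b)
       - (1 / 2 * ln x ^ k + INR k * ln x ^ pred k) * t * sin (t * ln x + b)
       - t * (INR k * ln x ^ pred k) * sin (t * ln x + b)
       - t ^ 2 * ln x ^ k * cos (t * ln x + b)))).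
  split.
  - unfold osc_dx. auto_derive; [repeat split; try tauto; lra |].
    assert (E : / x = / sqrt x * / sqrt x) by (rewrite <- Rinv_mult, sqrt_sqrt; lra).
    rewrite E. generalize dependent (sqrt x). intros s Hs _. field. lra.
  - rewrite Rabs_mult, Rabs_pos_eq.
    2:{ left. apply Rmult_lt_0_compat; apply Rinv_0_lt_compat; lra. }
    rewrite <- inv_pow_sqrt by lra.
    replace (7 * A ^ 2 * (INR (fact k) * 4 ^ k) * (/ sqrt x * / x * exp (ln x / 4))) with
      (/ sqrt x * / x * (7 * A ^ 2 * lnpow_bound k (ln x))) by (unfold lnpow_bound; ring).
    apply Rmult_le_compat_l.
    { left. apply Rmult_lt_0_compat; apply Rinv_0_lt_compat; lra. }
    apply osc_coeff_bound; auto using lnpow_bound_0, lnpow_bound_1, lnpow_bound_2.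
    + apply Rabs_le_between, COS_bound.
    + apply Rabs_le_between, SIN_bound.
Qed.

Lemma Rpower_antimono (x y a : R) : 0 < x -> x <= y -> 0 <= a -> Rpower y (- a) <= Rpower x (- a).
Proof.
  intros Hx Hy Ha. rewrite !Rpower_Ropp.
  apply Rinv_le_contravar; [apply exp_pos | apply Rle_Rpower_l; lra].
Qed.

(** Mean value theorem for [y^(-1/4)]. The intermediate point is at most [2 x], which loses
    [2^(-5/4) >= 1/4]; with the derivative's factor [1/4] this makes [16]. *)
Lemma Rpower_telescope (x : R) : 1 <= x ->
  Rpower x (- (5 / 4)) <= 16 * (Rpower x (- (1 / 4)) - Rpower (x + 1) (- (1 / 4))).
Proof.
  intros Hx.
  destruct (MVT_gen (fun y => Rpower y (- (1 / 4))) x (x + 1)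
    (fun y => - (1 / 4) * Rpower y (- (5 / 4)))) as [c [Hc E]].
  - intros y. rewrite Rmin_left, Rmax_right by lra. intros Hy.
    unfold Rpower. auto_derive; [lra |].
    replace (- (5 / 4) * ln y) with (- (1 / 4) * ln y + - ln y) by field.
    rewrite exp_plus, (exp_Ropp (ln y)), exp_ln by lra. field. lra.
  - intros y. rewrite Rmin_left, Rmax_right by lra. intros Hy.
    apply continuity_pt_filterlim, (ex_derive_continuous (fun y => Rpower y (- (1 / 4)))).
    unfold Rpower. auto_derive. lra.
  - rewrite Rmin_left, Rmax_right in Hc by lra.
    assert (H1 : Rpower (2 * x) (- (5 / 4)) <= Rpower c (- (5 / 4))) by (apply Rpower_antimono; lra).
    rewrite <- Rpower_mult_distr in H1 by lra. cbv beta in E.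
    assert (H2 : Rpower 2 (Ropp 2) <= Rpower 2 (- (5 / 4))) by (apply Rle_Rpower; lra).
    rewrite (Rpower_Ropp 2 2) in H2. replace (Rpower 2 2) with 4 in H2.
    2:{ change 2 with (INR 2) at 2. rewrite Rpower_pow by lra. simpl; ring. }
    assert (0 < Rpower x (- (5 / 4))) by apply exp_pos.
    assert (/ 4 * Rpower x (- (5 / 4)) <= Rpower 2 (- (5 / 4)) * Rpower x (- (5 / 4)))
      by (apply Rmult_le_compat_r; lra).
    lra.
Qed.

(** The increment of [osc] over [[x, x+1]] is [osc_dx] at an intermediate point, so only the
    variation of [osc_dx] remains, controlled by its derivative. The constant is [112 = 7 * 16]. *)
Lemma osc_step_bound (k : nat) (b A x t : R) : 1 <= x -> Rabs t <= A -> 1 <= A ->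
  Rabs (osc_dx k b x t - (osc k b (x + 1) t - osc k b x t)) <=
  112 * A ^ 2 * (INR (fact k) * 4 ^ k) * (Rpower x (- (1 / 4)) - Rpower (x + 1) (- (1 / 4))).
Proof.
  intros Hx Ht HA.
  destruct (MVT_gen (fun y => osc k b y t) x (x + 1) (fun y => osc_dx k b y t)) as [c [Hc E]].
  - intros y. rewrite Rmin_left by lra. intros Hy. apply is_derive_osc_x. lra.
  - intros y. rewrite Rmin_left by lra. intros Hy.
    apply continuity_pt_filterlim, (ex_derive_continuous (fun y => osc k b y t)).
    eexists. apply is_derive_osc_x. lra.
  - rewrite Rmin_left, Rmax_right in Hc by lra. rewrite E.
    replace (osc_dx k b x t - osc_dx k b c t * (x + 1 - x)) with (- (osc_dx k b c t - osc_dx k b x t)) by ring.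
    rewrite Rabs_Ropp.
    set (K := 7 * A ^ 2 * (INR (fact k) * 4 ^ k)).
    assert (HK : 0 <= K).
    { unfold K. repeat apply Rmult_le_pos; try lra; try apply pos_INR; apply pow_le; lra. }
    apply Rle_trans with (K * Rpower x (- (5 / 4)) * Rabs (c - x)).
    + apply (lipschitz_of_derive (fun y => osc_dx k b y t) (Derive (fun y => osc_dx k b y t))).
      intros u. rewrite Rmin_left, Rmax_right by lra. intros Hu.
      destruct (osc_dx_derive_bound k b A u t ltac:(lra) Ht HA) as [d [D1 D2]].
      assert (Du : Derive (fun y => osc_dx k b y t) u = d) by exact (is_derive_unique _ _ _ D1).
      rewrite Du. split; [exact D1 |].
      eapply Rle_trans; [exact D2 |]. apply Rmult_le_compat_l; [exact HK |].
      apply Rpower_antimono; lra.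
    + pose proof (Rpower_telescope x Hx) as T.
      assert (0 < Rpower x (- (5 / 4))) by apply exp_pos.
      rewrite Rabs_pos_eq by lra.
      replace (112 * A ^ 2 * (INR (fact k) * 4 ^ k)) with (K * 16) by (unfold K; ring).
      rewrite (Rmult_assoc K 16).
      apply Rle_trans with (K * Rpower x (- (5 / 4))); [| now apply Rmult_le_compat_l].
      assert (0 <= K * Rpower x (- (5 / 4))) by (apply Rmult_le_pos; lra). nra.
Qed.

(* Parts of [(1 - s) (sum_(n <= N) n^(-s)) - (N+1)^(1-s)] and of their [t]-derivatives. *)
Definition oscsum (k : nat) (b : R) (N : nat) (t : R) : R :=
  sum_n_m (fun n => osc_dx k b (INR n) t) 1 N - osc k b (INR (S N)) t.

Definition osclim (k : nat) (b t : R) : R := real (Lim_seq (fun N => oscsum k b N t)).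

Lemma oscsum_S (k : nat) (b : R) (N : nat) (t : R) :
  oscsum k b (S N) t - oscsum k b N t =
  osc_dx k b (INR (S N)) t - (osc k b (INR (S N) + 1) t - osc k b (INR (S N)) t).
Proof.
  unfold oscsum. rewrite sum_n_Sm by lia. rewrite (S_INR (S N)). unfold plus; simpl. ring.
Qed.

Lemma oscsum_cauchy (k : nat) (b A t : R) (N M : nat) : Rabs t <= A -> 1 <= A -> (N <= M)%nat ->
  Rabs (oscsum k b M t - oscsum k b N t) <=
  112 * A ^ 2 * (INR (fact k) * 4 ^ k)
  * (Rpower (INR (S N)) (- (1 / 4)) - Rpower (INR (S M)) (- (1 / 4))).
Proof.
  intros Ht HA. induction 1 as [| M HM IH].
  - rewrite !Rminus_diag, Rabs_R0. lra.
  - replace (oscsum k b (S M) t - oscsum k b N t) with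
      ((oscsum k b (S M) t - oscsum k b M t) + (oscsum k b M t - oscsum k b N t)) by ring.
    eapply Rle_trans; [apply Rabs_triang |]. rewrite oscsum_S.
    assert (H1 : 1 <= INR (S M)) by (apply (le_INR 1); lia).
    pose proof (osc_step_bound k b A (INR (S M)) t H1 Ht HA) as S1.
    rewrite (S_INR (S M)). lra.
Qed.

Lemma is_lim_seq_Rpower_neg (a : R) : 0 < a -> is_lim_seq (fun N => Rpower (INR (S N)) (- a)) 0.
Proof.
  intros Ha. apply (is_lim_seq_incr_1 (fun N => Rpower (INR N) (- a))).
  assert (L : is_lim_seq (fun N => - a * ln (INR N)) m_infty).
  { assert (E : Rbar_mult (- a) p_infty = m_infty)
      by (simpl; destruct (Rle_dec 0 (- a)); [exfalso; lra | reflexivity]).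
    rewrite <- E. apply (is_lim_seq_scal_l (fun N => ln (INR N)) (- a) p_infty).
    apply (filterlim_comp _ _ _ INR ln eventually (Rbar_locally' p_infty) (Rbar_locally' p_infty)).
    - apply is_lim_seq_INR.
    - apply is_lim_ln_p. }
  apply (filterlim_comp _ _ _ (fun N => - a * ln (INR N)) exp eventually (Rbar_locally' m_infty)).
  - exact L.
  - apply is_lim_exp_m.
Qed.

Lemma oscsum_osclim (k : nat) (b A t : R) (N : nat) : Rabs t <= A -> 1 <= A ->
  is_lim_seq (fun N => oscsum k b N t) (osclim k b t) /\
  Rabs (osclim k b t - oscsum k b N t) <=
    112 * A ^ 2 * (INR (fact k) * 4 ^ k) * Rpower (INR (S N)) (- (1 / 4)).
Proof.
  intros Ht HA.
  set (K := 112 * A ^ 2 * (INR (fact k) * 4 ^ k)).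
  assert (HK : 0 <= K).
  { unfold K. repeat apply Rmult_le_pos; try lra; try apply pos_INR; apply pow_le; lra. }
  assert (C : forall p q, (p <= q)%nat -> Rabs (oscsum k b q t - oscsum k b p t) <=
    K * Rpower (INR (S p)) (- (1 / 4))).
  { intros p q Hpq. eapply Rle_trans; [apply (oscsum_cauchy k b A); assumption |].
    apply Rmult_le_compat_l; [exact HK |].
    assert (0 < Rpower (INR (S q)) (- (1 / 4))) by apply exp_pos. lra. }
  assert (L0 : is_lim_seq (fun p => K * Rpower (INR (S p)) (- (1 / 4))) 0).
  { replace (Finite 0) with (Rbar_mult K 0) by (simpl; f_equal; ring).
    apply (is_lim_seq_scal_l _ K 0), is_lim_seq_Rpower_neg. lra. }
  assert (E : ex_finite_lim_seq (fun N => oscsum k b N t)).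
  { apply ex_lim_seq_cauchy_corr. intros eps. apply is_lim_seq_spec in L0.
    destruct (L0 (pos_div_2 eps)) as [M HM]. exists M. intros p q Hp Hq.
    specialize (HM M (le_n M)). rewrite Rminus_0_r in HM. apply Rabs_lt_between in HM. change (pos (pos_div_2 eps)) with (eps / 2) in HM.
    pose proof (C M p Hp) as C1. pose proof (C M q Hq) as C2.
    apply Rabs_le_between in C1, C2. apply Rabs_lt_between. lra. }
  assert (L : is_lim_seq (fun N => oscsum k b N t) (osclim k b t)) by now apply Lim_seq_correct'.
  split; [exact L |].
  apply (is_lim_seq_le_loc (fun M => Rabs (oscsum k b M t - oscsum k b N t))
    (fun _ => K * Rpower (INR (S N)) (- (1 / 4))) (Finite (Rabs (osclim k b t - oscsum k b N t)))
    (Finite (K * Rpower (INR (S N)) (- (1 / 4))))).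
  - exists N. intros M HM. now apply C.
  - apply (is_lim_seq_abs (fun M => oscsum k b M t - oscsum k b N t) (osclim k b t - oscsum k b N t)).
    apply is_lim_seq_minus'; [exact L | apply is_lim_seq_const].
  - apply is_lim_seq_const.
Qed.

Lemma is_derive_oscsum (k : nat) (b : R) (N : nat) (t : R) :
  is_derive (oscsum k b N) t (oscsum (S k) (b + PI / 2) N t).
Proof.
  unfold oscsum. apply (is_derive_minus (V := R_NormedModule)
    (fun t => sum_n_m (fun n => osc_dx k b (INR n) t) 1 N)); [| apply is_derive_osc_t].
  induction N as [| N IH].
  - rewrite sum_n_m_zero by lia. apply is_derive_ext with (fun _ => 0).
    + intros u. rewrite sum_n_m_zero by lia. reflexivity.
    + apply (is_derive_const (V := R_NormedModule)).
  - rewrite sum_n_Sm by lia.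
    apply is_derive_ext with (fun t => plus (sum_n_m (fun n => osc_dx k b (INR n) t) 1 N)
      (osc_dx k b (INR (S N)) t)).
    + intros u. rewrite sum_n_Sm by lia. reflexivity.
    + apply (is_derive_plus (V := R_NormedModule)); [exact IH | apply is_derive_osc_dx_t].
Qed.

Lemma osclim_CVU (k : nat) (b A : R) : 1 <= A ->
  CVU_dom (oscsum k b) (fun t => - A < t /\ t < A).
Proof.
  intros HA eps.
  set (K := 112 * A ^ 2 * (INR (fact k) * 4 ^ k)).
  assert (L0 : is_lim_seq (fun p => K * Rpower (INR (S p)) (- (1 / 4))) 0).
  { replace (Finite 0) with (Rbar_mult K 0) by (simpl; f_equal; ring).
    apply (is_lim_seq_scal_l _ K 0), is_lim_seq_Rpower_neg. lra. }
  apply is_lim_seq_spec in L0. destruct (L0 eps) as [M HM]. exists M. intros N HN t Ht.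
  fold (osclim k b t).
  specialize (HM N HN). rewrite Rminus_0_r in HM. apply Rabs_lt_between in HM.
  rewrite Rabs_minus_sym.
  destruct (oscsum_osclim k b A t N) as [_ B]; [apply Rabs_le_between; lra | exact HA |].
  fold K in B. lra.
Qed.

(** Differentiation passes to the limit because the differentiated sequence is again an [oscsum],
    for the parameters [S k] and [b + PI / 2], and converges locally uniformly by the same
    estimate. *)
Lemma is_derive_osclim (k : nat) (b t : R) :
  is_derive (osclim k b) t (osclim (S k) (b + PI / 2) t).
Proof.
  set (A := Rabs t + 1). assert (HA : 1 <= A) by (unfold A; pose proof (Rabs_pos t); lra).
  assert (D : forall n x, Derive (oscsum k b n) x = oscsum (S k) (b + PI / 2) n x)
    by (intros; apply is_derive_unique, is_derive_oscsum).
  pose proof (CVU_Derive (oscsum k b) (fun t => - A < t /\ t < A)) as C.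
  unfold osclim at 2. rewrite <- (Lim_seq_ext _ _ (fun n => D n t)).
  apply C.
  - apply open_and; [apply open_gt | apply open_lt].
  - intros x y z; lra.
  - now apply osclim_CVU.
  - intros n x _. eexists. apply is_derive_oscsum.
  - intros n x _. apply continuity_pt_filterlim.
    apply (continuous_ext (oscsum (S k) (b + PI / 2) n)); [intros; symmetry; apply D |].
    apply (ex_derive_continuous (oscsum (S k) (b + PI / 2) n)). eexists. apply is_derive_oscsum.
  - intros eps. destruct (osclim_CVU (S k) (b + PI / 2) A HA eps) as [N HN]. exists N.
    intros n Hn x Hx. rewrite D, (Lim_seq_ext _ _ (fun n => D n x)). now apply HN.
  - unfold A. pose proof (Rle_abs t). pose proof (Rabs_maj2 t). lra.
Qed.

(** Compare with [N = 0], where the sum is empty and only [- osc] at [x = 1] is left; [ln 1 = 0]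
    keeps it at most [1] in modulus, so [113 = 112 + 1]. *)
Lemma osclim_bound (k : nat) (b A t : R) : Rabs t <= A -> 1 <= A ->
  Rabs (osclim k b t) <= 113 * A ^ 2 * (INR (fact k) * 4 ^ k).
Proof.
  intros Ht HA. destruct (oscsum_osclim k b A t 0 Ht HA) as [_ B].
  set (K := INR (fact k) * 4 ^ k) in *.
  assert (HK : 1 <= K).
  { unfold K. rewrite <- (Rmult_1_l 1). apply Rmult_le_compat; try lra.
    - apply (le_INR 1), lt_O_fact.
    - apply pow_R1_Rle. lra. }
  assert (H0 : Rabs (oscsum k b 0 t) <= 1).
  { unfold oscsum. rewrite sum_n_m_zero by lia. unfold osc, zero; simpl. rewrite ln_1, sqrt_1.
    rewrite Rminus_0_l, Rabs_Ropp, !Rabs_mult, Rabs_R1, Rmult_1_l.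
    rewrite <- (Rmult_1_l 1). apply Rmult_le_compat; try apply Rabs_pos.
    - destruct k; simpl; [rewrite Rabs_R1; lra | rewrite Rmult_0_l, Rabs_R0; lra].
    - apply Rabs_le_between, COS_bound. }
  simpl INR in B. rewrite Rpower_Ropp in B.
  assert (R1 : Rpower 1 (1 / 4) = 1) by (unfold Rpower; rewrite ln_1, Rmult_0_r; apply exp_0).
  rewrite R1, Rinv_1, Rmult_1_r in B.
  apply Rabs_le_between in B, H0. apply Rabs_le_between.
  assert (1 <= A ^ 2) by (apply pow_R1_Rle; lra).
  assert (1 <= A ^ 2 * K) by nra. lra.
Qed.

(** * Identification of the limit with [(1 - s) zeta s] *)

Lemma cpow_half_parts (x t : R) : 0 < x ->
  cpow x (- half t) = (/ sqrt x * cos (t * ln x), - (/ sqrt x * sin (t * ln x)))%R /\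
  cpow x (1 - half t) = (sqrt x * cos (t * ln x), - (sqrt x * sin (t * ln x)))%R.
Proof.
  intros Hx. split.
  - apply injective_projections.
    + change (fst (cpow x (- half t))) with (Re (cpow x (- half t))).
      rewrite cpow_re. simpl. rewrite <- exp_half_ln, <- exp_Ropp by assumption.
      f_equal; [f_equal; field |].
      rewrite <- cos_neg. f_equal. ring.
    + change (snd (cpow x (- half t))) with (Im (cpow x (- half t))).
      rewrite cpow_im. simpl. rewrite <- exp_half_ln, <- exp_Ropp by assumption.
      rewrite Ropp_mult_distr_r, <- sin_neg. f_equal; f_equal; field.
  - apply injective_projections.
    + change (fst (cpow x (1 - half t))) with (Re (cpow x (1 - half t))).
      rewrite cpow_re. simpl. rewrite <- exp_half_ln by assumption.
      f_equal; [f_equal; field |].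
      rewrite <- cos_neg. f_equal. ring.
    + change (snd (cpow x (1 - half t))) with (Im (cpow x (1 - half t))).
      rewrite cpow_im. simpl. rewrite <- exp_half_ln by assumption.
      rewrite Ropp_mult_distr_r, <- sin_neg. f_equal; f_equal; field.
Qed.

Lemma oscsum_dsum (N : nat) (t : R) :
  (oscsum 0 0 N t, oscsum 0 (PI / 2) N t) =
  ((1 - half t) * dsum t N - Cnpow (S N) (1 - half t))%C.
Proof.
  assert (D : (sum_n_m (fun n => osc_dx 0 0 (INR n) t) 1 N,
               sum_n_m (fun n => osc_dx 0 (PI / 2) (INR n) t) 1 N) = ((1 - half t) * dsum t N)%C).
  { unfold dsum. induction N as [| N IH].
    - rewrite !sum_n_m_zero by lia. rewrite Cmult_0_r. reflexivity.
    - rewrite !sum_n_Sm by lia.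
      change (plus (sum_n_m (fun n => Cnpow n (- half t)) 1 N) (Cnpow (S N) (- half t))) with
        (sum_n_m (fun n => Cnpow n (- half t)) 1 N + Cnpow (S N) (- half t))%C.
      rewrite Cmult_plus_distr_l, <- IH.
      change (Cnpow (S N) (- half t)) with (cpow (INR (S N)) (- half t)).
      assert (Hx : 0 < INR (S N)) by (apply lt_0_INR; lia).
      destruct (cpow_half_parts (INR (S N)) t Hx) as [-> _].
      unfold osc_dx at 2 4. rewrite !Rplus_0_r, (Rplus_comm _ (PI / 2)), <- cos_sin.
      replace (cos (PI / 2 + t * ln (INR (S N)))) with (- sin (t * ln (INR (S N))))
        by (rewrite (sin_cos (t * _)); ring).
      change (@plus R_AbelianMonoid) with Rplus.
      generalize (sum_n_m (fun n => osc_dx 0 0 (INR n) t) 1 N) (sum_n_m (fun n => osc_dx 0 (PI / 2) (INR n) t) 1 N).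
      intros u v. generalize (INR (S N)). intros x.
      apply injective_projections; simpl;
        [apply (f_equal (Rplus u)) | apply (f_equal (Rplus v))]; lra. }
  unfold oscsum.
  change (Cnpow (S N) (1 - half t)) with (cpow (INR (S N)) (1 - half t)).
  assert (Hx : 0 < INR (S N)) by (apply lt_0_INR; lia).
  destruct (cpow_half_parts (INR (S N)) t Hx) as [_ ->].
  rewrite <- D. unfold osc. rewrite !Rplus_0_r, (Rplus_comm _ (PI / 2)).
  replace (cos (PI / 2 + t * ln (INR (S N)))) with (- sin (t * ln (INR (S N))))
    by (rewrite (sin_cos (t * _)); ring).
  generalize (INR (S N)). intros x.
  apply injective_projections; simpl; ring.
Qed.

(** Up to the factor [1 - s], [oscsum] differs from the sequence defining [zeta] at [N + 1] only by
    the last term [(N+1)^(-s)]; hence [54 = 53 + 1]. *)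
Lemma zeta_oscsum (N : nat) (t : R) : 4 * Cmod (half t) <= INR (S N) ->
  Cmod ((1 - half t) * zeta (half t) - (oscsum 0 0 N t, oscsum 0 (PI / 2) N t))%C
  <= 54 * Cmod (half t) * / sqrt (INR (S N)).
Proof.
  intros H. rewrite oscsum_dsum.
  pose proof (zeta_uniform_approx t (S N) ltac:(lia) H) as Z.
  assert (Hx : 0 < INR (S N)) by (apply lt_0_INR; lia).
  assert (D : dsum t (S N) = (dsum t N + Cnpow (S N) (- half t))%C).
  { unfold dsum. rewrite sum_n_Sm by lia. reflexivity. }
  replace ((1 - half t) * zeta (half t) - ((1 - half t) * dsum t N - Cnpow (S N) (1 - half t)))%C with
    ((1 - half t) * ((zeta (half t) - (dsum t (S N) - prim t (S N))) + Cnpow (S N) (- half t)))%C.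
  2:{ rewrite D. unfold prim. field. apply one_minus_half_neq_0. }
  rewrite Cmod_mult, Cmod_half_conj, (Rmult_comm 54), Rmult_assoc.
  apply Rmult_le_compat_l; [apply Cmod_ge_0 |].
  eapply Rle_trans; [apply Cmod_triangle |]. rewrite Cmod_Cnpow_half by lia. lra.
Qed.

Lemma zeta_osclim (t : R) :
  ((1 - half t) * zeta (half t))%C = (osclim 0 0 t, osclim 0 (PI / 2) t).
Proof.
  set (A := Rabs t + 1). assert (HA : 1 <= A) by (unfold A; pose proof (Rabs_pos t); lra).
  assert (Ht : Rabs t <= A) by (unfold A; lra).
  set (w := ((1 - half t) * zeta (half t))%C).
  assert (L0 : is_lim_seq (fun N => 54 * Cmod (half t) * / sqrt (INR (S N))) 0).
  { replace (Finite 0) with (Rbar_mult (54 * Cmod (half t)) 0) by (simpl; f_equal; ring).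
    apply is_lim_seq_scal_l.
    apply (is_lim_seq_incr_1 (fun N => / sqrt (INR N))), is_lim_seq_inv_sqrt. }
  destruct (nfloor_ex (4 * Cmod (half t))) as [M HM].
  { pose proof (Cmod_ge_0 (half t)). lra. }
  assert (HN : forall N, (M <= N)%nat -> 4 * Cmod (half t) <= INR (S N)).
  { intros N H. rewrite S_INR. apply le_INR in H. lra. }
  assert (K : forall (P : C -> R) l (u : nat -> R), (forall a b, P (a - b)%C = P a - P b) ->
    (forall a, Rabs (P a) <= Cmod a) ->
    (forall N, u N = P (oscsum 0 0 N t, oscsum 0 (PI / 2) N t)) ->
    is_lim_seq u (Finite l) -> P w = l).
  { intros P l u Pm Pb Hu Hl.
    assert (L : is_lim_seq u (P w)).
    { apply is_lim_seq_ext with (fun N => P w - (P w - u N)); [intros; ring |].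
      replace (Finite (P w)) with (Finite (P w - 0)) by (f_equal; ring).
      apply is_lim_seq_minus'; [apply is_lim_seq_const |].
      apply is_lim_seq_abs_0.
      apply (is_lim_seq_le_le_loc (fun _ => 0) _ (fun N => 54 * Cmod (half t) * / sqrt (INR (S N)))).
      - exists M. intros N H. split; [apply Rabs_pos |].
        rewrite Hu, <- Pm. eapply Rle_trans; [apply Pb |]. apply zeta_oscsum. now apply HN.
      - apply is_lim_seq_const.
      - exact L0. }
    apply is_lim_seq_unique in L, Hl. rewrite L in Hl. now injection Hl. }
  apply injective_projections.
  - apply (K (fun z => Re z) _ (fun N => oscsum 0 0 N t)); try reflexivity.
    + apply re_le_Cmod.
    + now apply (oscsum_osclim 0 0 A t 0).
  - apply (K (fun z => Im z) _ (fun N => oscsum 0 (PI / 2) N t)); try reflexivity.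
    + apply im_le_Cmod.
    + now apply (oscsum_osclim 0 (PI / 2) A t 0).
Qed.

Lemma hardyZ2_zeta (t : R) : hardyZ2 t = Cmod (zeta (half t)) ^ 2.
Proof.
  unfold hardyZ2, hardyZ. rewrite Cmod_mult, Cmod_Cexp. simpl Re. rewrite exp_0, Rmult_1_l.
  reflexivity.
Qed.

Lemma hardyZ2_osclim (t : R) :
  hardyZ2 t = (osclim 0 0 t ^ 2 + osclim 0 (PI / 2) t ^ 2) / (1 / 4 + t ^ 2).
Proof.
  assert (P : 0 < 1 / 4 + t ^ 2) by (pose proof (pow2_ge_0 t); lra).
  assert (H : Cmod ((1 - half t) * zeta (half t))%C ^ 2 = osclim 0 0 t ^ 2 + osclim 0 (PI / 2) t ^ 2).
  { rewrite zeta_osclim, Cmod2_alt. reflexivity. }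
  rewrite Cmod_mult, Cmod_half_conj, Rpow_mult_distr, Cmod_half_sqr in H.
  rewrite hardyZ2_zeta, <- H. field. lra.
Qed.

Lemma hardyZ2_pos (t : R) : 0 <= hardyZ2 t.
Proof. unfold hardyZ2. apply pow2_ge_0. Qed.

Lemma hardyZ2_continuous (t : R) : continuous hardyZ2 t.
Proof.
  apply continuous_ext with
    (fun t => (osclim 0 0 t ^ 2 + osclim 0 (PI / 2) t ^ 2) / (1 / 4 + t ^ 2)).
  { intros u. symmetry. apply hardyZ2_osclim. }
  apply (ex_derive_continuous (fun t => (osclim 0 0 t ^ 2 + osclim 0 (PI / 2) t ^ 2) / (1 / 4 + t ^ 2))).
  auto_derive. repeat split.
  - eexists. apply is_derive_osclim.
  - eexists. apply is_derive_osclim.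
  - pose proof (pow2_ge_0 t). simpl in *. lra.
Qed.

(* A function whose [k]-th derivative is locally [O(k! M^k)] is real analytic with radius of convergence at least [1/M] at every point. *)
Lemma derivatives_vanish_forward (f : nat -> R -> R) (M : R) : 1 <= M ->
  (forall k t, is_derive (f k) t (f (S k) t)) ->
  (forall A, exists K, forall k t, Rabs t <= A -> Rabs (f k t) <= K * (INR (fact k) * M ^ k)) ->
  forall a b, a < b -> (forall t, a < t < b -> f 0%nat t = 0) ->
  forall t, a < t -> f 0%nat t = 0.
Proof.
  intros HM Hd Hb.
  assert (DN : forall k t, Derive_n (f 0%nat) k t = f k t).
  { induction k as [| k IH]; intros t; [reflexivity |]. simpl.
    rewrite (Derive_ext _ (f k)) by exact IH. apply is_derive_unique, Hd. }
  assert (EX : forall k t, ex_derive_n (f 0%nat) k t).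
  { intros [| k] t; [exact I |]. simpl.
    apply ex_derive_ext with (f k); [intros; symmetry; apply DN |]. eexists; apply Hd. }
  assert (OPEN : forall a b, (forall t, a < t < b -> f 0%nat t = 0) ->
    forall k t, a < t < b -> f k t = 0).
  { intros a b H. induction k as [| k IH]; intros t Ht; [now apply H |].
    rewrite <- (is_derive_unique _ _ _ (Hd k t)).
    transitivity (Derive (fun _ => 0) t); [| apply Derive_const].
    apply Derive_ext_loc.
    assert (P : 0 < Rmin (t - a) (b - t)) by (apply Rmin_case; lra).
    exists (mkposreal _ P). intros y Hy. apply IH.
    unfold ball in Hy; simpl in Hy; unfold AbsRing_ball, abs, minus, plus, opp in Hy; simpl in Hy.
    apply Rabs_lt_between in Hy.
    pose proof (Rmin_l (t - a) (b - t)). pose proof (Rmin_r (t - a) (b - t)). lra. }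
  (* If all derivatives vanish at [t0], the value at [t] is the Lagrange remainder alone, at most
     [K ((t - t0) M)^(n+1)] with [(t - t0) M < 1/2]. The radius does not depend on [t0], so the
     steps can be iterated. *)
  assert (FWD : forall t0, (forall k, f k t0 = 0) ->
    forall t, t0 < t -> t < t0 + / (2 * M) -> f 0%nat t = 0).
  { intros t0 H0 t Ht1 Ht2.
    set (A := Rabs t0 + Rabs t). destruct (Hb A) as [K HK].
    assert (LE : forall n, Rabs (f 0%nat t) <= K * (1 / 2) ^ S n).
    { intros n. destruct (Taylor_Lagrange (f 0%nat) n t0 t Ht1) as [z [Hz E]].
      - intros u _ k _. apply EX.
      - rewrite E. rewrite sum_eq_R0, Rplus_0_l by (intros m _; rewrite DN, H0; ring).
        rewrite DN, Rabs_mult.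
        assert (Hz' : Rabs z <= A).
        { unfold A. apply Rabs_le_between. pose proof (Rle_abs t). pose proof (Rabs_maj2 t0).
          pose proof (Rabs_pos t0). pose proof (Rabs_pos t). lra. }
        pose proof (HK (S n) z Hz') as B.
        assert (Pf : 0 < INR (fact (S n))) by apply INR_fact_lt_0.
        rewrite Rabs_pos_eq by (apply Rdiv_le_0_compat; [apply pow_le; lra | exact Pf]).
        assert (K0 : 0 <= K).
        { specialize (HK 0%nat z Hz'). simpl in HK. pose proof (Rabs_pos (f 0%nat z)). lra. }
        apply Rle_trans with ((t - t0) ^ S n / INR (fact (S n)) * (K * (INR (fact (S n)) * M ^ S n))).
        + apply Rmult_le_compat_l; [| exact B].
          apply Rdiv_le_0_compat; [apply pow_le; lra | exact Pf].
        + replace ((t - t0) ^ S n / INR (fact (S n)) * (K * (INR (fact (S n)) * M ^ S n)))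
            with (K * ((t - t0) * M) ^ S n) by (rewrite Rpow_mult_distr; field; lra).
          apply Rmult_le_compat_l; [exact K0 |]. apply pow_incr.
          assert ((t - t0) * M <= / (2 * M) * M) by (apply Rmult_le_compat_r; lra).
          replace (/ (2 * M) * M) with (1 / 2) in * by (field; lra). nra. }
    assert (L : is_lim_seq (fun n => K * (1 / 2) ^ S n) 0).
    { replace (Finite 0) with (Rbar_mult K 0) by (simpl; f_equal; ring).
      apply is_lim_seq_scal_l, (is_lim_seq_incr_1 (fun n => (1 / 2) ^ n)), is_lim_seq_geom.
      rewrite Rabs_pos_eq; lra. }
    assert (Z : Rabs (f 0%nat t) <= 0).
    { apply (is_lim_seq_le (fun _ => Rabs (f 0%nat t)) (fun n => K * (1 / 2) ^ S n)
        (Rabs (f 0%nat t)) 0); [exact LE | apply is_lim_seq_const | exact L]. }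
    pose proof (Rabs_pos (f 0%nat t)). apply Rabs_eq_0. lra. }
  intros a b Hab H0 t Ht.
  set (c := (a + b) / 2). set (h := / (4 * M)).
  assert (Hh : 0 < h) by (apply Rinv_0_lt_compat; lra).
  assert (Hh2 : / (2 * M) = 2 * h) by (unfold h; field; lra).
  assert (ST : forall j : nat, forall u, a < u < c + INR j * h -> f 0%nat u = 0).
  { induction j as [| j IH]; intros u Hu.
    - simpl in Hu. apply H0. unfold c in Hu. lra.
    - rewrite S_INR in Hu. destruct (Rlt_dec u (c + INR j * h)) as [| Hn]; [apply IH; lra |].
      (* The base point must lie within [2 h] of [u] and strictly inside the interval already
         covered; the midpoint keeps it to the right of [a]. *)
      set (u0 := Rmax (u - 3 / 2 * h) ((a + c + INR j * h) / 2)).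
      assert (Hac : a < c + INR j * h).
      { pose proof (pos_INR j). unfold c. assert (0 <= INR j * h) by (apply Rmult_le_pos; lra). lra. }
      assert (B : a < u0 < c + INR j * h).
      { unfold u0. pose proof (Rmax_l (u - 3 / 2 * h) ((a + c + INR j * h) / 2)).
        pose proof (Rmax_r (u - 3 / 2 * h) ((a + c + INR j * h) / 2)). split; [lra |].
        apply Rmax_case; lra. }
      apply (FWD u0).
      + intros k. now apply (OPEN a (c + INR j * h)).
      + lra.
      + rewrite Hh2. unfold u0. pose proof (Rmax_l (u - 3 / 2 * h) ((a + c + INR j * h) / 2)). lra. }
  destruct (nfloor_ex (Rmax 0 ((t - c) / h))) as [j Hj]; [apply Rmax_l |].
  apply (ST (S j)). split; [exact Ht |]. rewrite S_INR.
  assert ((t - c) / h < INR j + 1) by (pose proof (Rmax_r 0 ((t - c) / h)); lra).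
  apply Rlt_div_l in H; lra.
Qed.

Lemma osclim_vanish_forward (b a1 a2 : R) : a1 < a2 ->
  (forall t, a1 < t < a2 -> osclim 0 b t = 0) -> forall t, a1 < t -> osclim 0 b t = 0.
Proof.
  intros Ha H t Ht.
  pose proof (derivatives_vanish_forward (fun k => osclim k (b + INR k * (PI / 2))) 4) as V.
  cbv beta in V. change (INR 0) with 0 in V.
  replace (b + 0 * (PI / 2)) with b in V by ring.
  apply (V ltac:(lra)) with a1 a2; try assumption.
  - intros k u. rewrite S_INR.
    replace (b + (INR k + 1) * (PI / 2)) with (b + INR k * (PI / 2) + PI / 2) by ring.
    apply is_derive_osclim.
  - intros A. set (A' := Rmax A 1). exists (113 * A' ^ 2). intros k u Hu.
    apply osclim_bound; [| apply Rmax_r]. eapply Rle_trans; [exact Hu | apply Rmax_l].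
Qed.

Lemma hardyZ2_vanish_forward (a b : R) : a < b ->
  (forall t, a < t < b -> hardyZ2 t = 0) -> forall t, a < t -> hardyZ2 t = 0.
Proof.
  intros Hab H.
  assert (P : forall t, 0 < 1 / 4 + t ^ 2) by (intros t; pose proof (pow2_ge_0 t); lra).
  assert (Z : forall t, a < t < b -> osclim 0 0 t = 0 /\ osclim 0 (PI / 2) t = 0).
  { intros t Ht. specialize (H t Ht). rewrite hardyZ2_osclim in H. specialize (P t).
    assert (E : osclim 0 0 t ^ 2 + osclim 0 (PI / 2) t ^ 2 = 0).
    { apply (f_equal (fun x => x * (1 / 4 + t ^ 2))) in H. field_simplify in H; lra. }
    split; nra. }
  intros t Ht. rewrite hardyZ2_osclim.
  rewrite (osclim_vanish_forward 0 a b), (osclim_vanish_forward (PI / 2) a b); try assumption.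
  - specialize (P t). field. lra.
  - intros u Hu. now apply Z.
  - intros u Hu. now apply Z.
Qed.

(** * The mean square of zeta on the critical line *)

(* Goals produced by the Coquelicot [_ext] lemmas are equations in a projected carrier type, which [ring] does not see through. *)
Ltac eqR := match goal with |- @eq _ ?a ?b => change (@eq R a b) end.

Definition harmonic (N : nat) : R := sum_n_m (fun n => / INR n) 1 N.

(** The real part of the products of [n^(-s)] with the conjugates of [m^(-s)], [m <= M]: one row of
    off-diagonal terms of the squared sum. *)
Definition crossterm (n M : nat) (t : R) : R :=
  sum_n_m (fun m => / sqrt (INR m) * / sqrt (INR n) * cos (t * (ln (INR n) - ln (INR m)))) 1 M.

Lemma sum_n_m_1_S (f : nat -> R) (N : nat) : sum_n_m f 1 (S N) = sum_n_m f 1 N + f (S N).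
Proof. rewrite sum_n_Sm by lia. reflexivity. Qed.

Lemma sum_n_m_1_0 (f : nat -> R) : sum_n_m f 1 0 = 0.
Proof. now rewrite sum_n_m_zero by lia. Qed.

Lemma dsum_parts (t : R) (N : nat) : dsum t N =
  (sum_n_m (fun n => / sqrt (INR n) * cos (t * ln (INR n))) 1 N,
   - sum_n_m (fun n => / sqrt (INR n) * sin (t * ln (INR n))) 1 N)%R.
Proof.
  unfold dsum. induction N as [| N IH].
  - rewrite !sum_n_m_1_0, sum_n_m_zero by lia. unfold zero; simpl. rewrite Ropp_0. reflexivity.
  - rewrite !sum_n_m_1_S, sum_n_Sm by lia. rewrite IH.
    change (Cnpow (S N) (- half t)) with (cpow (INR (S N)) (- half t)).
    assert (Hx : 0 < INR (S N)) by (apply lt_0_INR; lia).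
    destruct (cpow_half_parts (INR (S N)) t Hx) as [-> _].
    unfold plus; cbn -[INR]. unfold Cplus; cbn -[INR]. f_equal. ring.
Qed.

Lemma Cmod_dsum_sqr_S (t : R) (N : nat) :
  Cmod (dsum t (S N)) ^ 2 = Cmod (dsum t N) ^ 2 + / INR (S N) + 2 * crossterm (S N) N t.
Proof.
  assert (X : forall n, crossterm n N t =
    sum_n_m (fun n => / sqrt (INR n) * cos (t * ln (INR n))) 1 N
      * (/ sqrt (INR n) * cos (t * ln (INR n))) +
    sum_n_m (fun n => / sqrt (INR n) * sin (t * ln (INR n))) 1 N
      * (/ sqrt (INR n) * sin (t * ln (INR n)))).
  { intros n. unfold crossterm. induction N as [| N IH].
    - rewrite !sum_n_m_1_0. ring.
    - rewrite !sum_n_m_1_S, IH, Rmult_minus_distr_l, cos_minus. ring. }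
  rewrite !Cmod2_alt, !dsum_parts, X, !sum_n_m_1_S. cbn [Re Im fst snd].
  assert (Hx : 0 < INR (S N)) by (apply lt_0_INR; lia).
  assert (Hs : 0 < sqrt (INR (S N))) by now apply sqrt_lt_R0.
  assert (E : / INR (S N) = (/ sqrt (INR (S N))) ^ 2 * (sin (t * ln (INR (S N))) ^ 2 + cos (t * ln (INR (S N))) ^ 2)).
  { replace (sin _ ^ 2 + cos _ ^ 2) with 1.
    - rewrite Rmult_1_r, pow_inv, pow2_sqrt by lra. reflexivity.
    - rewrite <- !Rsqr_pow2. symmetry. apply sin2_cos2. }
  rewrite E. ring.
Qed.

Lemma is_RInt_0 (a b : R) : is_RInt (fun _ => 0) a b 0.
Proof.
  pose proof (is_RInt_const (V := R_NormedModule) a b 0) as H.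
  change (scal (b - a) 0) with ((b - a) * 0) in H. rewrite Rmult_0_r in H. exact H.
Qed.

Lemma is_RInt_weighted_cos (T L : R) : L <> 0 ->
  is_RInt (fun t => (T - t) * cos (t * L)) 0 T ((1 - cos (T * L)) / L ^ 2).
Proof.
  intros HL.
  replace ((1 - cos (T * L)) / L ^ 2) with
    (minus ((T - T) * sin (T * L) / L - cos (T * L) / L ^ 2)
           ((T - 0) * sin (0 * L) / L - cos (0 * L) / L ^ 2)).
  2:{ rewrite Rmult_0_l, sin_0, cos_0. unfold minus, plus, opp; simpl. field. exact HL. }
  apply (is_RInt_derive (V := R_CompleteNormedModule)
    (fun t => (T - t) * sin (t * L) / L - cos (t * L) / L ^ 2) (fun t => (T - t) * cos (t * L))).
  - intros t _. auto_derive; [trivial |]. field. exact HL.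
  - intros t _. apply (ex_derive_continuous (fun t => (T - t) * cos (t * L))).
    auto_derive. trivial.
Qed.

(* Since [n <= m (1 + (n - m))], the factor [1 / sqrt m] costs only [sqrt (1 + (n - m)) / sqrt n]. *)
Lemma crossterm_bound (m n : R) : 1 <= m -> m + 1 <= n ->
  / sqrt m * / sqrt n * / (ln n - ln m) ^ 2 <= 6 * n * (/ sqrt (n - m) - / sqrt (n - m + 1)).
Proof.
  intros Hm Hn. set (k := n - m). assert (Hk : 1 <= k) by (unfold k; lra).
  assert (L1 : k / n <= ln n - ln m) by (apply ln_diff_ge; lra).
  assert (P1 : 0 < k / n) by (apply Rdiv_lt_0_compat; lra).
  assert (L2 : / (ln n - ln m) ^ 2 <= (n / k) ^ 2).
  { replace ((n / k) ^ 2) with (/ (k / n) ^ 2) by (field; lra).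
    apply Rinv_le_contravar; [nra |]. apply pow_incr. lra. }
  assert (Sm : 0 < sqrt m) by (apply sqrt_lt_R0; lra).
  assert (Sn : 0 < sqrt n) by (apply sqrt_lt_R0; lra).
  assert (Sk : 0 < sqrt (k + 1)) by (apply sqrt_lt_R0; lra).
  assert (L3 : / sqrt m <= sqrt (k + 1) / sqrt n).
  { apply Rmult_le_reg_r with (sqrt m * sqrt n); [nra |].
    replace (/ sqrt m * (sqrt m * sqrt n)) with (sqrt n) by (field; lra).
    replace (sqrt (k + 1) / sqrt n * (sqrt m * sqrt n)) with (sqrt m * sqrt (k + 1)) by (field; lra).
    rewrite <- sqrt_mult by lra. apply sqrt_le_1_alt. unfold k. nra. }
  apply Rle_trans with (sqrt (k + 1) / sqrt n * / sqrt n * (n / k) ^ 2).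
  - apply Rmult_le_compat; [| | | exact L2].
    + left. apply Rmult_lt_0_compat; now apply Rinv_0_lt_compat.
    + left. apply Rinv_0_lt_compat. apply pow_lt. lra.
    + apply Rmult_le_compat_r; [| exact L3]. left. now apply Rinv_0_lt_compat.
  - replace (sqrt (k + 1) / sqrt n * / sqrt n * (n / k) ^ 2) with
      (n * ((k + 1) / k) * / (k * sqrt (k + 1))).
    2:{ rewrite <- (sqrt_sqrt (k + 1)) at 1 by lra.
        replace (n * (sqrt (k + 1) * sqrt (k + 1) / k) * / (k * sqrt (k + 1))) with
          (sqrt (k + 1) * n / k ^ 2) by (field; lra).
        rewrite <- (sqrt_sqrt n) at 1 by lra.
        replace ((n / k) ^ 2) with ((sqrt n * sqrt n) * (sqrt n * sqrt n) / k ^ 2)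
          by (rewrite sqrt_sqrt by lra; field; lra).
        field. lra. }
    pose proof (inv_sqrt_telescope k Hk) as T.
    assert (P2 : 0 < / (k * sqrt (k + 1))) by (apply Rinv_0_lt_compat; nra).
    assert (Q : (k + 1) / k <= 2) by (apply Rle_div_l; lra).
    assert (P3 : 0 < (k + 1) / k) by (apply Rdiv_lt_0_compat; lra).
    apply Rle_trans with (n * 2 * / (k * sqrt (k + 1))).
    + apply Rmult_le_compat_r; [lra |]. apply Rmult_le_compat_l; lra.
    + replace (6 * n * (/ sqrt k - / sqrt (k + 1))) with (n * 2 * (3 * (/ sqrt k - / sqrt (k + 1)))) by ring.
      apply Rmult_le_compat_l; lra.
Qed.

(** By [crossterm_bound] the row telescopes in [n - m], and [1 - cos <= 2] doubles [6] to [12]. Each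
    weighted integral is nonnegative, so no lower error arises. *)
Lemma is_RInt_crossterm (T : R) (n M : nat) : (M < n)%nat ->
  exists v, is_RInt (fun t => (T - t) * crossterm n M t) 0 T v /\
    0 <= v <= 12 * INR n * (/ sqrt (INR n - INR M) - / sqrt (INR n)).
Proof.
  induction M as [| M IH]; intros HM.
  - exists 0. split.
    + apply is_RInt_ext with (fun _ => 0).
      { intros t _. unfold crossterm. rewrite sum_n_m_1_0. eqR. ring. }
      apply is_RInt_0.
    + simpl INR. rewrite Rminus_0_r. lra.
  - destruct IH as [v [Iv Bv]]; [lia |].
    assert (Hm : 1 <= INR (S M)) by (apply (le_INR 1); lia).
    assert (Hn : INR (S M) + 1 <= INR n) by (rewrite <- S_INR; apply le_INR; lia).
    set (a := / sqrt (INR (S M)) * / sqrt (INR n)).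
    set (L := ln (INR n) - ln (INR (S M))).
    assert (HL : 0 < L) by (unfold L; pose proof (ln_increasing (INR (S M)) (INR n)); lra).
    exists (v + a * ((1 - cos (T * L)) / L ^ 2)). split.
    + apply is_RInt_ext with (fun t => plus ((T - t) * crossterm n M t) (scal a ((T - t) * cos (t * L)))).
      { intros t _. unfold crossterm. rewrite sum_n_m_1_S. fold L a.
        eqR. unfold plus, scal; simpl; unfold mult; simpl. ring. }
      apply (is_RInt_plus (V := R_NormedModule) (fun t => (T - t) * crossterm n M t)); [exact Iv |].
      apply (is_RInt_scal (V := R_NormedModule)), is_RInt_weighted_cos. lra.
    + pose proof (crossterm_bound (INR (S M)) (INR n) Hm Hn) as B. fold L a in B.
      replace (INR n - INR (S M) + 1) with (INR n - INR M) in B by (rewrite S_INR; ring).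
      assert (Pa : 0 < a).
      { apply Rmult_lt_0_compat; apply Rinv_0_lt_compat, sqrt_lt_R0; lra. }
      assert (PL : 0 < / L ^ 2) by (apply Rinv_0_lt_compat, pow_lt, HL).
      assert (C2 : 0 <= 1 - cos (T * L) <= 2) by (pose proof (COS_bound (T * L)); lra).
      assert (Q : 0 <= a * ((1 - cos (T * L)) / L ^ 2) <= 2 * (a * / L ^ 2)).
      { unfold Rdiv. assert (0 < a * / L ^ 2) by now apply Rmult_lt_0_compat. nra. }
      lra.
Qed.

(** The diagonal gives [T^2 / 2] times the harmonic sum. Row [n] adds between [0] and [24 n], which
    totals at most [24 N^2]. *)
Lemma is_RInt_dsum_sqr (T : R) (N : nat) :
  exists v, is_RInt (fun t => (T - t) * Cmod (dsum t N) ^ 2) 0 T v /\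
    T ^ 2 / 2 * harmonic N <= v <= T ^ 2 / 2 * harmonic N + 24 * INR N ^ 2.
Proof.
  induction N as [| N [v [Iv Bv]]].
  - exists 0. split.
    + apply is_RInt_ext with (fun _ => 0).
      { intros t _. rewrite dsum_parts, Cmod2_alt, !sum_n_m_1_0. eqR. simpl. ring. }
      apply is_RInt_0.
    + unfold harmonic. rewrite sum_n_m_1_0. simpl. lra.
  - destruct (is_RInt_crossterm T (S N) N) as [w [Iw Bw]]; [lia |].
    exists (v + / INR (S N) * (T ^ 2 / 2) + 2 * w). split.
    + apply is_RInt_ext with (fun t => plus (plus ((T - t) * Cmod (dsum t N) ^ 2)
        (scal (/ INR (S N)) (T - t))) (scal 2 ((T - t) * crossterm (S N) N t))).
      { intros t _. rewrite Cmod_dsum_sqr_S. unfold plus, scal; cbn -[INR pow]; unfold mult; cbn -[INR pow]. eqR. ring. }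
      apply (is_RInt_plus (V := R_NormedModule) (fun t => plus ((T - t) * Cmod (dsum t N) ^ 2)
        (scal (/ INR (S N)) (T - t)))).
      * apply (is_RInt_plus (V := R_NormedModule) (fun t => (T - t) * Cmod (dsum t N) ^ 2)); [exact Iv |].
        apply (is_RInt_scal (V := R_NormedModule)).
        replace (T ^ 2 / 2) with (minus (T * T - T ^ 2 / 2) (T * 0 - 0 ^ 2 / 2))
          by (unfold minus, plus, opp; simpl; field).
        apply (is_RInt_derive (V := R_CompleteNormedModule) (fun t => T * t - t ^ 2 / 2) (fun t => T - t)).
        -- intros t _. auto_derive; [trivial | field].
        -- intros t _. apply (ex_derive_continuous (fun t => T - t)). auto_derive. trivial.
      * apply (is_RInt_scal (V := R_NormedModule)). exact Iw.
    + unfold harmonic in *. rewrite sum_n_m_1_S.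
      assert (Hx : 1 <= INR (S N)) by (apply (le_INR 1); lia).
      replace (INR (S N) - INR N) with 1 in Bw by (rewrite S_INR; ring).
      rewrite sqrt_1, Rinv_1 in Bw.
      assert (W : 12 * INR (S N) * (1 - / sqrt (INR (S N))) <= 12 * INR (S N)).
      { rewrite <- (Rmult_1_r (12 * INR (S N))) at 2. apply Rmult_le_compat_l; [lra |].
        assert (0 < / sqrt (INR (S N))) by (apply Rinv_0_lt_compat, sqrt_lt_R0; lra). lra. }
      assert (Q : INR (S N) ^ 2 = INR N ^ 2 + 2 * INR (S N) - 1) by (rewrite S_INR; ring).
      split; [lra |]. nra.
Qed.

Lemma harmonic_bounds (N : nat) :
  ln (INR (S N)) <= harmonic N /\ ((1 <= N)%nat -> harmonic N <= 1 + ln (INR N)).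
Proof.
  unfold harmonic. induction N as [| N [IH1 IH2]].
  - rewrite sum_n_m_1_0. simpl. rewrite ln_1. split; [lra | lia].
  - rewrite sum_n_m_1_S.
    assert (Hx : 0 < INR (S N)) by (apply lt_0_INR; lia).
    split.
    + pose proof (exp_ineq1_le (/ INR (S N))) as E.
      assert (L : ln (INR (S (S N))) - ln (INR (S N)) <= / INR (S N)).
      { rewrite <- ln_div by (apply lt_0_INR; lia).
        rewrite <- (ln_exp (/ INR (S N))).
        assert (Q : INR (S (S N)) / INR (S N) = 1 + / INR (S N)) by (rewrite (S_INR (S N)); field; lra).
        rewrite Q. apply ln_le; [| lra].
        assert (0 < / INR (S N)) by now apply Rinv_0_lt_compat. lra. }
      lra.
    + intros _. destruct N as [| N].
      * rewrite sum_n_m_1_0. simpl. rewrite ln_1. lra.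
      * specialize (IH2 ltac:(lia)).
        assert (Hy : 0 < INR (S N)) by (apply lt_0_INR; lia).
        pose proof (ln_diff_ge (INR (S N)) (INR (S (S N))) Hy) as D.
        rewrite (S_INR (S N)) in *.
        assert (E : (INR (S N) + 1 - INR (S N)) / (INR (S N) + 1) = / (INR (S N) + 1)) by (field; lra).
        lra.
Qed.

Lemma ex_RInt_of_continuous (f : R -> R) (a b : R) : (forall t, continuous f t) -> ex_RInt f a b.
Proof. intros H. apply (ex_RInt_continuous (V := R_CompleteNormedModule)). intros t _. apply H. Qed.

Lemma continuous_weighted (f : R -> R) (T t : R) : continuous f t ->
  continuous (fun t => (T - t) * f t) t.
Proof.
  intros Hf. apply (continuous_mult (K := R_AbsRing) (fun t => T - t) f); [| exact Hf].
  apply (ex_derive_continuous (fun t => T - t)). auto_derive. trivial.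
Qed.

Lemma ex_RInt_weighted_hardy (T a b : R) : ex_RInt (fun t => (T - t) * hardyZ2 t) a b.
Proof.
  apply ex_RInt_of_continuous. intros t. apply continuous_weighted, hardyZ2_continuous.
Qed.

(** [1/4 + t^2] is [|s|^2], so this integrates the squared error of the approximate formula,
    uniformly in [T]. *)
Lemma RInt_inv_quarter (T : R) : 0 <= T ->
  exists v, is_RInt (fun t => / (1 / 4 + t ^ 2)) 0 T v /\ v <= 4.
Proof.
  intros HT. exists (minus (2 * atan (2 * T)) (2 * atan (2 * 0))). split.
  - apply (is_RInt_derive (V := R_CompleteNormedModule) (fun t => 2 * atan (2 * t))
      (fun t => / (1 / 4 + t ^ 2))).
    + intros t _. assert (P : 0 <= t ^ 2) by apply pow2_ge_0. auto_derive; [trivial |].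
      unfold Rsqr. field. simpl in P. lra.
    + intros t _. assert (P : 0 <= t ^ 2) by apply pow2_ge_0.
      apply (ex_derive_continuous (fun t => / (1 / 4 + t ^ 2))). auto_derive. simpl in P. lra.
  - rewrite Rmult_0_r, atan_0. unfold minus, plus, opp; simpl.
    pose proof (atan_bound (2 * T)). pose proof PI_4. lra.
Qed.

(** With a free [eta] this replaces Cauchy-Schwarz for the mixed term: squares of [zeta] and of the
    sum are compared pointwise, in either direction, before integration. *)
Lemma Cmod_sqr_weighted (z w : C) (eta : R) : 0 < eta ->
  Cmod z ^ 2 <= (1 + eta) * Cmod w ^ 2 + (1 + / eta) * Cmod (z - w)%C ^ 2.
Proof.
  intros He. pose proof (Cmod_triangle w (z - w)%C) as T.
  replace (w + (z - w))%C with z in T by ring.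
  pose proof (Cmod_ge_0 z). set (a := Cmod w) in *. set (b := Cmod (z - w)) in *.
  apply Rle_trans with ((a + b) ^ 2); [apply pow_incr; lra |].
  assert (0 <= / eta * (eta * a - b) ^ 2).
  { apply Rmult_le_pos; [left; now apply Rinv_0_lt_compat | apply pow2_ge_0]. }
  replace (/ eta * (eta * a - b) ^ 2) with (eta * a ^ 2 - 2 * a * b + / eta * b ^ 2) in *
    by (field; lra).
  lra.
Qed.

Lemma hardy_dsum_mean_bounds (T eta : R) : 1 <= T -> 0 < eta ->
  exists B, T ^ 2 / 2 * ln T <= B <= T ^ 2 / 2 * ln T + 900 * T ^ 2 /\
    RInt (fun t => (T - t) * hardyZ2 t) 0 T <= (1 + eta) * B + (1 + / eta) * (6000 * T ^ 2) /\
    B <= (1 + eta) * RInt (fun t => (T - t) * hardyZ2 t) 0 T + (1 + / eta) * (6000 * T ^ 2).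
Proof.
  intros HT He.
  (* One length serves every [t] in [[0, T]]: there [4 |s| <= 4 T + 2 < N + 1]. As [T >= 1], also
     [N <= 6 T] and [N + 1 <= 7 T]. *)
  destruct (nfloor_ex (4 * T + 2)) as [N HN]; [lra |].
  assert (HN1 : (1 <= N)%nat).
  { apply INR_le. change (INR 1) with 1. lra. }
  destruct (is_RInt_dsum_sqr T N) as [B [IB [B1 B2]]].
  destruct (harmonic_bounds N) as [H1 H2]. specialize (H2 HN1).
  rewrite S_INR in H1.
  assert (LT : ln T <= ln (INR N + 1)) by (apply ln_le; lra).
  assert (LN : ln (INR N) <= ln T + 6).
  { apply Rle_trans with (ln (T * 7)); [apply ln_le; lra |].
    rewrite ln_mult by lra. pose proof (exp_ineq1_le 6).
    assert (ln 7 <= ln (exp 6)) by (apply ln_le; lra). rewrite ln_exp in *. lra. }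
  assert (T2 : 1 <= T ^ 2) by (apply pow_R1_Rle; lra).
  exists B. split; [split |].
  { apply Rle_trans with (T ^ 2 / 2 * harmonic N); [apply Rmult_le_compat_l; lra | lra]. }
  { apply Rle_trans with (T ^ 2 / 2 * (ln T + 7) + 24 * (6 * T) ^ 2).
    - eapply Rle_trans; [exact B2 |]. apply Rplus_le_compat.
      + apply Rmult_le_compat_l; lra.
      + apply Rmult_le_compat_l; [lra |]. apply pow_incr. split; [apply pos_INR | lra].
    - lra. }
  destruct (RInt_inv_quarter T ltac:(lra)) as [v [Iv Bv]].
  pose proof (RInt_correct (V := R_CompleteNormedModule) _ _ _ (ex_RInt_weighted_hardy T 0 T)) as IZ.
  set (Z := RInt (fun t => (T - t) * hardyZ2 t) 0 T) in *.
  assert (ERR : forall t, 0 < t < T ->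
    Cmod (zeta (half t) - dsum t N)%C ^ 2 <= 196 * (7 * T) * / (1 / 4 + t ^ 2)).
  { intros t Ht. pose proof (Cmod_half_ge t) as Hh. pose proof (Cmod_half_sqr t) as Hs.
    assert (Hc : Cmod (half t) <= T + 1 / 2).
    { apply Rsqr_incr_0_var; [| lra]. rewrite !Rsqr_pow2, Hs. nra. }
    assert (K : 4 * Cmod (half t) <= INR (S N)) by (rewrite S_INR; lra).
    pose proof (zeta_dsum_approx t N K) as Z1. rewrite S_INR in Z1.
    apply Rle_trans with ((14 * sqrt (INR N + 1) / Cmod (half t)) ^ 2).
    - apply pow_incr. split; [apply Cmod_ge_0 | exact Z1].
    - rewrite <- Hs. replace ((14 * sqrt (INR N + 1) / Cmod (half t)) ^ 2) with
        (196 * (sqrt (INR N + 1) ^ 2) * / Cmod (half t) ^ 2) by (field; lra).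
      rewrite pow2_sqrt by (pose proof (pos_INR N); lra).
      apply Rmult_le_compat_r; [left; apply Rinv_0_lt_compat, pow_lt; lra |]. lra. }
  assert (Pe : 0 < / eta) by now apply Rinv_0_lt_compat.
  assert (FIN : (1 + / eta) * (196 * (7 * T) * T) * v <= (1 + / eta) * (6000 * T ^ 2)).
  { rewrite Rmult_assoc. apply Rmult_le_compat_l; [lra |].
    replace (196 * (7 * T) * T) with (1372 * T ^ 2) by ring.
    apply Rle_trans with (1372 * T ^ 2 * 4); [apply Rmult_le_compat_l; lra | lra]. }
  (* Used twice with the roles of [zeta] and the sum exchanged. The squared error
     [196 * 7 T / |s|^2], weighted by at most [T], integrates to at most
     [4 * 1372 T^2 <= 6000 T^2]. *)
  assert (CMP : forall f g u w, is_RInt (fun t => (T - t) * f t) 0 T u -> is_RInt (fun t => (T - t) * g t) 0 T w ->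
    (forall t, 0 < t < T -> f t <= (1 + eta) * g t + (1 + / eta) * (196 * (7 * T) * / (1 / 4 + t ^ 2))) ->
    u <= (1 + eta) * w + (1 + / eta) * (6000 * T ^ 2)).
  { intros f g u w Iu Iw Hfg.
    apply Rle_trans with ((1 + eta) * w + (1 + / eta) * (196 * (7 * T) * T) * v); [| lra].
    apply (is_RInt_le (fun t => (T - t) * f t) (fun t => (1 + eta) * ((T - t) * g t) +
      (1 + / eta) * (196 * (7 * T) * T) * / (1 / 4 + t ^ 2)) 0 T); [lra | exact Iu | |].
    - apply (is_RInt_plus (V := R_NormedModule) (fun t => (1 + eta) * ((T - t) * g t))).
      + apply (is_RInt_scal (V := R_NormedModule)). exact Iw.
      + apply (is_RInt_scal (V := R_NormedModule)). exact Iv.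
    - intros t Ht.
      assert (P : 0 < / (1 / 4 + t ^ 2)) by (apply Rinv_0_lt_compat; pose proof (pow2_ge_0 t); lra).
      assert (P2 : 0 <= (1 + / eta) * (196 * (7 * T) * / (1 / 4 + t ^ 2))).
      { repeat apply Rmult_le_pos; lra. }
      apply Rle_trans with ((T - t) * ((1 + eta) * g t + (1 + / eta) * (196 * (7 * T) * / (1 / 4 + t ^ 2)))).
      + apply Rmult_le_compat_l; [lra | now apply Hfg].
      + assert (Q : (T - t) * ((1 + / eta) * (196 * (7 * T) * / (1 / 4 + t ^ 2))) <=
          T * ((1 + / eta) * (196 * (7 * T) * / (1 / 4 + t ^ 2)))) by (apply Rmult_le_compat_r; lra).
        nra. }
  split.
  - apply (CMP hardyZ2 (fun t => Cmod (dsum t N) ^ 2)); [exact IZ | exact IB |].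
    intros t Ht. rewrite hardyZ2_zeta. eapply Rle_trans; [apply (Cmod_sqr_weighted _ (dsum t N) eta He) |].
    apply Rplus_le_compat_l. apply Rmult_le_compat_l; [lra | now apply ERR].
  - apply (CMP (fun t => Cmod (dsum t N) ^ 2) hardyZ2); [exact IB | exact IZ |].
    intros t Ht. rewrite hardyZ2_zeta.
    eapply Rle_trans; [apply (Cmod_sqr_weighted (dsum t N) (zeta (half t)) eta He) |].
    apply Rplus_le_compat_l. apply Rmult_le_compat_l; [lra |].
    replace (dsum t N - zeta (half t))%C with (- (zeta (half t) - dsum t N))%C by ring.
    rewrite Cmod_opp. now apply ERR.
Qed.

Lemma ln_eventually_ge (K : R) : exists T0, 1 < T0 /\ forall T, T0 <= T -> K <= ln T.
Proof.
  exists (exp (Rmax K 1)). split.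
  - pose proof (exp_ineq1_le (Rmax K 1)). pose proof (Rmax_r K 1). lra.
  - intros T HT. apply Rle_trans with (ln (exp (Rmax K 1))).
    + rewrite ln_exp. apply Rmax_l.
    + apply ln_le; [apply exp_pos | exact HT].
Qed.

Lemma hardy_weighted_mean (eps : R) : 0 < eps ->
  exists T0, 1 < T0 /\ forall T, T0 <= T ->
    Rabs (RInt (fun t => (T - t) * hardyZ2 t) 0 T - T ^ 2 / 2 * ln T) <= eps * (T ^ 2 * ln T).
Proof.
  intros He. set (eta := Rmin eps 1).
  assert (Heta : 0 < eta <= 1) by (unfold eta; split; [apply Rmin_case; lra | apply Rmin_r]).
  assert (Hle : eta <= eps) by apply Rmin_l.
  assert (Pe : 1 <= / eta) by (rewrite <- Rinv_1; apply Rinv_le_contravar; lra).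
  (* All errors of order [T^2]: [900] from the diagonal, doubled since [1 + eta <= 2], and the
     approximation error. For fixed [eta] a large [ln T] absorbs them. *)
  set (K := 1800 + (1 + / eta) * 6000).
  destruct (ln_eventually_ge (K * (2 / eta))) as [T0 [HT0 HL]].
  exists T0. split; [exact HT0 |]. intros T HT. specialize (HL T HT).
  destruct (hardy_dsum_mean_bounds T eta) as [B [[B1 B2] [B3 B4]]]; [lra | lra |].
  set (Z := RInt (fun t => (T - t) * hardyZ2 t) 0 T) in *.
  assert (T2 : 0 < T ^ 2) by (apply pow_lt; lra).
  assert (L0 : 0 < ln T) by (rewrite <- ln_1; apply ln_increasing; lra).
  set (X := T ^ 2 * ln T) in *.
  replace (T ^ 2 / 2 * ln T) with (X / 2) in * by (unfold X; field).
  assert (HK : K * T ^ 2 <= eta / 2 * X).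
  { unfold X. apply Rmult_le_reg_r with (2 / eta); [apply Rdiv_lt_0_compat; lra |].
    replace (eta / 2 * (T ^ 2 * ln T) * (2 / eta)) with (T ^ 2 * ln T) by (field; lra).
    replace (K * T ^ 2 * (2 / eta)) with (T ^ 2 * (K * (2 / eta))) by ring.
    apply Rmult_le_compat_l; lra. }
  assert (HX : 0 < X) by now apply Rmult_lt_0_compat.
  assert (E1 : eta * X <= eps * X) by (apply Rmult_le_compat_r; lra).
  assert (K1 : (1 + / eta) * (6000 * T ^ 2) = K * T ^ 2 - 1800 * T ^ 2) by (unfold K; ring).
  rewrite K1 in B3, B4.
  assert (D : eta * B <= eta * (X / 2) + 900 * T ^ 2) by nra.
  assert (UP : Z <= X / 2 + eps * X) by nra.
  assert (LO : X / 2 - eps * X <= Z).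
  (* The reverse comparison contains [eta * Z]; the upper estimate for [Z] turns it into
     [eta * X / 2] plus a term of second order in [eta]. *)
  { assert (Zb : eta * Z <= eta * (X / 2) + eta * (eta * X)).
    { rewrite <- Rmult_plus_distr_l. apply Rmult_le_compat_l; [lra |]. nra. }
    destruct (Rle_lt_dec Z (X / 2)) as [C | C]; [| nra].
    assert (eta * Z <= eta * (X / 2)) by (apply Rmult_le_compat_l; lra). nra. }
  apply Rabs_le_between. lra.
Qed.

Lemma RInt_split (f : R -> R) (a b c : R) : ex_RInt f a b -> ex_RInt f b c ->
  @eq R (RInt f a c) (RInt f a b + RInt f b c).
Proof. intros H1 H2. symmetry. exact (RInt_Chasles (V := R_CompleteNormedModule) f a b c H1 H2). Qed.

(** * Removal of the weight *)

Definition meansq (T : R) : R := RInt hardyZ2 0 T.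

Lemma ex_RInt_hardyZ2 (a b : R) : ex_RInt hardyZ2 a b.
Proof. apply ex_RInt_of_continuous. intros t. apply hardyZ2_continuous. Qed.

Lemma meansq_increment (a b : R) : meansq b - meansq a = RInt hardyZ2 a b.
Proof.
  unfold meansq. rewrite (RInt_split hardyZ2 0 a b) by apply ex_RInt_hardyZ2. ring.
Qed.

Lemma meansq_mono (a b : R) : a <= b -> meansq a <= meansq b.
Proof.
  intros H. assert (0 <= RInt hardyZ2 a b).
  { apply RInt_ge_0; [exact H | apply ex_RInt_hardyZ2 | intros; apply hardyZ2_pos]. }
  rewrite <- meansq_increment in *. lra.
Qed.

(** The weighted integral is a primitive of [meansq], so its increment over a step [h] lies between
    [h] times the two end values of this monotone function. *)
Lemma meansq_difference_bounds (T h : R) : 0 <= T -> 0 <= h ->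
  h * meansq T <= RInt (fun t => (T + h - t) * hardyZ2 t) 0 (T + h) - RInt (fun t => (T - t) * hardyZ2 t) 0 T
  <= h * meansq (T + h).
Proof.
  intros HT Hh.
  rewrite (RInt_split (fun t => (T + h - t) * hardyZ2 t) 0 T (T + h)) by apply ex_RInt_weighted_hardy.
  assert (E : @eq R (RInt (fun t => (T + h - t) * hardyZ2 t) 0 T)
    (h * meansq T + RInt (fun t => (T - t) * hardyZ2 t) 0 T)).
  { unfold meansq. apply is_RInt_unique.
    apply is_RInt_ext with (fun t => plus (scal h (hardyZ2 t)) ((T - t) * hardyZ2 t)).
    { intros t _. eqR. unfold plus, scal; simpl; unfold mult; simpl. ring. }
    apply (is_RInt_plus (V := R_NormedModule) (fun t => scal h (hardyZ2 t))).
    - apply (is_RInt_scal (V := R_NormedModule)).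
      exact (RInt_correct (V := R_CompleteNormedModule) _ _ _ (ex_RInt_hardyZ2 0 T)).
    - exact (RInt_correct (V := R_CompleteNormedModule) _ _ _ (ex_RInt_weighted_hardy T 0 T)). }
  rewrite E.
  assert (P1 : 0 <= RInt (fun t => (T + h - t) * hardyZ2 t) T (T + h)).
  { apply RInt_ge_0; [lra | apply ex_RInt_weighted_hardy |].
    intros t Ht. apply Rmult_le_pos; [lra | apply hardyZ2_pos]. }
  assert (P2 : RInt (fun t => (T + h - t) * hardyZ2 t) T (T + h) <= h * (meansq (T + h) - meansq T)).
  { rewrite meansq_increment.
    apply (is_RInt_le (fun t => (T + h - t) * hardyZ2 t) (fun t => scal h (hardyZ2 t)) T (T + h)); [lra | | |].
    - exact (RInt_correct (V := R_CompleteNormedModule) _ _ _ (ex_RInt_weighted_hardy (T + h) T (T + h))).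
    - apply (is_RInt_scal (V := R_NormedModule)).
      exact (RInt_correct (V := R_CompleteNormedModule) _ _ _ (ex_RInt_hardyZ2 T (T + h))).
    - intros t Ht. unfold scal; simpl; unfold mult; simpl.
      apply Rmult_le_compat_r; [apply hardyZ2_pos | lra]. }
  lra.
Qed.

(** The step is [h = d T] and the weighted integral is known within [d^2 T^2 ln T]: divided by [h],
    this error becomes [d T ln T], of the same order as the error made by moving from [T] to [T + h]
    or [T - h]. *)
Lemma meansq_asymptotic (eps : R) : 0 < eps ->
  exists T0, 1 < T0 /\ forall T, T0 <= T -> Rabs (meansq T - T * ln T) <= eps * (T * ln T).
Proof.
  intros He. set (d := Rmin (eps / 6) (1 / 2)).
  assert (Hd : 0 < d <= 1 / 2) by (unfold d; split; [apply Rmin_case; lra | apply Rmin_r]).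
  assert (Hde : 6 * d <= eps) by (unfold d; pose proof (Rmin_l (eps / 6) (1 / 2)); lra).
  destruct (hardy_weighted_mean (d ^ 2)) as [T1 [HT1 HW]]; [apply pow_lt; lra |].
  (* Makes [d * ln T >= 6], so that the shift [ln (T + h) - ln T <= d] is of second order in [d]
     relative to [ln T]. *)
  destruct (ln_eventually_ge (6 / d)) as [T2 [HT2 HL]].
  exists (Rmax (2 * T1) T2). split.
  { eapply Rlt_le_trans; [exact HT2 | apply Rmax_r]. }
  intros T HT. pose proof (Rmax_l (2 * T1) T2). pose proof (Rmax_r (2 * T1) T2).
  specialize (HL T ltac:(lra)).
  assert (L6 : 6 <= d * ln T).
  { apply Rmult_le_reg_r with (/ d); [apply Rinv_0_lt_compat; lra |].
    replace (d * ln T * / d) with (ln T) by (field; lra). exact HL. }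
  assert (TT : 0 < T) by lra.
  set (h := d * T).
  assert (Hh : 0 < h) by (apply Rmult_lt_0_compat; lra).
  destruct (meansq_difference_bounds T h ltac:(lra) ltac:(lra)) as [D1 _].
  assert (Hsub : 0 <= T - h) by (unfold h; nra).
  destruct (meansq_difference_bounds (T - h) h Hsub ltac:(lra)) as [_ D2].
  replace (T - h + h) with T in D2 by ring.
  pose proof (HW T ltac:(lra)) as W0.
  pose proof (HW (T + h) ltac:(lra)) as W1.
  pose proof (HW (T - h) ltac:(unfold h; nra)) as W2.
  set (J0 := RInt (fun t => (T - t) * hardyZ2 t) 0 T) in *.
  set (J1 := RInt (fun t => (T + h - t) * hardyZ2 t) 0 (T + h)) in *.
  set (J2 := RInt (fun t => (T - h - t) * hardyZ2 t) 0 (T - h)) in *.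
  set (L := ln T) in *.
  assert (L1 : ln (T + h) <= L + d).
  { replace (T + h) with (T * (1 + d)) by (unfold h; ring). rewrite ln_mult by lra.
    assert (ln (1 + d) <= ln (exp d)) by (apply ln_le; [lra | apply exp_ineq1_le]).
    rewrite ln_exp in *. unfold L. lra. }
  assert (L2 : ln (T - h) <= L) by (apply ln_le; [unfold h; nra | lra]).
  assert (L3 : 0 <= ln (T - h)) by (apply ln_nonneg; unfold h; nra).
  apply Rabs_le_between in W0, W1, W2.
  assert (T2p : 0 < T ^ 2) by (apply pow_lt; lra).
  assert (LL : 0 < L) by nra.
  assert (U1 : J1 <= (1 / 2 + d ^ 2) * ((1 + d) ^ 2 * T ^ 2 * (L + d))).
  { apply Rle_trans with ((1 / 2 + d ^ 2) * ((T + h) ^ 2 * ln (T + h))); [lra |].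
    apply Rmult_le_compat_l; [nra |].
    replace ((T + h) ^ 2) with ((1 + d) ^ 2 * T ^ 2) by (unfold h; ring).
    apply Rmult_le_compat_l; [nra | exact L1]. }
  assert (U2 : meansq T <= T * (L * (1 + 6 * d))).
  { apply Rmult_le_reg_l with (h * T); [nra |].
    apply Rle_trans with (T * (J1 - J0)); [nra |].
    apply Rle_trans with (T * (T ^ 2 * ((1 / 2 + d ^ 2) * ((1 + d) ^ 2 * (L + d)) - (1 / 2 - d ^ 2) * L))).
    { apply Rmult_le_compat_l; [lra |]. lra. }
    replace (h * T * (T * (L * (1 + 6 * d)))) with (T * (T ^ 2 * (d * L * (1 + 6 * d)))) by (unfold h; ring).
    apply Rmult_le_compat_l; [lra |]. apply Rmult_le_compat_l; [lra |].
    assert (Q1 : (1 / 2 + d ^ 2) * (1 + d) ^ 2 <= 1 / 2 + d + 4 * d ^ 2) by nra.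
    assert (Q2 : (1 / 2 + d ^ 2) * (1 + d) ^ 2 <= 2) by nra.
    assert (Q3 : ((1 / 2 + d ^ 2) * (1 + d) ^ 2) * (L + d) <= (1 / 2 + d + 4 * d ^ 2) * L + 2 * d) by nra.
    assert (Q4 : 2 * d <= d * (d * L)) by nra.
    lra. }
  assert (V1 : J2 <= (1 / 2 + d ^ 2) * ((1 - d) ^ 2 * T ^ 2 * L)).
  { apply Rle_trans with ((1 / 2 + d ^ 2) * ((T - h) ^ 2 * ln (T - h))); [lra |].
    apply Rmult_le_compat_l; [nra |].
    replace ((T - h) ^ 2) with ((1 - d) ^ 2 * T ^ 2) by (unfold h; ring).
    apply Rmult_le_compat_l; [nra | exact L2]. }
  assert (V2 : T * (L * (1 - 6 * d)) <= meansq T).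
  { apply Rmult_le_reg_l with (h * T); [nra |].
    apply Rle_trans with (T * (J0 - J2)); [| nra].
    apply Rle_trans with (T * (T ^ 2 * ((1 / 2 - d ^ 2) * L - (1 / 2 + d ^ 2) * ((1 - d) ^ 2 * L)))).
    2:{ apply Rmult_le_compat_l; [lra |]. lra. }
    replace (h * T * (T * (L * (1 - 6 * d)))) with (T * (T ^ 2 * (L * (d * (1 - 6 * d))))) by (unfold h; ring).
    apply Rmult_le_compat_l; [lra |]. apply Rmult_le_compat_l; [lra |].
    replace ((1 / 2 - d ^ 2) * L - (1 / 2 + d ^ 2) * ((1 - d) ^ 2 * L)) with
      (L * ((1 / 2 - d ^ 2) - (1 / 2 + d ^ 2) * (1 - d) ^ 2)) by ring.
    apply Rmult_le_compat_l; [lra |]. nra. }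
  assert (E : 6 * d * (T * L) <= eps * (T * L)) by (apply Rmult_le_compat_r; nra).
  apply Rabs_le_between. lra.
Qed.

(** * Regularity and growth of Jacob's ladders *)

Lemma RInt_pos_of_point (h : R -> R) (a b c : R) : a < c < b -> (forall t, continuous h t) ->
  (forall t, a <= t <= b -> 0 <= h t) -> 0 < h c -> 0 < RInt h a b.
Proof.
  intros Hc Hh Hp Hpos.
  assert (Q : 0 < h c / 2) by lra.
  destruct (proj1 (filterlim_locally h (h c)) (Hh c) (mkposreal _ Q)) as [d Hd].
  assert (Hd' : forall t, Rabs (t - c) < d -> 0 < h t).
  { intros t Ht. specialize (Hd t Ht).
    unfold ball in Hd; simpl in Hd; unfold AbsRing_ball, abs, minus, plus, opp in Hd; simpl in Hd.
    apply Rabs_lt_between in Hd. lra. }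
  set (e := Rmin (d / 2) (Rmin (c - a) (b - c))).
  pose proof (cond_pos d) as Pd.
  assert (He : 0 < e) by (unfold e; repeat apply Rmin_case; lra).
  assert (E1 : e <= d / 2) by apply Rmin_l.
  assert (E2 : e <= c - a) by (eapply Rle_trans; [apply Rmin_r | apply Rmin_l]).
  assert (E3 : e <= b - c) by (eapply Rle_trans; [apply Rmin_r | apply Rmin_r]).
  assert (Ex : forall u v, ex_RInt h u v) by (intros; now apply ex_RInt_of_continuous).
  rewrite (RInt_split h a (c - e) b), (RInt_split h (c - e) (c + e) b) by apply Ex.
  assert (0 <= RInt h a (c - e)) by (apply RInt_ge_0; [lra | apply Ex | intros; apply Hp; lra]).
  assert (0 <= RInt h (c + e) b) by (apply RInt_ge_0; [lra | apply Ex | intros; apply Hp; lra]).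
  assert (0 < RInt h (c - e) (c + e)).
  { apply RInt_gt_0; [lra | | intros; apply Hh]. intros t Ht. apply Hd'.
    apply Rabs_lt_between. lra. }
  lra.
Qed.

Lemma meansq_unbounded (K : R) : exists T0, forall T, T0 <= T -> K <= meansq T.
Proof.
  destruct (meansq_asymptotic (1 / 2)) as [T1 [HT1 H1]]; [lra |].
  destruct (ln_eventually_ge (2 * Rmax K 0)) as [T2 [HT2 H2]].
  exists (Rmax T1 T2). intros T HT. pose proof (Rmax_l T1 T2). pose proof (Rmax_r T1 T2).
  specialize (H1 T ltac:(lra)). specialize (H2 T ltac:(lra)). apply Rabs_le_between in H1.
  pose proof (Rmax_l K 0). pose proof (Rmax_r K 0).
  assert (1 * ln T <= T * ln T) by (apply Rmult_le_compat_r; lra). lra.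
Qed.

(** If [Z^2] vanished on an interval it would vanish everywhere to its right, and [meansq] would be
    constant from there on, against its growth. *)
Lemma hardyZ2_pos_point (a b : R) : a < b -> exists c, a < c < b /\ 0 < hardyZ2 c.
Proof.
  intros Hab. destruct (classic (exists c, a < c < b /\ 0 < hardyZ2 c)) as [E | E]; [exact E |].
  exfalso.
  assert (Z : forall t, a < t -> hardyZ2 t = 0).
  { apply (hardyZ2_vanish_forward a b Hab). intros t Ht.
    pose proof (hardyZ2_pos t). destruct (Req_dec (hardyZ2 t) 0) as [| N]; [assumption |].
    exfalso. apply E. exists t. lra. }
  destruct (meansq_unbounded (meansq b + 1)) as [T0 HT0].
  specialize (HT0 (Rmax T0 b) (Rmax_l _ _)).
  assert (R0 : RInt hardyZ2 b (Rmax T0 b) = 0).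
  { rewrite (RInt_ext _ (fun _ => 0)).
    - rewrite RInt_const. apply Rmult_0_r.
    - intros t Ht. rewrite Rmin_left in Ht by apply Rmax_r. apply Z. lra. }
  rewrite <- meansq_increment in R0. lra.
Qed.

Lemma meansq_strict (a b : R) : a < b -> meansq a < meansq b.
Proof.
  intros Hab. destruct (hardyZ2_pos_point a b Hab) as [c [Hc Pc]].
  assert (0 < RInt hardyZ2 a b).
  { apply RInt_pos_of_point with c; [exact Hc | apply hardyZ2_continuous | intros; apply hardyZ2_pos | exact Pc]. }
  rewrite <- meansq_increment in H. lra.
Qed.

Lemma is_derive_meansq (T : R) : is_derive meansq T (hardyZ2 T).
Proof.
  apply (is_derive_RInt hardyZ2 meansq 0 T); [| apply hardyZ2_continuous].
  apply filter_forall. intros x.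
  exact (RInt_correct (V := R_CompleteNormedModule) _ _ _ (ex_RInt_hardyZ2 0 x)).
Qed.

Lemma continuous_mul_exp (g : R -> R) (c t : R) : continuous g t ->
  continuous (fun t => g t * exp (- c * t)) t.
Proof.
  intros Hg. apply (continuous_mult (K := R_AbsRing) g (fun t => exp (- c * t))); [exact Hg |].
  apply (ex_derive_continuous (fun t => exp (- c * t))). auto_derive. trivial.
Qed.

Lemma continuous_mul_id (g : R -> R) (t : R) : continuous g t -> continuous (fun t => g t * t) t.
Proof.
  intros Hg. apply (continuous_mult (K := R_AbsRing) g (fun t => t)); [exact Hg | apply continuous_id].
Qed.

(** For [g = hardyZ2] and [m = mu] this is the left side of the ladder equation as a function of
    [x]. A general [g] is allowed because differentiation in [x] reproduces the integral with
    [g t * t], so one lemma yields both the derivative and its continuity. *)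
Definition laplace (g : R -> R) (m : R -> R) (x : R) : R :=
  RInt (fun t => g t * exp (- (2 / x) * t)) 0 (m x).

Lemma is_derive_laplace (g m : R -> R) (x dm : R) : (forall t, continuous g t) -> 0 < x ->
  is_derive m x dm ->
  is_derive (laplace g m) x
    (2 / x ^ 2 * laplace (fun t => g t * t) m x + g (m x) * exp (- (2 / x) * m x) * dm).
Proof.
  intros Hg Hx Hm.
  set (f := fun z t => g t * exp (- (2 / z) * t)).
  assert (Ex : forall y a b, ex_RInt (fun t => f y t) a b).
  { intros y a b. apply ex_RInt_of_continuous. intros t. unfold f.
    now apply continuous_mul_exp. }
  assert (Df : forall z t, 0 < z -> is_derive (fun u => f u t) z (g t * t * (2 / z ^ 2 * exp (- (2 / z) * t)))).
  { intros z t Hz. unfold f. auto_derive; [lra |]. unfold Rdiv. field. lra. }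
  assert (C2 : forall z t, 0 < z ->
    continuity_2d_pt (fun u v => Derive (fun z => f z v) u) z t).
  { intros z t Hz.
    apply continuity_2d_pt_ext_loc with (fun u v => g v * v * (2 * / u ^ 2 * exp (- (2 * / u) * v))).
    - exists (mkposreal z Hz). intros u v Hu Hv. simpl in Hu. apply Rabs_lt_between in Hu.
      symmetry. apply is_derive_unique. apply Df. lra.
    - assert (I2 : continuity_2d_pt (fun u _ => / u) z t).
      { apply (continuity_2d_pt_inv (fun u _ => u)); [apply continuity_2d_pt_id1 | lra]. }
      assert (I3 : continuity_2d_pt (fun u _ => / u ^ 2) z t).
      { apply continuity_2d_pt_ext_loc with (fun u _ => / u * / u).
        - exists (mkposreal z Hz). intros u v Hu Hv. simpl in Hu. apply Rabs_lt_between in Hu.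
          field. lra.
        - now apply continuity_2d_pt_mult. }
      assert (Cc : forall c : R, continuity_2d_pt (fun _ _ => c) z t) by (intros; apply continuity_2d_pt_const).
      apply (continuity_2d_pt_mult (fun _ v => g v * v) (fun u v => 2 * / u ^ 2 * exp (- (2 * / u) * v))).
      + apply (continuity_1d_2d_pt_comp (fun v => g v * v) (fun _ v => v)); [| apply continuity_2d_pt_id2].
        apply continuity_pt_filterlim. now apply continuous_mul_id.
      + apply (continuity_2d_pt_mult (fun u _ => 2 * / u ^ 2) (fun u v => exp (- (2 * / u) * v))).
        * apply (continuity_2d_pt_mult (fun _ _ => 2) (fun u _ => / u ^ 2)); [apply Cc | exact I3].
        * apply (continuity_1d_2d_pt_comp exp (fun u v => - (2 * / u) * v)).
          { apply derivable_continuous_pt, derivable_pt_exp. }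
          apply (continuity_2d_pt_mult (fun u _ => - (2 * / u)) (fun _ v => v)); [| apply continuity_2d_pt_id2].
          apply (continuity_2d_pt_opp (fun u _ => 2 * / u)).
          apply (continuity_2d_pt_mult (fun _ _ => 2) (fun u _ => / u)); [apply Cc | exact I2]. }
  assert (Hx2 : 0 < x / 2) by lra.
  assert (Loc : locally x (fun z => 0 < z)).
  { exists (mkposreal _ Hx2). intros z Hz.
    unfold ball in Hz; simpl in Hz; unfold AbsRing_ball, abs, minus, plus, opp in Hz; simpl in Hz.
    apply Rabs_lt_between in Hz. lra. }
  assert (D : is_derive (fun x => RInt (fun t => f x t) 0 (m x)) x
     (RInt (fun t => Derive (fun u => f u t) x) 0 (m x) + f x (m x) * dm)).
  { apply is_derive_RInt_param_bound_comp_aux3.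
    - apply filter_forall. intros y. apply Ex.
    - exists (mkposreal 1 Rlt_0_1). apply filter_forall. intros y. apply Ex.
    - exact Hm.
    - exists (mkposreal 1 Rlt_0_1). revert Loc. apply filter_imp. intros z Hz t _.
      eexists. now apply Df.
    - intros t _. now apply C2.
    - exists (mkposreal _ Hx2). intros u v Hu _. simpl in Hu. apply Rabs_lt_between in Hu.
      apply C2. lra.
    - apply continuity_pt_filterlim. unfold f. now apply continuous_mul_exp. }
  evar_last; [exact D |]. f_equal.
  rewrite (RInt_ext _ (fun t => scal (2 / x ^ 2) (g t * t * exp (- (2 / x) * t)))).
  - unfold laplace. apply (RInt_scal (V := R_CompleteNormedModule)).
    apply ex_RInt_of_continuous. intros t.
    apply (continuous_mul_exp (fun t => g t * t)). now apply continuous_mul_id.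
  - intros t _. eqR.
    assert (Du : Derive (fun u => f u t) x = g t * t * (2 / x ^ 2 * exp (- (2 / x) * t)))
      by exact (is_derive_unique _ _ _ (Df x t Hx)).
    rewrite Du.
    unfold scal; simpl; unfold mult; simpl. ring.
Qed.

Lemma laplace_pos (g m : R -> R) (x c : R) : (forall t, continuous g t) ->
  (forall t, 0 <= t -> 0 <= g t) -> 0 < c < m x -> 0 < g c -> 0 < laplace g m x.
Proof.
  intros Hg Hp Hc Pc. apply RInt_pos_of_point with c; [exact Hc | | |].
  - intros t. now apply continuous_mul_exp.
  - intros t Ht. apply Rmult_le_pos; [apply Hp; lra | left; apply exp_pos].
  - apply Rmult_lt_0_compat; [exact Pc | apply exp_pos].
Qed.

(* By parts, the integral is [D m e^(-c m) - D 0 + c int_0^m D e^(-c t)]. *)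
Lemma laplace_comparison (D d : R -> R) (c m : R) : 0 <= m -> 0 <= c ->
  (forall t, is_derive D t (d t)) -> (forall t, continuous d t) ->
  (forall t, 0 <= t <= m -> 0 <= D t) ->
  - D 0 <= RInt (fun t => d t * exp (- c * t)) 0 m.
Proof.
  intros Hm Hc HD Hd HP.
  assert (CD : forall t, continuous D t).
  { intros t. apply (ex_derive_continuous D). eexists. apply HD. }
  assert (I1 : is_RInt (fun t => d t * exp (- c * t) - c * (D t * exp (- c * t))) 0 m
     (minus (D m * exp (- c * m)) (D 0 * exp (- c * 0)))).
  { apply (is_RInt_derive (V := R_CompleteNormedModule) (fun t => D t * exp (- c * t))
      (fun t => d t * exp (- c * t) - c * (D t * exp (- c * t)))).
    - intros t _. evar_last.
      + apply (is_derive_mult D (fun t => exp (- c * t)) t (d t) (- c * exp (- c * t))); [apply HD | | intros; apply Rmult_comm].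
        auto_derive; [trivial | ring].
      + unfold plus, mult; simpl. ring.
    - intros t _.
      apply (continuous_ext (fun t => 1 * (d t * exp (- c * t)) + - c * (D t * exp (- c * t)))).
      { intros u. eqR. ring. }
      apply (continuous_lin2 (fun t => d t * exp (- c * t)) (fun t => D t * exp (- c * t))).
      + now apply continuous_mul_exp.
      + now apply continuous_mul_exp. }
  assert (E2 : ex_RInt (fun t => D t * exp (- c * t)) 0 m).
  { apply ex_RInt_of_continuous. intros t. now apply continuous_mul_exp. }
  assert (P2 : 0 <= RInt (fun t => D t * exp (- c * t)) 0 m).
  { apply RInt_ge_0; [exact Hm | exact E2 |]. intros t Ht.
    apply Rmult_le_pos; [apply HP; lra | left; apply exp_pos]. }
  assert (I3 : is_RInt (fun t => d t * exp (- c * t)) 0 m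
    (plus (minus (D m * exp (- c * m)) (D 0 * exp (- c * 0))) (scal c (RInt (fun t => D t * exp (- c * t)) 0 m)))).
  { apply is_RInt_ext with (fun t => plus (d t * exp (- c * t) - c * (D t * exp (- c * t))) (scal c (D t * exp (- c * t)))).
    - intros t _. eqR. unfold plus, scal; simpl; unfold mult; simpl. ring.
    - apply (is_RInt_plus (V := R_NormedModule) (fun t => d t * exp (- c * t) - c * (D t * exp (- c * t)))); [exact I1 |].
      apply (is_RInt_scal (V := R_NormedModule)).
      exact (RInt_correct (V := R_CompleteNormedModule) _ _ _ E2). }
  rewrite (is_RInt_unique _ _ _ _ I3).
  unfold plus, minus, scal, opp; simpl; unfold mult, plus; simpl. rewrite Rmult_0_r, exp_0.
  assert (0 <= c * RInt (fun t => D t * exp (- c * t)) 0 m) by now apply Rmult_le_pos.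
  assert (0 <= D m * exp (- c * m)) by (apply Rmult_le_pos; [apply HP; lra | left; apply exp_pos]).
  lra.
Qed.

Lemma ladder_eq (mu : R -> R) (y0 : R) (phi : R -> R) (T1 T : R) :
  jacobs_ladder mu y0 phi T1 -> T1 <= T -> laplace hardyZ2 mu (phi T) = meansq T.
Proof. intros HJ HT. exact (jl_eq _ _ _ _ HJ T HT). Qed.

(** Bounds [F] on the part of its domain below [B]; as [meansq] is unbounded, [phi T] must
    eventually exceed [B]. Where [mu x] is negative the integral runs backwards and is at most [0],
    whence the [Rmax]. *)
Lemma laplace_le_meansq (mu : R -> R) (y0 x B : R) : ladder_bound mu y0 -> y0 < x -> x <= B ->
  laplace hardyZ2 mu x <= meansq (Rmax 0 (mu B)).
Proof.
  intros Hmu Hx HB. pose proof (lb_domain _ _ Hmu) as H0.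
  pose proof (lb_increasing _ _ Hmu x B Hx HB) as HM.
  assert (Ex : forall a b, ex_RInt (fun t => hardyZ2 t * exp (- (2 / x) * t)) a b).
  { intros a b. apply ex_RInt_of_continuous. intros t. apply continuous_mul_exp, hardyZ2_continuous. }
  destruct (Rle_lt_dec 0 (mu x)) as [P | P].
  - apply Rle_trans with (meansq (mu x)).
    + apply RInt_le; [exact P | apply Ex | apply ex_RInt_hardyZ2 |].
      intros t Ht. rewrite <- (Rmult_1_r (hardyZ2 t)) at 2.
      apply Rmult_le_compat_l; [apply hardyZ2_pos |]. rewrite <- exp_0. apply exp_monotone.
      assert (0 < 2 / x) by (apply Rdiv_lt_0_compat; lra). nra.
    + apply meansq_mono. eapply Rle_trans; [exact HM | apply Rmax_r].
  - assert (0 <= RInt (fun t => hardyZ2 t * exp (- (2 / x) * t)) (mu x) 0).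
    { apply RInt_ge_0; [lra | apply Ex |]. intros t _.
      apply Rmult_le_pos; [apply hardyZ2_pos | left; apply exp_pos]. }
    unfold laplace. rewrite <- (opp_RInt_swap (V := R_CompleteNormedModule)) by apply Ex.
    apply Rle_trans with 0; [unfold opp; simpl; lra |].
    apply Rle_trans with (meansq 0).
    + unfold meansq. rewrite RInt_point. right. reflexivity.
    + apply meansq_mono, Rmax_l.
Qed.

Lemma ladder_to_infinity (mu : R -> R) (y0 : R) (phi : R -> R) (T1 B : R) :
  ladder_bound mu y0 -> jacobs_ladder mu y0 phi T1 ->
  exists T0, T1 <= T0 /\ forall T, T0 <= T -> B < phi T.
Proof.
  intros Hmu HJ.
  destruct (meansq_unbounded (meansq (Rmax 0 (mu B)) + 1)) as [T0 HT0].
  exists (Rmax T1 T0). split; [apply Rmax_l |]. intros T HT.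
  pose proof (Rmax_l T1 T0). pose proof (Rmax_r T1 T0).
  destruct (Rlt_le_dec B (phi T)) as [| C]; [assumption |]. exfalso.
  specialize (HT0 T ltac:(lra)).
  pose proof (laplace_le_meansq mu y0 (phi T) B Hmu (jl_range _ _ _ _ HJ T ltac:(lra)) C) as U.
  rewrite (ladder_eq mu y0 phi T1 T HJ) in U by lra. lra.
Qed.

Definition dlaplace (mu : R -> R) (x : R) : R :=
  2 / x ^ 2 * laplace (fun t => hardyZ2 t * t) mu x
  + hardyZ2 (mu x) * exp (- (2 / x) * mu x) * Derive mu x.

Lemma ladder_bound_ex_derive (mu : R -> R) (y0 x : R) : ladder_bound mu y0 -> y0 < x ->
  ex_derive mu x.
Proof. intros Hmu Hx. exact (lb_smooth _ _ Hmu 1%nat x Hx). Qed.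

Lemma is_derive_laplace_hardy (mu : R -> R) (y0 x : R) : ladder_bound mu y0 -> y0 < x ->
  is_derive (laplace hardyZ2 mu) x (dlaplace mu x).
Proof.
  intros Hmu Hx. pose proof (lb_domain _ _ Hmu) as H0.
  apply is_derive_laplace; [apply hardyZ2_continuous | lra |].
  apply Derive_correct. now apply (ladder_bound_ex_derive mu y0).
Qed.

Lemma continuous_dlaplace (mu : R -> R) (y0 x : R) : ladder_bound mu y0 -> y0 < x ->
  continuous (dlaplace mu) x.
Proof.
  intros Hmu Hx. pose proof (lb_domain _ _ Hmu) as H0.
  pose proof (ladder_bound_ex_derive mu y0 x Hmu Hx) as Em.
  pose proof (ex_derive_continuous mu x Em) as Cm.
  assert (C1 : continuous (fun x => 2 / x ^ 2) x).
  { apply (ex_derive_continuous (fun x => 2 / x ^ 2)). auto_derive.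
    apply Rgt_not_eq. repeat apply Rmult_lt_0_compat; lra. }
  assert (C2 : continuous (laplace (fun t => hardyZ2 t * t) mu) x).
  { apply (ex_derive_continuous (laplace (fun t => hardyZ2 t * t) mu)). eexists.
    apply (is_derive_laplace (fun t => hardyZ2 t * t) mu x (Derive mu x)); [| lra | now apply Derive_correct].
    intros t. apply continuous_mul_id, hardyZ2_continuous. }
  assert (C3 : continuous (fun x => exp (- (2 / x) * mu x)) x).
  { apply (ex_derive_continuous (fun x => exp (- (2 / x) * mu x))). auto_derive. repeat split; [lra | exact Em]. }
  assert (C4 : continuous (Derive mu) x).
  { apply (ex_derive_continuous (Derive mu)). exact (lb_smooth _ _ Hmu 2%nat x Hx). }
  assert (C5 : continuous (fun x => hardyZ2 (mu x)) x).
  { apply (continuous_comp mu hardyZ2); [exact Cm | apply hardyZ2_continuous]. }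
  apply (continuous_plus (V := R_NormedModule) (fun x => 2 / x ^ 2 * laplace (fun t => hardyZ2 t * t) mu x)
    (fun x => hardyZ2 (mu x) * exp (- (2 / x) * mu x) * Derive mu x)).
  - exact (continuous_mult (K := R_AbsRing) (fun x => 2 / x ^ 2) _ x C1 C2).
  - apply (continuous_mult (K := R_AbsRing) (fun x => hardyZ2 (mu x) * exp (- (2 / x) * mu x))); [| exact C4].
    exact (continuous_mult (K := R_AbsRing) (fun x => hardyZ2 (mu x)) _ x C5 C3).
Qed.

Lemma is_derive_nonneg (f : R -> R) (x l d : R) : 0 < d -> is_derive f x l ->
  (forall y, x <= y < x + d -> f x <= f y) -> 0 <= l.
Proof.
  intros Hd Hf Hm. destruct (Rle_lt_dec 0 l) as [| N]; [assumption |]. exfalso.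
  apply is_derive_Reals in Hf. destruct (Hf (- l) ltac:(lra)) as [e He].
  pose proof (cond_pos e) as Pe.
  set (h := Rmin (e / 2) (d / 2)).
  assert (Hh : 0 < h) by (unfold h; apply Rmin_case; lra).
  pose proof (Rmin_l (e / 2) (d / 2) : h <= e / 2). pose proof (Rmin_r (e / 2) (d / 2) : h <= d / 2).
  specialize (He h ltac:(lra)). rewrite (Rabs_pos_eq h) in He by lra. specialize (He ltac:(lra)).
  apply Rabs_lt_between in He.
  assert (0 <= (f (x + h) - f x) / h).
  { apply Rdiv_le_0_compat; [| exact Hh]. specialize (Hm (x + h) ltac:(lra)). lra. }
  lra.
Qed.

(** The integral term is positive since [Z^2] is positive somewhere in []0, mu x[], and the boundary
    term is nonnegative since [mu] increases. The condition [1 < x] gives [ln x > 0], hence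
    [mu x > 0]. *)
Lemma dlaplace_pos (mu : R -> R) (y0 x : R) : ladder_bound mu y0 -> y0 < x -> 1 < x ->
  0 < dlaplace mu x.
Proof.
  intros Hmu Hx H1. pose proof (lb_domain _ _ Hmu) as H0.
  assert (Pm : 0 < mu x).
  { pose proof (lb_lower _ _ Hmu x Hx) as L. assert (0 < ln x) by (rewrite <- ln_1; apply ln_increasing; lra).
    assert (0 < 7 * x * ln x) by (repeat apply Rmult_lt_0_compat; lra). lra. }
  destruct (hardyZ2_pos_point 0 (mu x) Pm) as [c [Hc Pc]].
  assert (P1 : 0 < laplace (fun t => hardyZ2 t * t) mu x).
  { apply (laplace_pos (fun t => hardyZ2 t * t) mu x c); [| | exact Hc | nra].
    - intros t. apply continuous_mul_id, hardyZ2_continuous.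
    - intros t Ht. apply Rmult_le_pos; [apply hardyZ2_pos | exact Ht]. }
  assert (P2 : 0 < 2 / x ^ 2) by (apply Rdiv_lt_0_compat; [lra | apply pow_lt; lra]).
  assert (P3 : 0 <= Derive mu x).
  { apply (is_derive_nonneg mu x _ 1 Rlt_0_1).
    - apply Derive_correct. now apply (ladder_bound_ex_derive mu y0).
    - intros y Hy. apply (lb_increasing _ _ Hmu); lra. }
  unfold dlaplace.
  assert (0 < 2 / x ^ 2 * laplace (fun t => hardyZ2 t * t) mu x) by now apply Rmult_lt_0_compat.
  assert (0 <= hardyZ2 (mu x) * exp (- (2 / x) * mu x) * Derive mu x); [| lra].
  apply Rmult_le_pos; [| exact P3].
  apply Rmult_le_pos; [apply hardyZ2_pos | left; apply exp_pos].
Qed.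

Lemma laplace_strict (mu : R -> R) (y0 a b : R) : ladder_bound mu y0 -> y0 < a -> 1 < a -> a < b ->
  laplace hardyZ2 mu a < laplace hardyZ2 mu b.
Proof.
  intros Hmu H1 H2 Hab.
  destruct (MVT_gen (laplace hardyZ2 mu) a b (dlaplace mu)) as [c [Hc E]].
  - intros x. rewrite Rmin_left by lra. intros Hx. apply (is_derive_laplace_hardy mu y0); [exact Hmu | lra].
  - intros x. rewrite Rmin_left by lra. intros Hx.
    apply continuity_pt_filterlim, (ex_derive_continuous (laplace hardyZ2 mu)). eexists.
    apply (is_derive_laplace_hardy mu y0); [exact Hmu | lra].
  - rewrite Rmin_left in Hc by lra.
    assert (0 < dlaplace mu c) by (apply (dlaplace_pos mu y0); [exact Hmu | lra | lra]).
    assert (0 < dlaplace mu c * (b - a)) by (apply Rmult_lt_0_compat; lra). lra.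
Qed.

Lemma is_derive_slope (f : R -> R) (x l : R) :
  is_derive f x l <-> is_lim (fun y => (f y - f x) / (y - x)) x l.
Proof.
  split.
  - intros H. apply is_derive_Reals in H. apply is_lim_spec. intros eps.
    destruct (H eps (cond_pos eps)) as [d Hd]. exists d. intros y Hy Hne.
    unfold ball in Hy; simpl in Hy; unfold AbsRing_ball, abs, minus, plus, opp in Hy; simpl in Hy.
    specialize (Hd (y - x) ltac:(lra) Hy). rewrite Rplus_minus in Hd. exact Hd.
  - intros H. apply is_derive_Reals. intros eps He. apply is_lim_spec in H.
    destruct (H (mkposreal eps He)) as [d Hd]. exists d. intros h Hne Hh.
    specialize (Hd (x + h)). replace (x + h - x) with h in Hd by ring. apply Hd; [| lra].
    unfold ball; simpl; unfold AbsRing_ball, abs, minus, plus, opp; simpl.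
    replace (x + h + - x) with h by ring. exact Hh.
Qed.

Lemma is_lim_of_continuous (f : R -> R) (x : R) : continuous f x -> is_lim f x (f x).
Proof.
  intros H. apply (filterlim_filter_le_1 (F := locally x)); [apply filter_le_within | exact H].
Qed.

(** The slope of [f] is the slope of [g] divided by the slope of [F] taken along [f]. The slope
    function of [F] at [f x], completed there by [dF], is continuous, so it can be composed with
    [f]. *)
Lemma is_derive_implicit (F f g : R -> R) (x dF dg : R) :
  is_derive F (f x) dF -> dF <> 0 -> is_derive g x dg -> continuous f x ->
  locally x (fun y => F (f y) = g y) ->
  locally x (fun y => y <> x -> f y <> f x /\ F (f y) <> F (f x)) ->
  is_derive f x (dg / dF).
Proof.
  intros HF HdF Hg Hf Heq Hinj.
  set (s := fun y => match Req_EM_T y (f x) with left _ => dF | right _ => (F y - F (f x)) / (y - f x) end).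
  assert (Cs : continuous s (f x)).
  { apply is_derive_slope, is_lim_spec in HF. apply filterlim_locally. intros eps.
    assert (Sx : s (f x) = dF) by (unfold s; destruct (Req_EM_T (f x) (f x)); congruence).
    rewrite Sx. destruct (HF eps) as [d Hd]. exists d. intros y Hy. unfold s.
    destruct (Req_EM_T y (f x)) as [_ | N]; [apply ball_center |].
    exact (Hd y Hy N). }
  assert (Ls : is_lim (fun y => s (f y)) x dF).
  { assert (Sx : s (f x) = dF) by (unfold s; destruct (Req_EM_T (f x) (f x)); congruence).
    rewrite <- Sx. apply (is_lim_of_continuous (fun y => s (f y))).
    now apply (continuous_comp f s). }
  apply is_derive_slope.
  apply is_lim_ext_loc with (fun y => (g y - g x) / (y - x) / s (f y)).
  { pose proof (locally_singleton _ _ Heq) as Ex.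
    destruct (filter_and _ _ Heq Hinj) as [d Hd]. exists d. intros y Hy Hne.
    destruct (Hd y Hy) as [E1 I]. destruct (I Hne) as [N1 N2].
    rewrite <- E1, <- Ex. unfold s. destruct (Req_EM_T (f y) (f x)) as [| _]; [contradiction |].
    field. repeat split; lra. }
  apply is_derive_slope in Hg.
  replace (Finite (dg / dF)) with (Rbar_div dg dF) by reflexivity.
  apply is_lim_div; [exact Hg | exact Ls | | exact I].
  intros E. injection E. exact HdF.
Qed.

(** Beyond [T2] the ladder exceeds both [y0] and [1], the region where [F] is strictly increasing;
    there [phi] is the inverse of [F] composed with [meansq]. *)
Lemma ladder_regular (mu : R -> R) (y0 : R) (phi : R -> R) (T1 : R) :
  ladder_bound mu y0 -> jacobs_ladder mu y0 phi T1 ->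
  exists T2, T1 <= T2 /\
    (forall T, T2 <= T -> y0 < phi T /\ 1 < phi T) /\
    (forall T T', T2 <= T -> T < T' -> phi T < phi T') /\
    (forall T, T2 < T -> is_derive phi T (hardyZ2 T / dlaplace mu (phi T))).
Proof.
  intros Hmu HJ.
  destruct (ladder_to_infinity mu y0 phi T1 (Rmax y0 1) Hmu HJ) as [T2 [H12 H2]].
  exists T2.
  assert (RG : forall T, T2 <= T -> y0 < phi T /\ 1 < phi T).
  { intros T HT. specialize (H2 T HT). pose proof (Rmax_l y0 1). pose proof (Rmax_r y0 1). lra. }
  assert (EQ : forall T, T2 <= T -> laplace hardyZ2 mu (phi T) = meansq T).
  { intros T HT. apply (ladder_eq mu y0 phi T1); [exact HJ | lra]. }
  assert (ST : forall T T', T2 <= T -> T < T' -> phi T < phi T').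
  { intros T T' HT HTT. destruct (Rlt_le_dec (phi T) (phi T')) as [| C]; [assumption |]. exfalso.
    pose proof (meansq_strict T T' HTT) as M. rewrite <- !EQ in M by lra.
    destruct C as [C | C]; [| rewrite C in M; lra].
    destruct (RG T' ltac:(lra)) as [R1 R2].
    pose proof (laplace_strict mu y0 (phi T') (phi T) Hmu R1 R2 C). lra. }
  split; [exact H12 | split; [exact RG | split; [exact ST |]]].
  intros T HT. destruct (RG T ltac:(lra)) as [R1 R2].
  assert (Near : forall d, 0 < d -> locally T (fun y => T2 < y /\ Rabs (y - T) < d)).
  { intros d Hd. assert (P : 0 < Rmin d (T - T2)) by (apply Rmin_case; lra).
    exists (mkposreal _ P). intros y Hy.
    unfold ball in Hy; simpl in Hy; unfold AbsRing_ball, abs, minus, plus, opp in Hy; simpl in Hy.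
    change (Rabs (y - T) < Rmin d (T - T2)) in Hy.
    pose proof (Rmin_l d (T - T2)). pose proof (Rmin_r d (T - T2)).
    split; [apply Rabs_lt_between in Hy |]; lra. }
  (* For [y] near [T], [meansq y] lies strictly between the values of [F] at [phi T - e] and
     [phi T + e], which confines [phi y]. The bound on [e] keeps [phi T - e] in the region where [F]
     is strictly increasing. *)
  assert (CT : continuous phi T).
  { apply filterlim_locally. intros eps.
    set (e := Rmin (eps / 2) ((phi T - Rmax y0 1) / 2)).
    pose proof (H2 T ltac:(lra)) as H2'. pose proof (cond_pos eps) as Pe.
    assert (He : 0 < e) by (unfold e; apply Rmin_case; lra).
    assert (He1 : e <= eps / 2) by apply Rmin_l.
    assert (He2 : e <= (phi T - Rmax y0 1) / 2) by apply Rmin_r.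
    pose proof (Rmax_l y0 1). pose proof (Rmax_r y0 1).
    pose proof (laplace_strict mu y0 (phi T - e) (phi T) Hmu ltac:(lra) ltac:(lra) ltac:(lra)) as L1.
    pose proof (laplace_strict mu y0 (phi T) (phi T + e) Hmu ltac:(lra) ltac:(lra) ltac:(lra)) as L2.
    rewrite EQ in L1, L2 by lra.
    set (g := Rmin (meansq T - laplace hardyZ2 mu (phi T - e)) (laplace hardyZ2 mu (phi T + e) - meansq T)).
    assert (Hg : 0 < g) by (unfold g; apply Rmin_case; lra).
    assert (Cm : continuous meansq T).
    { apply (ex_derive_continuous meansq). eexists. apply is_derive_meansq. }
    pose proof (proj1 (filterlim_locally meansq (meansq T)) Cm (mkposreal _ Hg)) as Lm.
    generalize (filter_and _ _ Lm (Near 1 Rlt_0_1)). apply filter_imp. intros y [Hy [Hy2 _]].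
    unfold ball in Hy; simpl in Hy; unfold AbsRing_ball, abs, minus, plus, opp in Hy; simpl in Hy.
    apply Rabs_lt_between in Hy.
    assert (G1 : g <= meansq T - laplace hardyZ2 mu (phi T - e)) by apply Rmin_l.
    assert (G2 : g <= laplace hardyZ2 mu (phi T + e) - meansq T) by apply Rmin_r.
    destruct (RG y ltac:(lra)) as [Y1 Y2].
    pose proof (EQ y ltac:(lra)) as Ey.
    unfold ball; simpl; unfold AbsRing_ball, abs, minus, plus, opp; simpl.
    apply Rabs_lt_between.
    assert (phi T - e <= phi y).
    { destruct (Rle_lt_dec (phi T - e) (phi y)) as [| C]; [assumption |].
      pose proof (laplace_strict mu y0 (phi y) (phi T - e) Hmu Y1 Y2 C). lra. }
    assert (phi y <= phi T + e).
    { destruct (Rle_lt_dec (phi y) (phi T + e)) as [| C]; [assumption |].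
      pose proof (laplace_strict mu y0 (phi T + e) (phi y) Hmu ltac:(lra) ltac:(lra) C). lra. }
    lra. }
  apply (is_derive_implicit (laplace hardyZ2 mu) phi meansq).
  - now apply (is_derive_laplace_hardy mu y0).
  - apply Rgt_not_eq. now apply (dlaplace_pos mu y0).
  - apply is_derive_meansq.
  - exact CT.
  - generalize (Near 1 Rlt_0_1). apply filter_imp. intros y [Hy _]. apply EQ. lra.
  - generalize (Near 1 Rlt_0_1). apply filter_imp. intros y [Hy _] Hne.
    rewrite !EQ by lra.
    destruct (Rtotal_order y T) as [C | [C | C]]; [| contradiction |].
    + pose proof (ST y T ltac:(lra) C). pose proof (meansq_strict y T C). lra.
    + pose proof (ST T y ltac:(lra) C). pose proof (meansq_strict T y C). lra.
Qed.

(** * Growth of the truncated Laplace integral and of the ladder *)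

Lemma tangent_xlnx (X t : R) : 0 < X -> 0 < t -> t * ln X + t - X <= t * ln t.
Proof.
  intros HX Ht. pose proof (exp_ineq1_le (ln X - ln t)) as E.
  unfold Rminus in E. rewrite exp_plus, exp_Ropp, !exp_ln in E by lra.
  assert (t * (1 + (ln X + - ln t)) <= t * (X * / t)) by (apply Rmult_le_compat_l; lra).
  replace (t * (X * / t)) with X in H by (field; lra). lra.
Qed.

Lemma ln_le_sqrt (x : R) : 0 < x -> ln x <= 2 * sqrt x.
Proof.
  intros Hx. assert (Hs : 0 < sqrt x) by now apply sqrt_lt_R0.
  rewrite <- (sqrt_sqrt x) at 1 by lra. rewrite ln_mult by assumption.
  pose proof (exp_ineq1_le (ln (sqrt x))) as E. rewrite exp_ln in E by assumption. lra.
Qed.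

Lemma meansq_nonneg (t : R) : 0 <= t -> 0 <= meansq t.
Proof.
  intros Ht. replace 0 with (meansq 0); [now apply meansq_mono |].
  unfold meansq. rewrite RInt_point. reflexivity.
Qed.

(** With [X = x / 2] this says that the exponent [2 / x * mu x] is at least [ln X], so the kernel at
    the upper limit is at most [1 / X]. *)
Lemma ladder_bound_ge (mu : R -> R) (y0 x : R) : ladder_bound mu y0 -> y0 < x -> 2 <= x ->
  x / 2 * ln (x / 2) <= mu x.
Proof.
  intros Hmu Hx H2. pose proof (lb_lower _ _ Hmu x Hx) as L.
  assert (L1 : ln (x / 2) <= ln x) by (apply ln_le; lra).
  assert (L2 : 0 <= ln (x / 2)) by (apply ln_nonneg; lra).
  assert (x / 2 * ln (x / 2) <= x * ln x) by (apply Rmult_le_compat; lra).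
  assert (0 <= x * ln x) by (apply Rmult_le_pos; lra). lra.
Qed.

(** The comparison integral: [p + 2 q t / X] is the density of [p t + q t^2 / X], the shape of the
    majorant and, for [q = 0], of the minorant of [meansq] below. *)
Lemma is_RInt_affine_exp (p q X m : R) : 0 < X ->
  is_RInt (fun t => (p + 2 * q * t / X) * exp (- (/ X) * t)) 0 m
    (X * p + 2 * q * X - (X * p + 2 * q * (m + X)) * exp (- (/ X) * m)).
Proof.
  intros HX.
  replace (X * p + 2 * q * X - (X * p + 2 * q * (m + X)) * exp (- (/ X) * m)) with
    (minus (- (X * p + 2 * q * (m + X)) * exp (- (/ X) * m))
           (- (X * p + 2 * q * (0 + X)) * exp (- (/ X) * 0))).
  2:{ rewrite Rmult_0_r, exp_0. unfold minus, plus, opp; simpl. ring. }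
  apply (is_RInt_derive (V := R_CompleteNormedModule)
    (fun t => - (X * p + 2 * q * (t + X)) * exp (- (/ X) * t))
    (fun t => (p + 2 * q * t / X) * exp (- (/ X) * t))).
  - intros t _. auto_derive; [trivial |]. field. lra.
  - intros t _. apply (ex_derive_continuous (fun t => (p + 2 * q * t / X) * exp (- (/ X) * t))).
    auto_derive. trivial.
Qed.

Lemma laplace_minus_affine (mu : R -> R) (p q x : R) : 0 < x ->
  RInt (fun t => (hardyZ2 t - (p + 2 * q * t / (x / 2))) * exp (- (2 / x) * t)) 0 (mu x) =
  laplace hardyZ2 mu x
  - (x / 2 * p + 2 * q * (x / 2)
     - (x / 2 * p + 2 * q * (mu x + x / 2)) * exp (- (2 / x) * mu x)).
Proof.
  intros Hx. apply is_RInt_unique.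
  pose proof (is_RInt_affine_exp p q (x / 2) (mu x) ltac:(lra)) as I.
  replace (/ (x / 2)) with (2 / x) in I by (field; lra).
  apply is_RInt_ext with (fun t => minus (hardyZ2 t * exp (- (2 / x) * t))
    ((p + 2 * q * t / (x / 2)) * exp (- (2 / x) * t))).
  - intros t _. eqR. unfold minus, plus, opp; simpl. ring.
  - apply (is_RInt_minus (V := R_NormedModule) (fun t => hardyZ2 t * exp (- (2 / x) * t))); [| exact I].
    apply (RInt_correct (V := R_CompleteNormedModule) (fun t => hardyZ2 t * exp (- (2 / x) * t))).
    apply ex_RInt_of_continuous. intros t. apply continuous_mul_exp, hardyZ2_continuous.
Qed.

(** For all [t >= 0], [meansq t] is at most [meansq T0 + (1 + e) (t ln X + t^2 / X)]. A quadratic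
    majorant is taken because [t ln t], being convex, lies above its tangents. Its transform is at
    most [X p + 2 q X], and the constant yields [K]. *)
Lemma laplace_upper (e : R) : 0 < e -> exists K, forall mu y0 x,
  ladder_bound mu y0 -> y0 < x -> 2 <= x ->
  laplace hardyZ2 mu x <= K + (1 + e) * (x / 2 * ln (x / 2) + 2 * (x / 2)).
Proof.
  intros He. destruct (meansq_asymptotic e He) as [T0 [HT0 HA]].
  exists (meansq T0). intros mu y0 x Hmu Hx H2.
  set (X := x / 2). assert (HX : 1 <= X) by (unfold X; lra).
  pose proof (ladder_bound_ge mu y0 x Hmu Hx H2) as Hm. fold X in Hm.
  assert (L0 : 0 <= ln X) by now apply ln_nonneg.
  assert (Hm0 : 0 <= mu x) by (assert (0 <= X * ln X) by (apply Rmult_le_pos; lra); lra).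
  set (p := (1 + e) * ln X). set (q := 1 + e).
  assert (Hp : 0 <= p) by (apply Rmult_le_pos; lra).
  pose proof (laplace_comparison (fun t => meansq T0 + p * t + q * t ^ 2 / X - meansq t)
    (fun t => - (hardyZ2 t - (p + 2 * q * t / X))) (2 / x) (mu x) Hm0) as C.
  assert (E : RInt (fun t => - (hardyZ2 t - (p + 2 * q * t / X)) * exp (- (2 / x) * t)) 0 (mu x) =
    - RInt (fun t => (hardyZ2 t - (p + 2 * q * t / (x / 2))) * exp (- (2 / x) * t)) 0 (mu x)).
  { rewrite <- (RInt_opp (V := R_CompleteNormedModule)).
    - apply RInt_ext. intros t _. eqR. unfold opp, X; simpl. ring.
    - apply ex_RInt_of_continuous. intros t. apply continuous_mul_exp.
      apply (continuous_minus (V := R_NormedModule) hardyZ2 (fun t => p + 2 * q * t / (x / 2))); [apply hardyZ2_continuous |].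
      apply (ex_derive_continuous (fun t => p + 2 * q * t / (x / 2))). auto_derive. trivial. }
  cbv beta in C. rewrite E, laplace_minus_affine in C by lra. fold X in C.
  assert (M0 : meansq 0 = 0) by (unfold meansq; rewrite RInt_point; reflexivity).
  assert (Pq : 0 <= (X * p + 2 * q * (mu x + X)) * exp (- (2 / x) * mu x)).
  { apply Rmult_le_pos; [| left; apply exp_pos]. unfold q.
    assert (0 <= X * p) by (apply Rmult_le_pos; lra).
    assert (0 <= 2 * (1 + e) * (mu x + X)) by (apply Rmult_le_pos; lra). lra. }
  assert (G : - (meansq T0 + p * 0 + q * 0 ^ 2 / X - meansq 0) <=
    - (laplace hardyZ2 mu x - (X * p + 2 * q * X - (X * p + 2 * q * (mu x + X)) * exp (- (2 / x) * mu x)))).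
  { apply C.
    - left. apply Rdiv_lt_0_compat; lra.
    - intros t.
      apply (is_derive_ext (fun t => minus (meansq T0 + p * t + q * t ^ 2 / X) (meansq t))); [reflexivity |].
      evar_last.
      + apply (is_derive_minus (V := R_NormedModule) (fun t => meansq T0 + p * t + q * t ^ 2 / X) meansq t (p + 2 * q * t / X)).
        * auto_derive; [trivial |]. field. lra.
        * apply is_derive_meansq.
      + unfold minus, plus, opp; simpl. ring.
    - intros t. apply (continuous_opp (V := R_NormedModule) (fun t => hardyZ2 t - (p + 2 * q * t / X))).
      apply (continuous_minus (V := R_NormedModule) hardyZ2 (fun t => p + 2 * q * t / X)); [apply hardyZ2_continuous |].
      apply (ex_derive_continuous (fun t => p + 2 * q * t / X)). auto_derive. trivial.
    - intros t Ht.
      assert (N : 0 <= q * t ^ 2 / X).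
      { apply Rdiv_le_0_compat; [| lra]. apply Rmult_le_pos; [unfold q; lra | apply pow2_ge_0]. }
      assert (N2 : 0 <= p * t) by (apply Rmult_le_pos; lra).
      destruct (Rle_lt_dec T0 t) as [B | B].
      + specialize (HA t B). apply Rabs_le_between in HA.
        pose proof (meansq_nonneg T0 ltac:(lra)).
        (* The tangent inequality with [X] and [t] exchanged, multiplied by [t / X]. *)
        assert (TL : t * ln t <= t * ln X + t ^ 2 / X).
        { pose proof (tangent_xlnx t X ltac:(lra) ltac:(lra)) as T1.
          apply Rmult_le_reg_r with (X * / t); [apply Rmult_lt_0_compat; [lra | apply Rinv_0_lt_compat; lra] |].
          replace (t * ln t * (X * / t)) with (X * ln t) by (field; lra).
          replace ((t * ln X + t ^ 2 / X) * (X * / t)) with (X * ln X + t) by (field; lra). lra. }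
        assert (meansq t <= (1 + e) * (t * ln X + t ^ 2 / X)).
        { apply Rle_trans with ((1 + e) * (t * ln t)); [lra |]. apply Rmult_le_compat_l; lra. }
        assert (Q : (1 + e) * (t * ln X + t ^ 2 / X) = p * t + q * t ^ 2 / X) by (unfold p, q; field; lra).
        lra.
      + pose proof (meansq_mono t T0 ltac:(lra)). lra. }
  rewrite M0 in G.
  assert (Q : X * p + 2 * q * X = q * (X * ln X + 2 * X)) by (unfold p, q; ring).
  assert (Q0 : q * 0 ^ 2 / X = 0) by (field; lra).
  rewrite Q0 in G. lra.
Qed.

(** The minorant is [1 - e] times the tangent of [t ln t] at [X]. Its value [- X] at [0] cancels the
    [X] gained from the slope [ln X + 1], and truncation at [mu x] costs at most the slope. *)
Lemma laplace_lower (e : R) : 0 < e < 1 -> exists X0, 1 <= X0 /\ forall mu y0 x,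
  ladder_bound mu y0 -> y0 < x -> X0 <= x / 2 ->
  (1 - e) * (x / 2 * ln (x / 2) - ln (x / 2) - 1) <= laplace hardyZ2 mu x.
Proof.
  intros He. destruct (meansq_asymptotic e ltac:(lra)) as [T0 [HT0 HA]].
  exists ((3 * T0) ^ 2).
  assert (P1 : 1 <= (3 * T0) ^ 2) by (apply pow_R1_Rle; lra).
  split; [exact P1 |]. intros mu y0 x Hmu Hx HX0.
  set (X := x / 2) in *. assert (HX : 1 <= X) by lra.
  assert (H2 : 2 <= x) by (unfold X in HX; lra).
  pose proof (ladder_bound_ge mu y0 x Hmu Hx H2) as Hm. fold X in Hm.
  assert (L0 : 0 <= ln X) by now apply ln_nonneg.
  assert (Hm0 : 0 <= mu x) by (assert (0 <= X * ln X) by (apply Rmult_le_pos; lra); lra).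
  assert (SX : T0 * (ln X + 1) <= X).
  { assert (S3 : 3 * T0 <= sqrt X).
    { rewrite <- (sqrt_pow2 (3 * T0)) by lra. now apply sqrt_le_1_alt. }
    pose proof (ln_le_sqrt X ltac:(lra)) as LS.
    apply Rle_trans with (T0 * (3 * sqrt X)); [apply Rmult_le_compat_l; lra |].
    rewrite <- (sqrt_sqrt X) at 2 by lra.
    replace (T0 * (3 * sqrt X)) with ((3 * T0) * sqrt X) by ring.
    apply Rmult_le_compat_r; lra. }
  set (p := (1 - e) * (ln X + 1)).
  pose proof (laplace_comparison (fun t => meansq t - (1 - e) * (t * ln X + t - X))
    (fun t => hardyZ2 t - (p + 2 * 0 * t / (x / 2))) (2 / x) (mu x) Hm0) as C.
  cbv beta in C. rewrite laplace_minus_affine in C by lra. fold X in C.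
  assert (M0 : meansq 0 = 0) by (unfold meansq; rewrite RInt_point; reflexivity).
  assert (G : - (meansq 0 - (1 - e) * (0 * ln X + 0 - X)) <=
    laplace hardyZ2 mu x - (X * p + 2 * 0 * X - (X * p + 2 * 0 * (mu x + X)) * exp (- (2 / x) * mu x))).
  { apply C.
    - left. apply Rdiv_lt_0_compat; lra.
    - intros t.
      apply (is_derive_ext (fun t => minus (meansq t) ((1 - e) * (t * ln X + t - X)))); [reflexivity |].
      evar_last.
      + apply (is_derive_minus (V := R_NormedModule) meansq (fun t => (1 - e) * (t * ln X + t - X)) t (hardyZ2 t) p).
        * apply is_derive_meansq.
        * auto_derive; [trivial |]. unfold p. ring.
      + unfold minus, plus, opp; simpl. field. lra.
    - intros t.
      apply (continuous_minus (V := R_NormedModule) hardyZ2 (fun t => p + 2 * 0 * t / X)); [apply hardyZ2_continuous |].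
      apply (ex_derive_continuous (fun t => p + 2 * 0 * t / X)). auto_derive. trivial.
    - intros t Ht. destruct (Rle_lt_dec T0 t) as [B | B].
      + specialize (HA t B). apply Rabs_le_between in HA.
        pose proof (tangent_xlnx X t ltac:(lra) ltac:(lra)) as TL.
        assert ((1 - e) * (t * ln X + t - X) <= (1 - e) * (t * ln t)) by (apply Rmult_le_compat_l; lra).
        lra.
      + pose proof (meansq_nonneg t ltac:(lra)).
        assert (t * (ln X + 1) <= T0 * (ln X + 1)) by (apply Rmult_le_compat_r; lra).
        assert (0 <= (1 - e) * (X - t * (ln X + 1))) by (apply Rmult_le_pos; lra). lra. }
  rewrite M0 in G.
  assert (EX : exp (- (2 / x) * mu x) <= / X).
  { rewrite <- (exp_ln (/ X)) by (apply Rinv_0_lt_compat; lra). rewrite ln_Rinv by lra. apply exp_monotone.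
    apply Rmult_le_reg_l with X; [lra |].
    replace (X * (- (2 / x) * mu x)) with (- mu x) by (unfold X; field; lra). lra. }
  assert (Q : X * p * exp (- (2 / x) * mu x) <= p).
  { apply Rle_trans with (X * p * / X); [| right; field; lra].
    apply Rmult_le_compat_l; [| exact EX].
    apply Rmult_le_pos; [lra |]. unfold p. apply Rmult_le_pos; lra. }
  unfold p in *. lra.
Qed.

Lemma laplace_asymptotic (e : R) : 0 < e < 1 -> exists X0, 1 < X0 /\ forall mu y0 x,
  ladder_bound mu y0 -> y0 < x -> X0 <= x / 2 ->
  Rabs (laplace hardyZ2 mu x - x / 2 * ln (x / 2)) <= e * (x / 2 * ln (x / 2)).
Proof.
  intros He.
  destruct (laplace_upper (e / 2) ltac:(lra)) as [K HK].
  destruct (laplace_lower (e / 2) ltac:(lra)) as [X1 [HX1 HL]].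
  destruct (ln_eventually_ge ((Rabs K + 4) * (2 / e))) as [X2 [HX2 HG]].
  exists (Rmax X1 X2). split; [eapply Rlt_le_trans; [exact HX2 | apply Rmax_r] |].
  intros mu y0 x Hmu Hx HX. pose proof (Rmax_l X1 X2). pose proof (Rmax_r X1 X2).
  specialize (HK mu y0 x Hmu Hx ltac:(lra)). specialize (HL mu y0 x Hmu Hx ltac:(lra)).
  specialize (HG (x / 2) ltac:(lra)).
  set (X := x / 2) in *. set (L := ln X) in *.
  assert (P : 0 < 2 / e) by (apply Rdiv_lt_0_compat; lra).
  pose proof (Rabs_pos K) as PK. pose proof (Rle_abs K) as PK2.
  assert (G1 : Rabs K + 4 <= e / 2 * L).
  { apply Rmult_le_reg_r with (2 / e); [exact P |].
    replace (e / 2 * L * (2 / e)) with L by (field; lra). exact HG. }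
  assert (G2 : X * (Rabs K + 4) <= X * (e / 2 * L)) by (apply Rmult_le_compat_l; lra).
  assert (G3 : 1 * Rabs K <= X * Rabs K) by (apply Rmult_le_compat_r; lra).
  assert (PL : 0 < L) by (assert (0 < e / 2 * L) by lra; nra).
  assert (LX : L <= 2 * X).
  { pose proof (exp_ineq1_le L) as E. unfold L in E at 2. rewrite exp_ln in E by lra. lra. }
  assert (XL : 0 < X * L) by (apply Rmult_lt_0_compat; lra).
  apply Rabs_le_between. split; nra.
Qed.

(** With [X = phi T / 2], the equation makes [X ln X] and [T ln T] agree up to factors [1 - d/4] and
    [1 + d/4] on the two sides. If [X] differed from [T] by more than [d T], monotonicity of [ln]
    would separate them by a factor [1 - d] or [1 + d], which is too much. *)
Lemma ladder_asymptotic (mu : R -> R) (y0 : R) (phi : R -> R) (T1 d : R) :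
  ladder_bound mu y0 -> jacobs_ladder mu y0 phi T1 -> 0 < d < 1 ->
  exists T0, T1 <= T0 /\ forall T, T0 <= T -> Rabs (phi T / 2 - T) <= d * T.
Proof.
  intros Hmu HJ Hd. set (e := d / 4).
  destruct (laplace_asymptotic e) as [X0 [HX0 HX]]; [unfold e; lra |].
  destruct (meansq_asymptotic e) as [T2 [HT2 HM]]; [unfold e; lra |].
  destruct (ladder_to_infinity mu y0 phi T1 (2 * X0) Hmu HJ) as [T3 [H13 H3]].
  exists (Rmax T3 T2). split; [eapply Rle_trans; [exact H13 | apply Rmax_l] |].
  intros T HT. pose proof (Rmax_l T3 T2). pose proof (Rmax_r T3 T2).
  specialize (H3 T ltac:(lra)). specialize (HM T ltac:(lra)).
  specialize (HX mu y0 (phi T) Hmu (jl_range _ _ _ _ HJ T ltac:(lra)) ltac:(lra)).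
  rewrite (ladder_eq mu y0 phi T1 T HJ) in HX by lra.
  set (X := phi T / 2) in *. assert (PX : 1 < X) by (unfold X; lra).
  apply Rabs_le_between in HM, HX.
  assert (LT : 0 < ln T) by (rewrite <- ln_1; apply ln_increasing; lra).
  assert (LX : 0 < ln X) by (rewrite <- ln_1; apply ln_increasing; lra).
  assert (PT : 0 < T * ln T) by (apply Rmult_lt_0_compat; lra).
  assert (PXL : 0 < X * ln X) by (apply Rmult_lt_0_compat; lra).
  apply Rabs_le_between. split.
  - destruct (Rle_lt_dec (- (d * T)) (X - T)) as [| C]; [assumption |]. exfalso.
    assert (B1 : X <= (1 - d) * T) by lra.
    assert (B2 : ln X <= ln T) by (apply ln_le; [lra |]; nra).
    assert (B3 : X * ln X <= (1 - d) * T * ln T) by (apply Rmult_le_compat; lra).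
    assert (B4 : (1 + e) * (X * ln X) <= (1 + e) * ((1 - d) * T * ln T)).
    { apply Rmult_le_compat_l; [unfold e |]; lra. }
    assert (B5 : (1 - e) * (T * ln T) <= (1 + e) * (1 - d) * (T * ln T)) by lra.
    apply Rmult_le_reg_r in B5; [| exact PT]. unfold e in B5. nra.
  - destruct (Rle_lt_dec (X - T) (d * T)) as [| C]; [assumption |]. exfalso.
    assert (B1 : (1 + d) * T <= X) by lra.
    assert (B2 : ln T <= ln X) by (apply ln_le; [lra |]; nra).
    assert (B3 : (1 + d) * T * ln T <= X * ln X) by (apply Rmult_le_compat; nra).
    assert (B4 : (1 - e) * ((1 + d) * T * ln T) <= (1 - e) * (X * ln X)).
    { apply Rmult_le_compat_l; [unfold e |]; lra. }
    assert (B5 : (1 - e) * (1 + d) * (T * ln T) <= (1 + e) * (T * ln T)) by lra.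
    apply Rmult_le_reg_r in B5; [| exact PT]. unfold e in B5. nra.
Qed.

(** * Bessel functions *)

Definition gauss_seq (x : R) (n : nat) : R :=
  INR (fact n) * Rpower (INR n) x / prod_f_R0 (fun k => x + INR k) n.

Lemma gauss_prod_pos (x : R) (n : nat) : 0 < x -> 0 < prod_f_R0 (fun k => x + INR k) n.
Proof.
  intros Hx. induction n as [| n IH]; cbn -[INR].
  - rewrite Rplus_0_r. exact Hx.
  - apply Rmult_lt_0_compat; [exact IH |]. pose proof (pos_INR (S n)). lra.
Qed.

(** Reduces to [((y+1)/y)^x >= 1 + x / (y+1)]. Monotonicity gives [Lim_seq] a genuine limit, finite
    or infinite, so that the limit of a product may be taken in [Gamma_succ]. *)
Lemma gauss_seq_incr (x : R) (n : nat) : 0 < x -> gauss_seq x (S n) <= gauss_seq x (S (S n)).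
Proof.
  intros Hx. pose proof (gauss_prod_pos x (S n) Hx) as P.
  unfold gauss_seq. set (m := S n) in *. cbn [prod_f_R0].
  assert (Hm : 0 < INR m) by (apply lt_0_INR; unfold m; lia).
  rewrite fact_simpl, mult_INR, S_INR. set (y := INR m) in *.
  assert (R : Rpower y x * (x + (y + 1)) <= (y + 1) * Rpower (y + 1) x).
  { replace (Rpower (y + 1) x) with (Rpower y x * exp (x * (ln (y + 1) - ln y)))
      by (unfold Rpower; rewrite <- exp_plus; f_equal; ring).
    assert (0 < Rpower y x) by apply exp_pos.
    replace ((y + 1) * (Rpower y x * exp (x * (ln (y + 1) - ln y)))) with
      (Rpower y x * ((y + 1) * exp (x * (ln (y + 1) - ln y)))) by ring.
    apply Rmult_le_compat_l; [lra |].
    pose proof (exp_ineq1_le (x * (ln (y + 1) - ln y))) as E.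
    pose proof (ln_diff_ge y (y + 1) Hm ltac:(lra)) as D.
    assert (D' : x * ((y + 1 - y) / (y + 1)) <= x * (ln (y + 1) - ln y)) by (apply Rmult_le_compat_l; lra).
    replace (x + (y + 1)) with ((y + 1) * (1 + x * ((y + 1 - y) / (y + 1)))) by (field; lra).
    apply Rmult_le_compat_l; lra. }
  set (f := INR (fact m)) in *. assert (Pf : 0 < f) by apply INR_fact_lt_0.
  set (p := prod_f_R0 (fun k => x + INR k) m) in *.
  apply Rle_div_l; [exact P |].
  replace ((y + 1) * f * Rpower (y + 1) x / (p * (x + (y + 1))) * p) with
    (f * ((y + 1) * Rpower (y + 1) x / (x + (y + 1)))) by (field; lra).
  apply Rmult_le_compat_l; [lra |]. apply Rle_div_r; [lra | exact R].
Qed.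

(* Where the limit is infinite, both values of [Gamma] are the junk value [0]. *)
Lemma Gamma_succ (x : R) : 0 < x -> Gamma (x + 1) = x * Gamma x.
Proof.
  intros Hx.
  assert (E : ex_lim_seq (gauss_seq x)).
  { apply ex_lim_seq_incr_1, ex_lim_seq_incr. intros n. now apply gauss_seq_incr. }
  assert (V : is_lim_seq (fun n => x * (INR n / (x + 1 + INR n))) x).
  { replace (Finite x) with (Rbar_mult x 1) by (simpl; f_equal; ring).
    apply (is_lim_seq_scal_l _ x 1).
    apply is_lim_seq_ext with (fun n => 1 - (x + 1) * / (INR n + (x + 1))).
    { intros n. pose proof (pos_INR n). field. lra. }
    replace (Finite 1) with (Finite (1 - (x + 1) * 0)) by (f_equal; ring).
    apply is_lim_seq_minus'; [apply is_lim_seq_const |].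
    apply (is_lim_seq_scal_l _ (x + 1) 0).
    replace (Finite 0) with (Rbar_inv p_infty) by reflexivity.
    apply is_lim_seq_inv; [| discriminate].
    apply is_lim_seq_plus with p_infty (x + 1);
      [apply is_lim_seq_INR | apply is_lim_seq_const | reflexivity]. }
  assert (U : forall n, (1 <= n)%nat ->
    gauss_seq (x + 1) n = gauss_seq x n * (x * (INR n / (x + 1 + INR n)))).
  { intros n Hn. assert (Hy : 0 < INR n) by now apply lt_0_INR.
    assert (P : x * prod_f_R0 (fun k => x + 1 + INR k) n =
      prod_f_R0 (fun k => x + INR k) n * (x + 1 + INR n)).
    { clear. induction n as [| n IH]; cbn -[INR].
      - simpl. ring.
      - rewrite <- Rmult_assoc, IH, S_INR. ring. }
    pose proof (gauss_prod_pos x n Hx) as P1. pose proof (gauss_prod_pos (x + 1) n ltac:(lra)) as P2.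
    unfold gauss_seq. rewrite Rpower_plus, Rpower_1 by exact Hy.
    replace (prod_f_R0 (fun k => x + INR k) n) with
      (x * prod_f_R0 (fun k => x + 1 + INR k) n / (x + 1 + INR n)) by (rewrite P; field; lra).
    field. repeat split; lra. }
  change (Gamma (x + 1)) with (real (Lim_seq (gauss_seq (x + 1)))).
  change (Gamma x) with (real (Lim_seq (gauss_seq x))).
  rewrite (Lim_seq_ext_loc (gauss_seq (x + 1)) (fun n => gauss_seq x n * (x * (INR n / (x + 1 + INR n)))))
    by (exists 1%nat; exact U).
  rewrite Lim_seq_mult; [| exact E | eexists; exact V |].
  - rewrite (is_lim_seq_unique _ _ V).
    destruct (Lim_seq (gauss_seq x)) as [l | |]; simpl.
    + ring.
    + destruct (Rle_dec 0 x) as [h | h]; [destruct (Rle_lt_or_eq_dec 0 x h) |]; simpl; ring.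
    + destruct (Rle_dec 0 x) as [h | h]; [destruct (Rle_lt_or_eq_dec 0 x h) |]; simpl; ring.
  - rewrite (is_lim_seq_unique _ _ V).
    destruct (Lim_seq (gauss_seq x)) as [l | |]; simpl; try exact I; lra.
Qed.

Definition bcoef (nu : R) (r : nat) : R := (-1) ^ r / (INR (fact r) * Gamma (nu + INR r + 1)).

(** The recurrence behind Bessel's equation, obtained from the functional equation of [Gamma];
    inverses distribute over products under the convention [/ 0 = 0]. *)
Lemma bcoef_S (nu : R) (r : nat) : -1 < nu ->
  INR (S r) * ((nu + INR (S r)) * bcoef nu (S r)) = - bcoef nu r.
Proof.
  intros Hnu. unfold bcoef. rewrite fact_simpl, mult_INR.
  assert (P : 0 < nu + INR r + 1) by (pose proof (pos_INR r); lra).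
  assert (Pr : 0 < INR (S r)) by (apply lt_0_INR; lia).
  replace (nu + INR (S r) + 1) with ((nu + INR r + 1) + 1) by (rewrite S_INR; ring).
  rewrite Gamma_succ by exact P. unfold Rdiv. rewrite !Rinv_mult.
  replace (nu + INR (S r)) with (nu + INR r + 1) by (rewrite S_INR; ring).
  cbn [pow].
  replace (INR (S r) * ((nu + INR r + 1) * (-1 * (-1) ^ r *
     (/ INR (S r) * / INR (fact r) * (/ (nu + INR r + 1) * / Gamma (nu + INR r + 1))))))
   with ((INR (S r) * / INR (S r)) * ((nu + INR r + 1) * / (nu + INR r + 1)) *
     - ((-1) ^ r * (/ INR (fact r) * / Gamma (nu + INR r + 1)))) by ring.
  rewrite !Rinv_r by lra. ring.
Qed.

(** Differentiating the entire factor raises the order by one and changes the sign; this is how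
    [J_(nu+1)] enters the norm. *)
Lemma bcoef_derive (nu : R) (r : nat) : PS_derive (bcoef nu) r = - bcoef (nu + 1) r.
Proof.
  unfold PS_derive, bcoef. rewrite fact_simpl, mult_INR.
  assert (Pr : 0 < INR (S r)) by (apply lt_0_INR; lia).
  replace (nu + INR (S r) + 1) with (nu + 1 + INR r + 1) by (rewrite S_INR; ring).
  unfold Rdiv. rewrite !Rinv_mult. cbn [pow].
  replace (INR (S r) * (-1 * (-1) ^ r * (/ INR (S r) * / INR (fact r) * / Gamma (nu + 1 + INR r + 1))))
    with ((INR (S r) * / INR (S r)) * - ((-1) ^ r * (/ INR (fact r) * / Gamma (nu + 1 + INR r + 1)))) by ring.
  rewrite Rinv_r by lra. ring.
Qed.

Lemma CV_radius_bcoef (nu : R) : -1 < nu -> CV_radius (bcoef nu) = p_infty.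
Proof.
  intros Hnu.
  assert (Pr : forall r, 0 < INR (S r)) by (intros r; apply lt_0_INR; lia).
  assert (Pn : forall r, 0 < nu + INR (S r)) by (intros r; rewrite S_INR; pose proof (pos_INR r); lra).
  assert (Q : forall r, bcoef nu (S r) = - bcoef nu r / (INR (S r) * (nu + INR (S r)))).
  { intros r. rewrite <- (bcoef_S nu r Hnu). specialize (Pr r). specialize (Pn r). field. lra. }
  (* The ratio test asks for nonzero coefficients; by the recurrence they all vanish or none
     does. *)
  destruct (Req_dec (bcoef nu 0) 0) as [Z | Z].
  - rewrite (CV_radius_ext (bcoef nu) (fun _ => 0)); [apply CV_radius_const_0 |].
    induction n as [| n IH]; [exact Z |]. rewrite Q, IH. unfold Rdiv. ring.
  - assert (NZ : forall n, bcoef nu n <> 0).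
    { induction n as [| n IH]; [exact Z |]. rewrite Q. specialize (Pr n). specialize (Pn n).
      apply Rmult_integral_contrapositive_currified; [lra |]. apply Rinv_neq_0_compat. nra. }
    apply CV_radius_infinite_DAlembert; [exact NZ |].
    apply is_lim_seq_le_le with (fun _ => 0) (fun n => / (nu + 1) * / INR (S n)).
    + intros n. split; [apply Rabs_pos |]. rewrite Q.
      specialize (Pr n). pose proof (Pn n) as Pn'. specialize (NZ n).
      replace (- bcoef nu n / (INR (S n) * (nu + INR (S n))) / bcoef nu n) with
        (- (/ (nu + INR (S n)) * / INR (S n))) by (field; lra).
      rewrite Rabs_Ropp, Rabs_pos_eq.
      * apply Rmult_le_compat_r; [left; now apply Rinv_0_lt_compat |].
        apply Rinv_le_contravar; [lra |]. rewrite S_INR. pose proof (pos_INR n). lra.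
      * left. apply Rmult_lt_0_compat; now apply Rinv_0_lt_compat.
    + apply is_lim_seq_const.
    + replace (Finite 0) with (Rbar_mult (/ (nu + 1)) 0) by (simpl; f_equal; ring).
      apply is_lim_seq_scal_l. apply (is_lim_seq_incr_1 (fun n => / INR n)).
      replace (Finite 0) with (Rbar_inv p_infty) by reflexivity.
      apply is_lim_seq_inv; [apply is_lim_seq_INR | discriminate].
Qed.

(* [J_nu x = (x/2)^nu bessel0 nu (x^2/4)], with [bessel0 nu] entire. *)
Definition bessel0 (nu y : R) : R := PSeries (bcoef nu) y.
Definition bessel1 (nu y : R) : R := PSeries (PS_derive (bcoef nu)) y.
Definition bessel2 (nu y : R) : R := PSeries (PS_derive (PS_derive (bcoef nu))) y.

Lemma is_derive_bessel0 (nu y : R) : -1 < nu -> is_derive (bessel0 nu) y (bessel1 nu y).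
Proof. intros H. apply is_derive_PSeries. rewrite CV_radius_bcoef by exact H. exact I. Qed.

Lemma is_derive_bessel1 (nu y : R) : -1 < nu -> is_derive (bessel1 nu) y (bessel2 nu y).
Proof.
  intros H. apply is_derive_PSeries. rewrite CV_radius_derive, CV_radius_bcoef by exact H. exact I.
Qed.

(** Bessel's equation for the entire factor [E] in the variable [y = x^2 / 4]:
    [y E'' + (nu + 1) E' + E = 0], checked coefficient by coefficient. *)
Lemma bessel_ode (nu y : R) : -1 < nu ->
  y * bessel2 nu y = - (nu + 1) * bessel1 nu y - bessel0 nu y.
Proof.
  intros H. unfold bessel0, bessel1, bessel2.
  rewrite <- PSeries_incr_1, <- PSeries_scal.
  apply Rplus_eq_reg_r with (PSeries (bcoef nu) y). unfold Rminus.
  rewrite Rplus_assoc, Rplus_opp_l, Rplus_0_r.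
  rewrite <- PSeries_plus.
  - apply PSeries_ext. intros n. pose proof (bcoef_S nu n H) as B.
    unfold PS_plus, PS_scal, PS_derive, plus, scal; cbn -[INR]; unfold mult; cbn -[INR].
    assert (E : bcoef nu n = - (INR (S n) * ((nu + INR (S n)) * bcoef nu (S n)))) by lra.
    destruct n as [| n].
    + rewrite E. unfold PS_incr_1, zero; cbn -[INR]. simpl. ring.
    + rewrite E. cbn -[INR]. rewrite (S_INR (S n)). ring.
  - apply ex_pseries_incr_1, CV_radius_inside.
    rewrite !CV_radius_derive, CV_radius_bcoef by exact H. exact I.
  - apply CV_radius_inside. rewrite CV_radius_bcoef by exact H. exact I.
Qed.

Lemma besselJ_bessel0 (nu x : R) : 0 < x ->
  besselJ nu x = Rpower (x / 2) nu * bessel0 nu (x ^ 2 / 4).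
Proof.
  intros Hx. unfold besselJ, bessel0, PSeries. rewrite <- Series_scal_l.
  apply Series_ext. intros r. fold (bcoef nu r).
  replace (Rpower (x / 2) (nu + 2 * INR r)) with (Rpower (x / 2) nu * (x ^ 2 / 4) ^ r); [ring |].
  rewrite Rpower_plus. f_equal. rewrite <- Rpower_mult, (Rpower_pow r) by apply exp_pos.
  f_equal. pose proof (Rpower_pow 2 (x / 2) ltac:(lra)) as E.
  replace (INR 2) with 2 in E by (simpl; ring). rewrite E. field.
Qed.

Lemma besselJ_succ (nu x : R) : 0 < x ->
  besselJ (nu + 1) x = - (Rpower (x / 2) nu * (x / 2) * bessel1 nu (x ^ 2 / 4)).
Proof.
  intros Hx. rewrite besselJ_bessel0 by exact Hx. rewrite Rpower_plus, Rpower_1 by lra.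
  rewrite Ropp_mult_distr_r. f_equal. unfold bessel0, bessel1.
  rewrite (PSeries_ext (PS_derive (bcoef nu)) (PS_opp (bcoef (nu + 1)))).
  - rewrite PSeries_opp. ring.
  - intros n. apply bcoef_derive.
Qed.

Lemma bessel0_zero (nu a : R) : 0 < a -> besselJ nu a = 0 -> bessel0 nu (a ^ 2 / 4) = 0.
Proof.
  intros Ha H. rewrite besselJ_bessel0 in H by exact Ha.
  apply Rmult_integral in H as [H | H]; [| exact H].
  pose proof (exp_pos (nu * ln (a / 2))). unfold Rpower in H. lra.
Qed.

Lemma is_derive_bessel0_comp (nu A u : R) : -1 < nu ->
  is_derive (fun u => bessel0 nu (A * u ^ 2)) u (2 * A * u * bessel1 nu (A * u ^ 2)).
Proof.
  intros H. evar_last.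
  - apply (is_derive_comp (bessel0 nu) (fun u => A * u ^ 2)).
    + now apply is_derive_bessel0.
    + auto_derive; trivial.
  - unfold scal; simpl; unfold mult; simpl. ring.
Qed.

Lemma is_derive_bessel1_comp (nu A u : R) : -1 < nu ->
  is_derive (fun u => bessel1 nu (A * u ^ 2)) u (2 * A * u * bessel2 nu (A * u ^ 2)).
Proof.
  intros H. evar_last.
  - apply (is_derive_comp (bessel1 nu) (fun u => A * u ^ 2)).
    + now apply is_derive_bessel1.
    + auto_derive; trivial.
  - unfold scal; simpl; unfold mult; simpl. ring.
Qed.

Lemma besselJ_scale (nu a u : R) : 0 < a -> 0 < u ->
  besselJ nu (a * u) = Rpower (a / 2) nu * Rpower u nu * bessel0 nu (a ^ 2 / 4 * u ^ 2).
Proof.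
  intros Ha Hu. rewrite besselJ_bessel0 by now apply Rmult_lt_0_compat.
  replace (a * u / 2) with (a / 2 * u) by field.
  replace ((a * u) ^ 2 / 4) with (a ^ 2 / 4 * u ^ 2) by field.
  rewrite <- Rpower_mult_distr by lra. reflexivity.
Qed.

Lemma continuous_besselJ_scale (nu a u : R) : -1 < nu -> 0 < a -> 0 < u ->
  continuous (fun u => besselJ nu (a * u)) u.
Proof.
  intros Hnu Ha Hu.
  apply continuous_ext_loc with
    (fun u => Rpower (a / 2) nu * exp (nu * ln u) * bessel0 nu (a ^ 2 / 4 * u ^ 2)).
  { exists (mkposreal u Hu). intros v Hv.
    unfold ball in Hv; simpl in Hv; unfold AbsRing_ball, abs, minus, plus, opp in Hv; simpl in Hv.
    apply Rabs_lt_between in Hv. symmetry. apply besselJ_scale; lra. }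
  apply (ex_derive_continuous
    (fun u => Rpower (a / 2) nu * exp (nu * ln u) * bessel0 nu (a ^ 2 / 4 * u ^ 2))).
  auto_derive. split; [exact Hu |]. split; [| trivial].
  eexists. now apply is_derive_bessel0.
Qed.

Lemma filterlim_Rpower_0 (p : R) : 0 < p ->
  filterlim (fun u => Rpower u p) (at_right 0) (locally 0).
Proof.
  intros Hp. unfold Rpower.
  apply (filterlim_comp _ _ _ (fun u => p * ln u) exp (at_right 0) (Rbar_locally' m_infty)).
  - assert (E : Rbar_mult p m_infty = m_infty).
    { simpl. destruct (Rle_dec 0 p) as [h | h]; [| exfalso; lra].
      destruct (Rle_lt_or_eq_dec 0 p h); [reflexivity | exfalso; lra]. }
    intros P HP. change (Rbar_locally m_infty P) in HP.
    destruct HP as [M HM].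
    exists (mkposreal (exp (M / p)) (exp_pos _)). intros u Hu Hu0.
    unfold ball in Hu; simpl in Hu; unfold AbsRing_ball, abs, minus, plus, opp in Hu; simpl in Hu.
    apply Rabs_lt_between in Hu. apply HM.
    assert (ln u < M / p) by (rewrite <- (ln_exp (M / p)); apply ln_increasing; lra).
    apply Rmult_lt_compat_l with (r := p) in H; [| exact Hp].
    replace (p * (M / p)) with M in H by (field; lra). exact H.
  - apply is_lim_exp_m.
Qed.

Lemma filterlim_Rpower_mult_0 (p : R) (g : R -> R) : 0 < p -> continuous g 0 ->
  filterlim (fun u => Rpower u p * g u) (at_right 0) (locally 0).
Proof.
  intros Hp Hg.
  cut (filterlim (fun u => Rpower u p * g u) (at_right 0) (locally (0 * g 0))).
  { now rewrite Rmult_0_l. }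
  apply (filterlim_comp_2 (F := at_right 0) (fun u => Rpower u p) g Rmult
    (G := locally 0) (H := locally (g 0)) (I := locally (0 * g 0))).
  - now apply filterlim_Rpower_0.
  - apply (filterlim_filter_le_1 (F := locally 0)); [apply filter_le_within | exact Hg].
  - apply (filterlim_mult (K := R_AbsRing)).
Qed.

Lemma is_derive_Rpower_mult (p u : R) (g : R -> R) (dg : R) : 0 < u -> is_derive g u dg ->
  is_derive (fun u => Rpower u p * g u) u (Rpower u p * (p * g u + u * dg) / u).
Proof.
  intros Hu Hg. unfold Rpower.
  assert (D : Derive g u = dg) by now apply is_derive_unique.
  auto_derive.
  - repeat split; try lra. now exists dg.
  - rewrite <- D. change (Derive (fun x : R => g x) u) with (Derive g u). field. lra.
Qed.

(** With [v = J_nu (a u)] and [w = J_nu (b u)], the primitive is the Wronskian expression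
    [u (v' w - v w') / (b^2 - a^2)]. The terms in [nu u^(nu-1)] cancel, which leaves [u^(2 nu + 2)]
    times a continuous function; the exponent is positive exactly when [nu > -1]. *)
Lemma bessel_cross_primitive (nu a b : R) : -1 < nu -> 0 < a -> 0 < b -> a <> b ->
  besselJ nu a = 0 -> besselJ nu b = 0 ->
  exists H : R -> R,
    (forall u, 0 < u -> is_derive H u (besselJ nu (a * u) * besselJ nu (b * u) * u)) /\
    H 1 = 0 /\ filterlim H (at_right 0) (locally 0).
Proof.
  intros Hnu Ha Hb Hab Ja Jb.
  set (A := a ^ 2 / 4). set (B := b ^ 2 / 4).
  assert (HAB : B - A <> 0).
  { unfold A, B. intros E. apply Hab.
    assert (F : (b - a) * (b + a) = 0) by lra. apply Rmult_integral in F. lra. }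
  pose proof (bessel0_zero nu a Ha Ja) as Za. fold A in Za.
  pose proof (bessel0_zero nu b Hb Jb) as Zb. fold B in Zb.
  set (K := Rpower (a / 2) nu * Rpower (b / 2) nu / (2 * (B - A))).
  set (g := fun u => K * (A * bessel1 nu (A * u ^ 2) * bessel0 nu (B * u ^ 2)
                        - B * bessel1 nu (B * u ^ 2) * bessel0 nu (A * u ^ 2))).
  assert (Dg : forall u, is_derive g u (K * (
     (A * (2 * A * u * bessel2 nu (A * u ^ 2)) * bessel0 nu (B * u ^ 2)
      + A * bessel1 nu (A * u ^ 2) * (2 * B * u * bessel1 nu (B * u ^ 2)))
     - (B * (2 * B * u * bessel2 nu (B * u ^ 2)) * bessel0 nu (A * u ^ 2)
      + B * bessel1 nu (B * u ^ 2) * (2 * A * u * bessel1 nu (A * u ^ 2)))))).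
  { intros u. unfold g.
    pose proof (is_derive_bessel0_comp nu A u Hnu) as D1. pose proof (is_derive_bessel0_comp nu B u Hnu) as D2.
    pose proof (is_derive_bessel1_comp nu A u Hnu) as D3. pose proof (is_derive_bessel1_comp nu B u Hnu) as D4.
    set (fA0 := fun u => bessel0 nu (A * u ^ 2)) in *. set (fB0 := fun u => bessel0 nu (B * u ^ 2)) in *.
    set (fA1 := fun u => bessel1 nu (A * u ^ 2)) in *. set (fB1 := fun u => bessel1 nu (B * u ^ 2)) in *.
    apply is_derive_ext with (fun u => K * (A * fA1 u * fB0 u - B * fB1 u * fA0 u)); [reflexivity |].
    auto_derive.
    - repeat split; eexists; eassumption.
    - change (Derive (fun x : R => fA0 x) u) with (Derive fA0 u).
      change (Derive (fun x : R => fA1 x) u) with (Derive fA1 u).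
      change (Derive (fun x : R => fB0 x) u) with (Derive fB0 u).
      change (Derive (fun x : R => fB1 x) u) with (Derive fB1 u).
      assert (E1 : Derive fA0 u = 2 * A * u * bessel1 nu (A * u ^ 2)) by exact (is_derive_unique _ _ _ D1).
      assert (E2 : Derive fB0 u = 2 * B * u * bessel1 nu (B * u ^ 2)) by exact (is_derive_unique _ _ _ D2).
      assert (E3 : Derive fA1 u = 2 * A * u * bessel2 nu (A * u ^ 2)) by exact (is_derive_unique _ _ _ D3).
      assert (E4 : Derive fB1 u = 2 * B * u * bessel2 nu (B * u ^ 2)) by exact (is_derive_unique _ _ _ D4).
      rewrite E1, E2, E3, E4.
      unfold fA0, fA1, fB0, fB1. ring. }
  exists (fun u => Rpower u (2 * nu + 2) * g u). split; [| split].
  - intros u Hu. evar_last; [apply (is_derive_Rpower_mult _ _ g _ Hu (Dg u)) |].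
    rewrite !besselJ_scale by assumption. fold A B. unfold g.
    pose proof (bessel_ode nu (A * u ^ 2) Hnu) as OA. pose proof (bessel_ode nu (B * u ^ 2) Hnu) as OB.
    replace (2 * nu + 2) with (nu + (nu + INR 2)) by (simpl; ring).
    rewrite !Rpower_plus, Rpower_pow by exact Hu. unfold K.
    set (E0A := bessel0 nu (A * u ^ 2)) in *. set (E0B := bessel0 nu (B * u ^ 2)) in *.
    set (E1A := bessel1 nu (A * u ^ 2)) in *. set (E1B := bessel1 nu (B * u ^ 2)) in *.
    set (E2A := bessel2 nu (A * u ^ 2)) in *. set (E2B := bessel2 nu (B * u ^ 2)) in *.
    simpl INR.
    (* Regrouped so that second derivatives occur only as [A u^2 E2A] and [B u^2 E2B], the left
       sides of the differential equation. *)
    match goal with |- ?l = ?r => replace l with (Rpower u nu * (Rpower u nu * u) *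
      (Rpower (a / 2) nu * Rpower (b / 2) nu / (B - A)) *
      ((nu + 1) * (A * E1A * E0B - B * E1B * E0A) + A * (A * u ^ 2 * E2A) * E0B - B * (B * u ^ 2 * E2B) * E0A))
      by (field; split; [exact HAB | lra]) end.
    rewrite OA, OB. field. exact HAB.
  - unfold g. rewrite pow1, !Rmult_1_r, Za, Zb. ring.
  - apply filterlim_Rpower_mult_0; [lra |].
    apply (ex_derive_continuous g). eexists. apply Dg.
Qed.

(** With [v = J_nu (a u)], the primitive is [(u^2 v'^2 + (a^2 u^2 - nu^2) v^2) / (2 a^2)]. Its
    [nu^2] terms cancel in terms of [E], again leaving the factor [u^(2 nu + 2)]; at [u = 1] only
    the square of [E'] survives. *)
Lemma bessel_norm_primitive (nu a : R) : -1 < nu -> 0 < a -> besselJ nu a = 0 ->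
  exists H : R -> R,
    (forall u, 0 < u -> is_derive H u (besselJ nu (a * u) ^ 2 * u)) /\
    H 1 = / 2 * besselJ (nu + 1) a ^ 2 /\ filterlim H (at_right 0) (locally 0).
Proof.
  intros Hnu Ha Ja.
  set (A := a ^ 2 / 4).
  pose proof (bessel0_zero nu a Ha Ja) as Za. fold A in Za.
  set (K := / 2 * Rpower (a / 2) nu ^ 2).
  set (g := fun u => K * (nu * bessel0 nu (A * u ^ 2) * bessel1 nu (A * u ^ 2)
     + A * u ^ 2 * bessel1 nu (A * u ^ 2) ^ 2 + bessel0 nu (A * u ^ 2) ^ 2)).
  assert (Dg : forall u, is_derive g u (K * (2 * A * u) * (
     nu * (bessel1 nu (A * u ^ 2) ^ 2 + bessel0 nu (A * u ^ 2) * bessel2 nu (A * u ^ 2))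
     + bessel1 nu (A * u ^ 2) ^ 2 + 2 * (A * u ^ 2) * bessel1 nu (A * u ^ 2) * bessel2 nu (A * u ^ 2)
     + 2 * bessel0 nu (A * u ^ 2) * bessel1 nu (A * u ^ 2)))).
  { intros u. unfold g.
    pose proof (is_derive_bessel0_comp nu A u Hnu) as D1.
    pose proof (is_derive_bessel1_comp nu A u Hnu) as D3.
    set (f0 := fun u => bessel0 nu (A * u ^ 2)) in *. set (f1 := fun u => bessel1 nu (A * u ^ 2)) in *.
    apply is_derive_ext with (fun u => K * (nu * f0 u * f1 u + A * u ^ 2 * f1 u ^ 2 + f0 u ^ 2)); [reflexivity |].
    auto_derive.
    - repeat split; eexists; eassumption.
    - change (Derive (fun x : R => f0 x) u) with (Derive f0 u).
      change (Derive (fun x : R => f1 x) u) with (Derive f1 u).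
      assert (E1 : Derive f0 u = 2 * A * u * bessel1 nu (A * u ^ 2)) by exact (is_derive_unique _ _ _ D1).
      assert (E2 : Derive f1 u = 2 * A * u * bessel2 nu (A * u ^ 2)) by exact (is_derive_unique _ _ _ D3).
      rewrite E1, E2.
      unfold f0, f1. ring. }
  exists (fun u => Rpower u (2 * nu + 2) * g u). split; [| split].
  - intros u Hu. evar_last; [apply (is_derive_Rpower_mult _ _ g _ Hu (Dg u)) |].
    rewrite !besselJ_scale by assumption. fold A. unfold g.
    pose proof (bessel_ode nu (A * u ^ 2) Hnu) as OA.
    replace (2 * nu + 2) with (nu + (nu + INR 2)) at 1 by (simpl; ring).
    rewrite !Rpower_plus, Rpower_pow by exact Hu. unfold K.
    set (E0 := bessel0 nu (A * u ^ 2)) in *. set (E1 := bessel1 nu (A * u ^ 2)) in *.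
    set (E2 := bessel2 nu (A * u ^ 2)) in *.
    match goal with |- ?l = ?r => replace l with (Rpower u nu ^ 2 * Rpower (a / 2) nu ^ 2 * u *
      ((nu + 1) * (nu * E0 * E1 + A * u ^ 2 * E1 ^ 2 + E0 ^ 2)
       + (nu * (A * u ^ 2) * E1 ^ 2 + nu * E0 * (A * u ^ 2 * E2) + A * u ^ 2 * E1 ^ 2
          + 2 * (A * u ^ 2) * E1 * (A * u ^ 2 * E2) + 2 * (A * u ^ 2) * E0 * E1)))
      by (field; lra) end.
    assert (OA' : A * u ^ 2 * E2 = - (nu + 1) * E1 - E0) by exact OA.
    rewrite OA'. ring.
  - unfold g. rewrite pow1, !Rmult_1_r, Za, besselJ_succ by exact Ha. fold A.
    unfold Rpower at 1. rewrite ln_1, Rmult_0_r, exp_0. unfold K, A. field.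
  - apply filterlim_Rpower_mult_0; [lra |].
    apply (ex_derive_continuous g). eexists. apply Dg.
Qed.

(** * Orthogonality along the ladder *)

(** On [[c, b]] with [c > a] this is the fundamental theorem for [H (p t - T)]. Only the left end is
    improper, and there the vanishing limit of [H] gives the value. *)
Lemma is_integral_substitution (g H p : R -> R) (a b T v : R) : a < b ->
  (forall u, 0 < u -> is_derive H u (g u)) -> (forall u, 0 < u -> continuous g u) ->
  filterlim H (at_right 0) (locally 0) -> H (p b - T) = v ->
  p a = T -> (forall t t', a <= t -> t < t' -> t' <= b -> p t < p t') ->
  (forall t, a <= t <= b -> ex_derive p t) -> (forall t, a <= t <= b -> continuous (Derive p) t) ->
  is_integral (fun t => g (p t - T) * Derive p t) a b v.
Proof.
  intros Hab HH Hg H0 Hv Ha Hinc Hd Hc.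
  assert (Pos : forall t, a < t <= b -> 0 < p t - T).
  { intros t Ht. pose proof (Hinc a t (Rle_refl a) ltac:(lra) ltac:(lra)). lra. }
  assert (Cp : forall t, a <= t <= b -> continuous p t).
  { intros t Ht. apply (ex_derive_continuous p). now apply Hd. }
  assert (INT : forall c, a < c < b -> is_RInt (fun t => g (p t - T) * Derive p t) c b (v - H (p c - T))).
  { intros c Hcb. rewrite <- Hv.
    apply (is_RInt_derive (V := R_CompleteNormedModule) (fun t => H (p t - T)) (fun t => g (p t - T) * Derive p t)).
    - intros t. rewrite Rmin_left, Rmax_right by lra. intros Ht. evar_last.
      + apply (is_derive_comp H (fun t => p t - T)).
        * apply HH, Pos. lra.
        * apply (is_derive_minus (V := R_NormedModule) p (fun _ => T) t (Derive p t) 0).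
          -- apply Derive_correct, Hd. lra.
          -- apply (is_derive_const (V := R_NormedModule)).
      + unfold scal, minus, plus, opp; simpl; unfold mult; simpl. ring.
    - intros t. rewrite Rmin_left, Rmax_right by lra. intros Ht.
      apply (continuous_mult (K := R_AbsRing) (fun t => g (p t - T)) (Derive p)); [| apply Hc; lra].
      apply (continuous_comp (fun t => p t - T) g); [| apply Hg, Pos; lra].
      apply (continuous_minus (V := R_NormedModule) p (fun _ => T)); [apply Cp; lra | apply continuous_const]. }
  assert (L : filterlim (fun c => v - H (p c - T)) (at_right a) (locally v)).
  { assert (L1 : filterlim (fun c => p c - T) (at_right a) (at_right 0)).
    { intros P [e He].
      assert (Ca : continuous p a) by (apply Cp; lra).
      destruct (proj1 (filterlim_locally p (p a)) Ca e) as [d Hd'].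
      assert (Pd : 0 < Rmin d (b - a)) by (apply Rmin_case; [apply cond_pos | lra]).
      exists (mkposreal _ Pd). intros c Hc1 Hc2.
      change (Rabs (c - a) < Rmin d (b - a)) in Hc1.
      pose proof (Rmin_l d (b - a)). pose proof (Rmin_r d (b - a)).
      assert (Hc3 : Rabs (c - a) < d) by lra.
      apply Rabs_lt_between in Hc1.
      apply He; [| apply Pos; lra].
      specialize (Hd' c Hc3). change (Rabs (p c - p a) < e) in Hd'.
      change (Rabs (p c - T - 0) < e). rewrite Rminus_0_r, <- Ha. exact Hd'. }
    pose proof (filterlim_comp _ _ _ _ _ _ _ _ L1 H0) as L2.
    cut (filterlim (fun c => v - H (p c - T)) (at_right a) (locally (v - 0))).
    { now rewrite Rminus_0_r. }
    apply (filterlim_comp_2 (F := at_right a) (fun _ => v) (fun c => H (p c - T)) Rminus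
      (G := locally v) (H := locally 0) (I := locally (v - 0))).
    - apply filterlim_const.
    - exact L2.
    - apply (filterlim_comp_2 (F := filter_prod (locally v) (locally 0)) fst (fun z => - snd z) Rplus
        (G := locally v) (H := locally (- 0)) (I := locally (v + - 0))).
      + apply filterlim_fst.
      + apply (filterlim_comp _ _ _ snd Ropp _ (locally 0)); [apply filterlim_snd |].
        apply (filterlim_opp (V := R_NormedModule)).
      + apply (filterlim_plus (V := R_NormedModule)). }
  intros P HP. specialize (L P HP).
  apply Filter_prod with (fun c => a < c < b /\ P (v - H (p c - T))) (fun y => y = b).
  - apply filter_and; [| exact L].
    assert (Pd : 0 < b - a) by lra.
    exists (mkposreal _ Pd). intros c Hc1 Hc2. change (Rabs (c - a) < b - a) in Hc1.
    apply Rabs_lt_between in Hc1. lra.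
  - reflexivity.
  - intros c y [Hcb HPc] ->. exists (v - H (p c - T)). split; [now apply INT | exact HPc].
Qed.

Lemma set_dist_segments (a b : R) : 1 <= a -> a <= b ->
  set_dist (segment 0 1) (segment a b) = a - 1.
Proof.
  intros Ha Hab. unfold set_dist.
  rewrite (is_glb_Rbar_unique _ (Finite (a - 1))); [reflexivity |]. split.
  - intros d [x [y [Hx [Hy ->]]]]. unfold segment in *. simpl.
    rewrite Rabs_left1 by lra. lra.
  - intros l Hl. apply Hl. exists 1, a. unfold segment. repeat split; try lra.
    rewrite Rabs_left1 by lra. ring.
Qed.

Lemma inverse_from_spec (f : R -> R) (a y : R) : (exists t, a <= t /\ f t = y) ->
  a <= inverse_from f a y /\ f (inverse_from f a y) = y.
Proof. exact (epsilon_spec (inhabits 0) (fun t => a <= t /\ f t = y)). Qed.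

(** [inverse_from] may choose any solution beyond [T1], whereas [phi] is known to be regular only
    beyond [T2]. The bound on [T] ensures that a solution exists and that the chosen one lies beyond
    [T2]. *)
Lemma ladder_inverse (mu : R -> R) (y0 : R) (phi : R -> R) (T1 : R) :
  ladder_bound mu y0 -> jacobs_ladder mu y0 phi T1 ->
  exists T2, T1 <= T2 /\
    (forall t t', T2 <= t -> t < t' -> phi t < phi t') /\
    (forall t, T2 < t -> ex_derive phi t /\ continuous (Derive phi) t) /\
    0 < phi (T2 + 1) /\
    forall T, phi (T2 + 1) / 2 <= T ->
      let r := inverse_from (fun t => phi t / 2) T1 T in T2 < r /\ phi r / 2 = T.
Proof.
  intros Hmu HJ.
  destruct (ladder_regular mu y0 phi T1 Hmu HJ) as [T2 [H12 [RG [ST DR]]]].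
  exists T2. split; [exact H12 | split; [exact ST | split; [| split]]].
  - intros t Ht. split; [eexists; now apply DR |].
    destruct (RG t ltac:(lra)) as [R1 R2].
    apply continuous_ext_loc with (fun t => hardyZ2 t * / dlaplace mu (phi t)).
    { assert (P : 0 < t - T2) by lra. exists (mkposreal _ P). intros u Hu.
      change (Rabs (u - t) < t - T2) in Hu. apply Rabs_lt_between in Hu.
      symmetry. apply is_derive_unique, DR. lra. }
    apply (continuous_mult (K := R_AbsRing) hardyZ2 (fun t => / dlaplace mu (phi t))); [apply hardyZ2_continuous |].
    apply (continuous_comp (fun t => dlaplace mu (phi t)) Rinv).
    + apply (continuous_comp phi (dlaplace mu)).
      * apply (ex_derive_continuous phi). eexists. now apply DR.
      * now apply (continuous_dlaplace mu y0).
    + apply (ex_derive_continuous Rinv). auto_derive.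
      apply Rgt_not_eq. now apply (dlaplace_pos mu y0).
  - destruct (RG (T2 + 1) ltac:(lra)). lra.
  - intros T HT. cbv zeta.
    destruct (inverse_from_spec (fun t => phi t / 2) T1 T) as [S1 S2].
    + destruct (ladder_to_infinity mu y0 phi T1 (2 * T) Hmu HJ) as [T3 [_ H3]].
      set (M := Rmax T3 (T2 + 2)). specialize (H3 M (Rmax_l _ _)).
      assert (HM : T2 + 2 <= M) by apply Rmax_r.
      destruct (Ranalysis5.f_interv_is_interv (fun t => phi t / 2) (T2 + 1) M T) as [x [Hx Ex]].
      * lra.
      * lra.
      * intros x Hx. apply continuity_pt_filterlim, (ex_derive_continuous (fun t => phi t / 2)).
        auto_derive. eexists. apply DR. lra.
      * exists x. split; [lra | exact Ex].
    + split; [| exact S2].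
      set (r := inverse_from (fun t => phi t / 2) T1 T) in *. cbv beta in S2.
      (* A solution [r <= T2] would have [phi r > phi T2]; applying [F] gives
         [meansq r > meansq T2], against monotonicity. *)
      destruct (Rlt_le_dec T2 r) as [| C]; [assumption |]. exfalso.
      pose proof (ST T2 (T2 + 1) (Rle_refl _) ltac:(lra)) as S.
      assert (C2 : phi T2 < phi r) by lra.
      destruct (RG T2 (Rle_refl _)) as [R1 R2].
      pose proof (laplace_strict mu y0 _ _ Hmu R1 R2 C2) as LS.
      rewrite !(ladder_eq mu y0 phi T1 _ HJ) in LS by lra.
      pose proof (meansq_mono r T2 C). lra.
Qed.

Lemma continuous_bessel_product (nu a b u : R) : -1 < nu -> 0 < a -> 0 < b -> 0 < u ->
  continuous (fun u => besselJ nu (a * u) * besselJ nu (b * u) * u) u.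
Proof.
  intros Hnu Ha Hb Hu.
  apply (continuous_mul_id (fun u => besselJ nu (a * u) * besselJ nu (b * u))).
  apply (continuous_mult (K := R_AbsRing) (fun u => besselJ nu (a * u)) (fun u => besselJ nu (b * u)));
    now apply continuous_besselJ_scale.
Qed.

Theorem theorem1 :
  forall (mu : R -> R) (y0 : R) (phi : R -> R) (T1 : R),
    ladder_bound mu y0 ->
    jacobs_ladder mu y0 phi T1 ->
    let phi1 := fun t : R => phi t / 2 in
    let Ztilde2 := Derive phi1 in
    let ring := inverse_from phi1 T1 in
    (exists T0 : R, 0 < T0 /\
      forall T : R, T0 <= T ->
        (T1 <= ring T /\ ring T < ring (T + 1)) /\
        (phi1 (ring T) = T /\ phi1 (ring (T + 1)) = T + 1) /\
        (forall u : R, segment T (T + 1) u <->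
           exists t : R, segment (ring T) (ring (T + 1)) t /\ phi1 t = u) /\
        (forall t : R, segment (ring T) (ring (T + 1)) t ->
           ex_derive phi1 t /\ 0 <= phi1 t - T <= 1) /\
        forall (nu : R) (j : nat -> R), -1 < nu -> bessel_zeros nu j ->
          (forall m n : nat, (1 <= m)%nat -> (1 <= n)%nat -> m <> n ->
             is_integral
               (fun t => besselJ nu (j m * (phi1 t - T))
                         * besselJ nu (j n * (phi1 t - T))
                         * (phi1 t - T) * Ztilde2 t)
               (ring T) (ring (T + 1)) 0) /\
          (forall n : nat, (1 <= n)%nat ->
             is_integral
               (fun t => besselJ nu (j n * (phi1 t - T)) ^ 2
                         * (phi1 t - T) * Ztilde2 t)
               (ring T) (ring (T + 1))
               (/ 2 * besselJ (nu + 1) (j n) ^ 2))) /\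
    asymp_equiv
      (fun T => set_dist (segment 0 1) (segment (ring T) (ring (T + 1))))
      (fun T => T).
Proof.
  intros mu y0 phi T1 Hmu HJ phi1 Ztilde2 ring.
  destruct (ladder_inverse mu y0 phi T1 Hmu HJ) as [T2 [H12 [ST [DR [P0 INV]]]]].
  (* [T2 + 1] and not [T2]: the intermediate value argument needs a left end inside the open ray
     where [phi] is differentiable. *)
  set (T0 := phi1 (T2 + 1)).
  assert (PT0 : 0 < T0) by (unfold T0, phi1; lra).
  assert (INV1 : forall T, T0 <= T -> T2 < ring T /\ phi1 (ring T) = T) by exact INV.
  clear INV.
  assert (ST1 : forall t t', T2 <= t -> t < t' -> phi1 t < phi1 t').
  { intros t t' Ht Htt. pose proof (ST t t' Ht Htt). unfold phi1. lra. }
  assert (MONO : forall T T', T0 <= T -> T < T' -> ring T < ring T').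
  { intros T T' HT HTT. destruct (INV1 T HT) as [A1 A2]. destruct (INV1 T' ltac:(lra)) as [B1 B2].
    destruct (Rlt_le_dec (ring T) (ring T')) as [| [C | C]]; [assumption | |]; exfalso.
    - pose proof (ST1 _ _ (Rlt_le _ _ B1) C). lra.
    - rewrite C in B2. lra. }
  assert (EX1 : forall t, T2 < t -> ex_derive phi1 t).
  { intros t Ht. unfold phi1. auto_derive. now apply DR. }
  assert (DE1 : forall t, T2 < t -> continuous (Derive phi1) t).
  { intros t Ht. apply continuous_ext with (fun t => scal (/ 2) (Derive phi t)).
    - intros u. symmetry. unfold phi1. rewrite (Derive_ext _ (fun t => / 2 * phi t)).
      + apply Derive_scal.
      + intros w. unfold Rdiv. apply Rmult_comm.
    - apply (continuous_scal_r (V := R_NormedModule) (/ 2) (Derive phi)). now apply DR. }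
  split.
  - exists T0. split; [exact PT0 |]. intros T HT.
    destruct (INV1 T HT) as [A1 A2]. destruct (INV1 (T + 1) ltac:(lra)) as [B1 B2].
    pose proof (MONO T (T + 1) HT ltac:(lra)) as AB.
    assert (SEG : forall t, segment (ring T) (ring (T + 1)) t -> T <= phi1 t <= T + 1).
    { intros t [S1 S2]. split.
      - destruct S1 as [S1 | <-]; [| lra]. pose proof (ST1 _ _ (Rlt_le _ _ A1) S1). lra.
      - destruct S2 as [S2 | ->]; [| lra]. pose proof (ST1 t (ring (T + 1)) ltac:(lra) S2). lra. }
    split; [split; [lra | exact AB] |].
    split; [split; [exact A2 | exact B2] |].
    split.
    { intros u. split.
      - intros [U1 U2]. exists (ring u). split; [| apply INV1; lra]. split.
        + destruct U1 as [U1 | <-]; [left; now apply MONO | lra].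
        + destruct U2 as [U2 | ->]; [left; apply MONO; lra | lra].
      - intros [t [S <-]]. exact (SEG t S). }
    split.
    { intros t S. split; [apply EX1; destruct S; lra |]. pose proof (SEG t S). lra. }
    intros nu j Hnu Hj.
    assert (SUB : forall g H v, (forall u, 0 < u -> is_derive H u (g u)) ->
      (forall u, 0 < u -> continuous g u) -> filterlim H (at_right 0) (locally 0) -> H 1 = v ->
      is_integral (fun t => g (phi1 t - T) * Derive phi1 t) (ring T) (ring (T + 1)) v).
    { intros g H v H1 H2 H3 H4. apply is_integral_substitution with H; try assumption.
      - rewrite B2. replace (T + 1 - T) with 1 by ring. exact H4.
      - intros t t' Ht1 Ht2 _. apply ST1; lra.
      - intros t Ht. apply EX1. lra.
      - intros t Ht. apply DE1. lra. }
    assert (NE : forall m n, (1 <= m)%nat -> (1 <= n)%nat -> m <> n -> j m <> j n).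
    { intros m n Hm Hn Hmn. destruct (Nat.lt_trichotomy m n) as [C | [C | C]]; [| contradiction |].
      - pose proof (bz_increasing _ _ Hj m n ltac:(lia)). lra.
      - pose proof (bz_increasing _ _ Hj n m ltac:(lia)). lra. }
    split.
    + intros m n Hm Hn Hmn.
      destruct (bz_zero _ _ Hj m Hm) as [Pm Zm]. destruct (bz_zero _ _ Hj n Hn) as [Pn Zn].
      destruct (bessel_cross_primitive nu (j m) (j n) Hnu Pm Pn (NE m n Hm Hn Hmn) Zm Zn)
        as [H [D1 [D2 D3]]].
      apply (SUB (fun u => besselJ nu (j m * u) * besselJ nu (j n * u) * u) H); try assumption.
      intros u Hu. now apply continuous_bessel_product.
    + intros n Hn. destruct (bz_zero _ _ Hj n Hn) as [Pn Zn].
      destruct (bessel_norm_primitive nu (j n) Hnu Pn Zn) as [H [D1 [D2 D3]]].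
      apply (SUB (fun u => besselJ nu (j n * u) ^ 2 * u) H); try assumption.
      intros u Hu. apply continuous_ext with (fun u => besselJ nu (j n * u) * besselJ nu (j n * u) * u).
      * intros w. simpl. now rewrite Rmult_1_r.
      * now apply continuous_bessel_product.
  - unfold asymp_equiv. apply is_lim_spec. intros eps.
    pose proof (cond_pos eps) as Peps.
    set (d := Rmin (1 / 2) (eps / 4)).
    assert (Hd : 0 < d <= 1 / 2) by (unfold d; split; [apply Rmin_case; lra | apply Rmin_l]).
    assert (Hde : d <= eps / 4) by apply Rmin_r.
    destruct (ladder_asymptotic mu y0 phi T1 d Hmu HJ ltac:(lra)) as [T3 [_ HA]].
    set (T4 := Rmax T3 (Rmax (T2 + 1) 1)).
    assert (H43 : T3 <= T4) by apply Rmax_l.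
    assert (H42 : T2 + 1 <= T4) by (eapply Rle_trans; [apply Rmax_l | apply Rmax_r]).
    assert (H41 : 1 <= T4) by (eapply Rle_trans; [apply Rmax_r | apply Rmax_r]).
    (* Exceeding [phi1 T4] forces [ring T >= T4], where the asymptotics of the ladder apply;
       exceeding [2 / eps] absorbs the [1] in the distance [ring T - 1]. *)
    exists (Rmax (Rmax T0 (phi1 T4)) (Rmax 1 (2 / eps))). intros T HT.
    pose proof (Rmax_l (Rmax T0 (phi1 T4)) (Rmax 1 (2 / eps))).
    pose proof (Rmax_r (Rmax T0 (phi1 T4)) (Rmax 1 (2 / eps))).
    pose proof (Rmax_l T0 (phi1 T4)). pose proof (Rmax_r T0 (phi1 T4)).
    pose proof (Rmax_l 1 (2 / eps)). pose proof (Rmax_r 1 (2 / eps)).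
    destruct (INV1 T ltac:(lra)) as [A1 A2].
    pose proof (MONO T (T + 1) ltac:(lra) ltac:(lra)) as AB.
    assert (R4 : T4 <= ring T).
    { destruct (Rle_lt_dec T4 (ring T)) as [| C]; [assumption |].
      pose proof (ST1 (ring T) T4 ltac:(lra) C). lra. }
    rewrite set_dist_segments by lra.
    specialize (HA (ring T) ltac:(lra)). fold (phi1 (ring T)) in HA. rewrite A2 in HA.
    apply Rabs_le_between in HA. set (r := ring T) in *.
    (* The error [d r] is relative to [r]; since [d <= 1/2] it converts into [2 d T <= eps / 2 * T],
       and the other half of [eps] is left for the [1]. *)
    assert (RB : r <= 2 * T) by nra.
    assert (dr : d * r <= eps / 2 * T) by nra.
    assert (E1 : 2 < eps * T).
    { apply Rmult_lt_reg_r with (/ eps); [now apply Rinv_0_lt_compat |].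
      replace (eps * T * / eps) with T by (field; lra). unfold Rdiv in *. lra. }
    replace ((r - 1) / T - 1) with ((r - 1 - T) / T) by (field; lra).
    unfold Rdiv. rewrite Rabs_mult, (Rabs_pos_eq (/ T)) by (left; apply Rinv_0_lt_compat; lra).
    apply Rlt_div_l; [lra |].
    apply Rabs_lt_between. lra.
Qed.
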